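(* Let $\mathcal L$ be a good cocycle, suppose that $\|\varphi\|_K:=\operatorname{ess\,sup}_{\omega\in\Omega}\big(K(\omega)\|\varphi_\omega\|_{BV}\big)<\infty$ and that there are positive constants $c_1,c_2,\eta$ such that $\alpha_n\le c_1e^{-c_2n^\eta}$ for every $n$. Set $\gamma=1/\eta$. Then there exists a constant $c_0$, which depends only on $\|\varphi\|_K$ and the constants $c_1,c_2,\eta$, such that for any $k\ge3$ and every $n\in\mathbb N$, $$|\Gamma_k(S_n)|\le n(k!)^{1+\gamma}(c_0)^{k-2},$$ where $\Gamma_k(S_n)$ is the $k$-th cumulant of $S_n$.
   Context: Cumulants. The $k$-th cumulant of a random variable $W$ with finite moments of all orders is $\Gamma_k(W)=\frac1{i^k}\frac{d^k}{dt^k}\big(\ln\mathbb E[e^{itW}]\big)\big|_{t=0}$. Variation. $(X,\mathcal B,m)$ is a probability space with a notion of variation $\mathrm v:L^1(X,m)\to[0,\infty]$ such that: (V1) $\mathrm v(th)=|t|\mathrm v(h)$; (V2) $\mathrm v(g+h)\le \mathrm v(g)+\mathrm v(h)$; (V3) $\|h\|_{L^\infty}\le C_{\mathrm v}(\|h\|_1+\mathrm v(h))$ for some constant $1\le C_{\mathrm v}<\infty$; (V4) for any $C>0$ the set $\{h:X\to\mathbb R:\|h\|_1+\mathrm v(h)\le C\}$ is $L^1(m)$-compact; (V5) $\mathrm v(\mathbf 1)=0$, where $\mathbf 1$ is the constant function $1$; (V6) $\{h:X\to\mathbb R_+:\|h\|_1=1,\ \mathrm v(h)<\infty\}$ is $L^1(m)$-dense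 in $\{h:X\to\mathbb R_+:\|h\|_1=1\}$; (V7) if $f\in L^1(X,m)$ and $\operatorname{ess\,inf}f>0$ then $\mathrm v(1/f)\le \mathrm v(f)/(\operatorname{ess\,inf}f)^2$; (V8) $\mathrm v(fg)\le\|f\|_{L^\infty}\mathrm v(g)+\|g\|_{L^\infty}\mathrm v(f)$; (V9) for $M>0$, $f:X\to[-M,M]$ measurable and $h:[-M,M]\to\mathbb C$ of class $C^1$, $\mathrm v(h\circ f)\le\|h'\|_{L^\infty}\mathrm v(f)$. $BV=\{g\in L^1(X,m):\mathrm v(g)<\infty\}$ is a Banach space with norm $\|g\|_{BV}=\|g\|_1+\mathrm v(g)$. Base map and random maps. $(\xi_n)_{n\in\mathbb Z}$ is a two-sided stationary sequence with values in a measurable space $\mathcal Y$; $\Omega=\mathcal Y^{\mathbb Z}$, $\mathbb P$ is the law of $(\xi_n)$ on $\Omega$, $\sigma((\omega_j)_j)=(\omega_{j+1})_j$ is the left shift, and $(\Omega,\mathcal F,\mathbb P,\sigma)$ is an invertible ergodic measure preserving system. $T_\omega:X\to X$, $\omega\in\Omega$, are non-singular maps ($m\circ T_\omega^{-1}\ll m$) with $T_\omega=T_{\omega_0}$ depending only on the $0$-th coordinate, such that the skew product $\tau(\omega,x)=(\sigma\omega,T_\omega x)$ is measurable. $T_\omega^n=T_{\sigma^{n-1}\omega}\circ\cdots\circ T_\omega$. The transfer operator $\mathcal L_\omega$ on $L^1(X,m)$ is given by $\int(\mathcal L_\omega f)g\,dm=\int f\,(g\circ T_\omega)\,dm$ for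 $f\in L^1,g\in L^\infty$, and $\mathcal L_\omega^n=\mathcal L_{\sigma^{n-1}\omega}\circ\cdots\circ\mathcal L_\omega$. Tempered: a measurable $Q:\Omega\to(0,\infty)$ is tempered if $\lim_{n\to\pm\infty}\frac1n\log Q(\sigma^n\omega)=0$ for $\mathbb P$-a.e. $\omega$. Good cocycle: $\mathcal L=(\mathcal L_\omega)_{\omega\in\Omega}$ is good if: (1) $\Omega$ is a Borel subset of a separable complete metric space, $\sigma$ is a homeomorphism, and $\Omega$ is a countable union of measurable sets on each of which $\omega\mapsto\mathcal L_\omega$ is continuous; (2) there is a tempered $N(\omega)$ with $\mathrm v(g\circ T_\omega)\le N(\omega)\mathrm v(g)$ for a.e. $\omega$ and all $g\in BV$; (3) there is a random variable $C:\Omega\to(0,\infty)$ with $\log C\in L^1(\mathbb P)$ and $\|\mathcal L_\omega h\|_{BV}\le C(\omega)\|h\|_{BV}$ for a.e. $\omega$ and all $h\in BV$; (4) there are $N\in\mathbb N$ and random variables $\alpha^N,K^N:\Omega\to(0,\infty)$ with $\int\log\alpha^N d\mathbb P<0$, $\log K^N\in L^1(\mathbb P)$ and $\mathrm v(\mathcal L^N_\omega h)\le\alpha^N(\omega)\mathrm v(h)+K^N(\omega)\|h\|_1$ for a.e. $\omega$ and all $h\in BV$; (5) for each $a>0$ and a.e. $\omega$ there are a random number $n_c(\omega)<\infty$ and positive random numbers $\alpha_0(\omega),\alpha_1(\omega),\dots$ such that $\operatorname{ess\,inf}_x(\mathcal L_\omega^nh)(x)\ge\alpha_n(\omega)\|h\|_1$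 for $n\ge n_c(\omega)$ and every $h\in L^\infty(X,m)$ with $h\ge0$, $\mathrm v(h)\le a\|h\|_1$; (6) $\log(\operatorname{ess\,inf}_x(\mathcal L_\omega\mathbf 1)(x))\in L^1(\mathbb P)$. Known facts fixing notation. For a good cocycle there is an essentially unique measurable family $h_\omega\in BV$, $h_\omega\ge0$, $\int h_\omega dm=1$, $\mathcal L_\omega h_\omega=h_{\sigma\omega}$ a.s.; $\|1/h_\omega\|_{BV}$ is tempered. Put $d\mu_\omega=h_\omega dm$, $\mu=\int\mu_\omega\,d\mathbb P(\omega)$ (a $\tau$-invariant probability measure on $\Omega\times X$), and $L_\omega^ng=\mathcal L_\omega^n(gh_\omega)/h_{\sigma^n\omega}$. With $\Pi(\omega)g=g-(\int g\,dm)h_\omega$ and $\tilde\Pi(\omega)g=g-\mu_\omega(g)$, there are $\lambda>0$ and tempered random variables $D,\tilde D$ such that, a.s. and for all $n\in\mathbb N$, $\|\mathcal L_\omega^n\Pi(\omega)\|_{BV}\le D(\omega)e^{-\lambda n}$, $\|\mathcal L^n_\omega(\mathrm{Id}-\Pi(\omega))\|_{BV}\le D(\omega)e^{\epsilon' n}$ (for a fixed $\epsilon'>0$, with $D$ depending on $\epsilon'$), $\|L_\omega^n\tilde\Pi(\omega)\|_{BV}\le\tilde D(\omega)e^{-\lambda n}$, $\|L_\omega^n(\mathrm{Id}-\tilde\Pi(\omega))\|_{BV}\le\tilde D(\omega)$. Set $\tilde K(\omega)=\max(D(\omega),\tilde D(\omega),N(\omega),\|1/h_\omega\|_{BV})$,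 fix $0<\varepsilon<\lambda/3$, and let $K:\Omega\to(1,\infty)$ be a tempered random variable with $1/K(\omega)\le\tilde K(\omega)\le K(\omega)$ and $K(\omega)e^{-\varepsilon|n|}\le K(\sigma^n\omega)\le K(\omega)e^{\varepsilon|n|}$ for a.e. $\omega$ and all $n\in\mathbb Z$ (such $K$ exists). Observable. $\varphi:\Omega\times X\to\mathbb R$ is measurable, $\int\varphi\,d\mu=0$, and $\varphi_\omega=\varphi(\omega,\cdot)$ depends on $\omega$ only through $\omega_0$. $S_n=\sum_{j=0}^{n-1}\varphi\circ\tau^j$, viewed as random variables on $(\Omega\times X,\mu)$; $\mathbb E$ is expectation with respect to $\mu$ (so $\mathbb E[S_n]=0$). Mixing. For sub-$\sigma$-algebras $\mathcal A,\mathcal H$ of the probability space with measure $\mathbf P$ on which $(\xi_n)$ is defined, $\alpha(\mathcal A,\mathcal H)=\sup\{|\mathbf P(A\cap B)-\mathbf P(A)\mathbf P(B)|:A\in\mathcal A,B\in\mathcal H\}$, and $\alpha_n=\alpha(\sigma(\xi_j:j\le0),\sigma(\xi_j:j\ge n))$.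
   Formalization: The constant c_0 may depend, besides ‖φ‖_K, c_1, c_2, η, on the fixed numerical constants C_v, λ, ε', ε of the set-up (but on nothing else); independence of λ across all set-ups is false. *)

(* Defs.v *)
From HB Require Import structures.
From mathcomp Require Import all_boot all_order all_algebra.
From mathcomp Require Import complex.
From mathcomp Require Import all_classical all_reals all_analysis ess_sup_inf.

Set Implicit Arguments.
Unset Strict Implicit.
Unset Printing Implicit Defensive.

Import Order.TTheory GRing.Theory Num.Theory.
Import numFieldNormedType.Exports.
Import ComplexField.Normc.

Local Open Scope classical_set_scope.
Local Open Scope ring_scope.

(** * Complex functions on a measure space

The functions of BV are complex-valued. [R[i]] carries no sigma-algebra in the
libraries, so measurability and integrals are taken on real and imaginary
parts. [normc] is the modulus, with values in [R]. *)

Definition cabs (R : realType) (X : Type) (f : X -> R[i]) : X -> \bar R :=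
  fun x => (normc (f x))%:E.

Definition creal (R : realType) (X : Type) (f : X -> R) : X -> R[i] :=
  fun x => Complex (f x) 0.

Definition cmeasurable (R : realType) (d : measure_display)
    (X : measurableType d) (f : X -> R[i]) : Prop :=
  measurable_fun setT (fun x => complex.Re (f x)) /\
  measurable_fun setT (fun x => complex.Im (f x)).

Definition cint (R : realType) (d : measure_display) (X : measurableType d)
    (m : probability X R) (f : X -> R[i]) : R[i] :=
  Complex (\int[m]_x complex.Re (f x)) (\int[m]_x complex.Im (f x)).

Definition norm1 (R : realType) (d : measure_display) (X : measurableType d)
    (m : probability X R) (f : X -> R[i]) : \bar R :=
  'N[m]_(1%:E)[cabs f]%E.

Definition normoo (R : realType) (d : measure_display) (X : measurableType d)
    (m : probability X R) (f : X -> R[i]) : \bar R :=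
  'N[m]_(+oo%E)[cabs f]%E.

Definition inL1 (R : realType) (d : measure_display) (X : measurableType d)
    (m : probability X R) (f : X -> R[i]) : Prop :=
  cmeasurable f /\ (norm1 m f < +oo)%E.

Definition inLoo (R : realType) (d : measure_display) (X : measurableType d)
    (m : probability X R) (f : X -> R[i]) : Prop :=
  cmeasurable f /\ (normoo m f < +oo)%E.

(** * Variation and the space BV *)

Definition bvnorm (R : realType) (d : measure_display) (X : measurableType d)
    (m : probability X R) (v : (X -> R[i]) -> \bar R) (g : X -> R[i]) : \bar R :=
  (norm1 m g + v g)%E.

Definition inBV (R : realType) (d : measure_display) (X : measurableType d)
    (m : probability X R) (v : (X -> R[i]) -> \bar R) (g : X -> R[i]) : Prop :=
  inL1 m g /\ (v g < +oo)%E.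

(* The operator norm of [A] on BV is at most [c]. *)
Definition bvop_le (R : realType) (d : measure_display) (X : measurableType d)
    (m : probability X R) (v : (X -> R[i]) -> \bar R)
    (A : (X -> R[i]) -> (X -> R[i])) (c : R) : Prop :=
  forall g, inBV m v g -> (bvnorm m v (A g) <= c%:E * bvnorm m v g)%E.

(* Elements of L^1 are represented by functions, so [v] has to be compatible
   with almost everywhere equality; outside L^1 it is an arbitrary extension.
   In [V4] compactness in the (pseudo)metric space L^1 is sequential
   compactness. In [V9] the function of class C^1 on [-M, M] is [hr + i hi],
   with derivative [hr' + i hi']; the derivative is continuous up to the
   boundary, so its essential supremum is its supremum. In products of
   extended reals 0 * +oo = 0. *)
Record is_variation (R : realType) (d : measure_display) (X : measurableType d)
    (m : probability X R) (v : (X -> R[i]) -> \bar R) (Cv : R) : Prop := {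
  var_ge0 : forall h, (0 <= v h)%E ;
  var_ae : forall g h, inL1 m g -> inL1 m h ->
    (\forall x \ae m, g x = h x) -> v g = v h ;
  V1 : forall (t : R[i]) h, inL1 m h ->
    v (fun x => t * h x) = ((normc t)%:E * v h)%E ;
  V2 : forall g h, inL1 m g -> inL1 m h ->
    (v (fun x => (g x + h x)%R) <= v g + v h)%E ;
  V3_ge1 : 1 <= Cv ;
  V3 : forall h, inL1 m h -> (normoo m h <= Cv%:E * (norm1 m h + v h))%E ;
  V4 : forall C : R, 0 < C -> forall h_ : nat -> X -> R,
    (forall n, inL1 m (creal (h_ n)) /\
       (norm1 m (creal (h_ n)) + v (creal (h_ n)) <= C%:E)%E) ->
    exists (s : nat -> nat) (h : X -> R),
      [/\ {homo s : i j / (i < j)%N},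
          inL1 m (creal h) /\ (norm1 m (creal h) + v (creal h) <= C%:E)%E &
          norm1 m (creal (h_ (s n) \- h)) @[n --> \oo] --> 0%E] ;
  V5 : v (fun=> 1) = 0%E ;
  V6 : forall h : X -> R, inL1 m (creal h) -> (forall x, 0 <= h x) ->
    norm1 m (creal h) = 1%E ->
    forall e : R, 0 < e -> exists g : X -> R,
      [/\ inL1 m (creal g), forall x, 0 <= g x, norm1 m (creal g) = 1%E,
          (v (creal g) < +oo)%E & (norm1 m (creal (h \- g)%R) < e%:E)%E] ;
  V7 : forall f : X -> R, inL1 m (creal f) ->
    (0 < ess_inf m (EFin \o f))%E ->
    (v (creal (fun x => (f x)^-1%R))
       <= v (creal f) * ((fine (ess_inf m (EFin \o f))) ^- 2)%R%:E)%E ;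
  V8 : forall f g, inL1 m f -> inL1 m g -> inL1 m (fun x => f x * g x) ->
    (v (fun x => (f x * g x)%R) <= normoo m f * v g + normoo m g * v f)%E ;
  V9 : forall (M : R) (f : X -> R) (hr hi hr' hi' : R -> R), 0 < M ->
    measurable_fun setT f -> (forall x, f x \in `[- M, M]) ->
    {within `[- M, M], continuous hr} -> {within `[- M, M], continuous hi} ->
    {within `[- M, M], continuous hr'} -> {within `[- M, M], continuous hi'} ->
    {in `]- M, M[, forall t : R, is_derive t (1 : R) hr (hr' t)} ->
    {in `]- M, M[, forall t : R, is_derive t (1 : R) hi (hi' t)} ->
    (v (fun x => Complex (hr (f x)) (hi (f x)))
       <= ereal_sup [set (normc (Complex (hr' t) (hi' t)))%:E |
                      t in `[(- M)%R, M]] * v (creal f))%E ;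
  BV_complete : forall g_ : nat -> X -> R[i], (forall n, inBV m v (g_ n)) ->
    (forall e : R, 0 < e -> exists n0, forall n p, (n0 <= n)%N -> (n0 <= p)%N ->
       (bvnorm m v (fun x => (g_ n x - g_ p x)%R) < e%:E)%E) ->
    exists2 g, inBV m v g &
      bvnorm m v (fun x => (g_ n x - g x)%R) @[n --> \oo] --> 0%E
}.

(** * Two-sided sequences and the shift *)

Definition cylinders (dY : measure_display) (Y : measurableType dY) :
    set (set (int -> Y)) :=
  [set A | exists (j : int) (B : set Y),
     measurable B /\ A = (fun w : int -> Y => w j) @^-1` B].

(* Y^Z with the product sigma-algebra. *)
Notation seqspace Y := (g_sigma_algebraType (@cylinders _ Y)).

(* [shiftZ n] is the n-th iterate of the left shift, for n in Z. *)
Definition shiftZ (Y : Type) (n : int) (w : int -> Y) : int -> Y :=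
  fun j => w (j + n).

Definition is_stationary (R : realType) (dS dY : measure_display)
    (S : measurableType dS) (Y : measurableType dY) (PP : probability S R)
    (xi : int -> S -> Y) : Prop :=
  forall (n : int) (A : set (seqspace Y)), measurable A ->
    PP [set s | A (shiftZ n (fun j => xi j s))] = PP [set s | A (fun j => xi j s)].

Definition is_law (R : realType) (dS dY : measure_display)
    (S : measurableType dS) (Y : measurableType dY) (PP : probability S R)
    (xi : int -> S -> Y) (P : probability (seqspace Y) R) : Prop :=
  forall A : set (seqspace Y), measurable A ->
    P A = PP [set s | A (fun j => xi j s)].

Definition is_ergodic (R : realType) (dY : measure_display)
    (Y : measurableType dY) (P : probability (seqspace Y) R) : Prop :=
  forall A : set (seqspace Y), measurable A -> shiftZ 1 @^-1` A = A ->
    P A = 0%E \/ P A = 1%E.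

(* The sigma-algebra generated by the variables [xi j], [j \in J]. *)
Definition sigma_of (dS dY : measure_display)
    (S : measurableType dS) (Y : measurableType dY) (xi : int -> S -> Y)
    (J : set int) : set (set S) :=
  <<s [set A | exists (j : int) (B : set Y),
         [/\ J j, measurable B & A = xi j @^-1` B]] >>.

Definition alpha_coef (R : realType) (dS : measure_display)
    (S : measurableType dS) (PP : probability S R) (AA HH : set (set S)) :
    \bar R :=
  ereal_sup [set r | exists A B, [/\ AA A, HH B &
    r = `| PP (A `&` B) - PP A * PP B |%E ]].

Definition alpha_mix (R : realType) (dS dY : measure_display)
    (S : measurableType dS) (Y : measurableType dY) (PP : probability S R)
    (xi : int -> S -> Y) (n : nat) : \bar R :=
  alpha_coef PP (sigma_of xi [set j | (j <= 0)%R])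
                (sigma_of xi [set j | (n%:Z <= j)%R]).

Definition tempered (R : realType) (dY : measure_display)
    (Y : measurableType dY) (P : probability (seqspace Y) R)
    (Q : seqspace Y -> R) : Prop :=
  [/\ measurable_fun setT Q, forall w, 0 < Q w &
    \forall w \ae P,
      (ln (Q (shiftZ n%:Z w)) / n%:R @[n --> \oo] --> (0 : R)) /\
      (ln (Q (shiftZ (- n%:Z) w)) / (- n%:R) @[n --> \oo] --> (0 : R))].

(** * Random maps and transfer operators

The maps depend on the coordinate of index 0 only: T_w is [T (w 0)]. *)

Definition skew_product (dX dY : measure_display) (X : measurableType dX)
    (Y : measurableType dY) (T : Y -> X -> X) (p : seqspace Y * X) :
    seqspace Y * X :=
  (shiftZ 1 p.1, T (p.1 0) p.2).

Definition nonsingular (R : realType) (dX : measure_display)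
    (X : measurableType dX) (m : probability X R) (f : X -> X) : Prop :=
  measurable_fun setT f /\
  forall A, measurable A -> m A = 0%E -> m (f @^-1` A) = 0%E.

Definition is_transfer (R : realType) (dX : measure_display)
    (X : measurableType dX) (m : probability X R) (f : X -> X)
    (L : (X -> R[i]) -> (X -> R[i])) : Prop :=
  forall u, inL1 m u -> inL1 m (L u) /\
    forall g, inLoo m g ->
      cint m (fun x => L u x * g x) = cint m (fun x => u x * g (f x)).

(* L_w^n = L_(sigma^(n-1) w) \o ... \o L_w *)
Fixpoint Liter (R : realType) (X Y : Type)
    (L : (int -> Y) -> (X -> R[i]) -> (X -> R[i])) (n : nat) (w : int -> Y)
    (u : X -> R[i]) : X -> R[i] :=
  if n is n'.+1 then L (shiftZ n'%:Z w) (Liter L n' w u) else u.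

(* Omega is a Borel subset of a Polish space E through [iota], its
   sigma-algebra being the trace of the Borel one, and w |-> L_w is continuous
   for the operator norm of BV on each piece [A k] of a countable cover. *)
Definition good_base (R : realType) (dX dY : measure_display)
    (X : measurableType dX) (Y : measurableType dY) (m : probability X R)
    (v : (X -> R[i]) -> \bar R)
    (L : seqspace Y -> (X -> R[i]) -> (X -> R[i])) : Prop :=
  exists (E : completePseudoMetricType R) (iota : seqspace Y -> E)
         (A : nat -> set (seqspace Y)),
    [/\ hausdorff_space E /\ (exists2 Q : set E, countable Q & dense Q),
        [/\ injective iota,
            <<s [set U : set E | open U] >> (range iota) &
            forall B : set (seqspace Y), measurable B <->
              exists2 C, <<s [set U : set E | open U] >> C &
                B = iota @^-1` C],
        continuous (shiftZ 1 : initial_topology iota -> initial_topology iota) /\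
        continuous
          (shiftZ (-1) : initial_topology iota -> initial_topology iota),
        (forall k, measurable (A k)) /\ \bigcup_k A k = setT &
        forall k w, A k w -> forall e : R, 0 < e ->
          \forall w' \near within (A k) (nbhs (w : initial_topology iota)),
            bvop_le m v (fun u => (fun x => L w' u x - L w u x)) e].

(* [Nv] is the tempered variable called N(w) in the notion of good cocycle.
   The condition on the positive part in the fourth clause only says that the
   integral of [ln (al w)] makes sense (a nonnegative function and its negative
   part both of infinite integral would give -oo in the library);
   [lne] is the extended logarithm, with [lne 0 = -oo]. *)
Definition good_cocycle (R : realType) (dX dY : measure_display)
    (X : measurableType dX) (Y : measurableType dY) (m : probability X R)
    (v : (X -> R[i]) -> \bar R) (P : probability (seqspace Y) R)
    (T : Y -> X -> X) (L : seqspace Y -> (X -> R[i]) -> (X -> R[i]))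
    (Nv : seqspace Y -> R) : Prop :=
  [/\ good_base m v L,
      tempered P Nv /\
      (\forall w \ae P, forall g, inBV m v g ->
         (v (g \o T (w 0%R)) <= (Nv w)%:E * v g)%E) &
   [/\ (exists C : seqspace Y -> R,
         [/\ measurable_fun setT C, forall w, 0 < C w,
             P.-integrable setT (fun w => (ln (C w))%:E) &
             \forall w \ae P, forall h, inBV m v h ->
               (bvnorm m v (L w h) <= (C w)%:E * bvnorm m v h)%E]),
       (exists (N : nat) (al KN : seqspace Y -> R),
         [/\ (0 < N)%N,
             [/\ measurable_fun setT al, measurable_fun setT KN,
                 forall w, 0 < al w & forall w, 0 < KN w],
             (\int[P]_w (Num.max (ln (al w)) 0)%:E < +oo)%E /\
             (\int[P]_w (ln (al w))%:E < 0)%E,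
             P.-integrable setT (fun w => (ln (KN w))%:E) &
             \forall w \ae P, forall h, inBV m v h ->
               (v (Liter L N w h)
                  <= (al w)%:E * v h + (KN w)%:E * norm1 m h)%E]),
       (forall a : R, 0 < a ->
         exists (nc : seqspace Y -> nat) (al : nat -> seqspace Y -> R),
         [/\ measurable_fun setT nc,
             forall n, measurable_fun setT (al n),
             forall n w, 0 < al n w &
             \forall w \ae P, forall n, (nc w <= n)%N ->
               forall h : X -> R, inLoo m (creal h) -> (forall x, 0 <= h x) ->
               (v (creal h) <= a%:E * norm1 m (creal h))%E ->
               ((al n w)%:E * norm1 m (creal h)
                 <= ess_inf m (fun x => (complex.Re (Liter L n w (creal h) x))%:E))%E]) &
       P.-integrable setT
         (fun w => lne (ess_inf m (fun x => (complex.Re (L w (fun=> 1%R) x))%:E)))]].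

(** * Equivariant densities and the adapted random variable K *)

Definition is_equivariant_density (R : realType) (dX dY : measure_display)
    (X : measurableType dX) (Y : measurableType dY) (m : probability X R)
    (v : (X -> R[i]) -> \bar R) (P : probability (seqspace Y) R)
    (L : seqspace Y -> (X -> R[i]) -> (X -> R[i]))
    (h : seqspace Y -> X -> R) : Prop :=
  measurable_fun setT (fun p : seqspace Y * X => h p.1 p.2) /\
  \forall w \ae P,
    [/\ inBV m v (creal (h w)), forall x, 0 <= h w x,
        (\int[m]_x (h w x)%:E = 1)%E &
        \forall x \ae m, L w (creal (h w)) x = creal (h (shiftZ 1 w)) x].

(* The normalized iterates L_w^n g = calL_w^n (g h_w) / h_(sigma^n w). *)
Definition Lnormd (R : realType) (X Y : Type)
    (L : (int -> Y) -> (X -> R[i]) -> (X -> R[i])) (h : (int -> Y) -> X -> R)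
    (n : nat) (w : int -> Y) (g : X -> R[i]) : X -> R[i] :=
  fun x => Liter L n w (fun y => g y * creal (h w) y) x
           / creal (h (shiftZ n%:Z w)) x.

(* [coPi] is Id - Pi and [coPitilde] is Id - Pitilde; since mu_w has density
   h_w, [coPitilde] maps g to the constant mu_w(g). *)
Definition coPi (R : realType) (dX : measure_display) (X : measurableType dX)
    (Y : Type) (m : probability X R) (h : (int -> Y) -> X -> R) (w : int -> Y)
    (g : X -> R[i]) : X -> R[i] :=
  fun x => cint m g * creal (h w) x.

Definition Pi (R : realType) (dX : measure_display) (X : measurableType dX)
    (Y : Type) (m : probability X R) (h : (int -> Y) -> X -> R) (w : int -> Y)
    (g : X -> R[i]) : X -> R[i] :=
  fun x => g x - coPi m h w g x.

Definition coPitilde (R : realType) (dX : measure_display) (X : measurableType dX)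
    (Y : Type) (m : probability X R) (h : (int -> Y) -> X -> R) (w : int -> Y)
    (g : X -> R[i]) : X -> R[i] :=
  fun=> cint m (fun x => g x * creal (h w) x).

Definition Pitilde (R : realType) (dX : measure_display) (X : measurableType dX)
    (Y : Type) (m : probability X R) (h : (int -> Y) -> X -> R) (w : int -> Y)
    (g : X -> R[i]) : X -> R[i] :=
  fun x => g x - coPitilde m h w g x.

Definition cocycle_bounds (R : realType) (dX dY : measure_display)
    (X : measurableType dX) (Y : measurableType dY) (m : probability X R)
    (v : (X -> R[i]) -> \bar R) (P : probability (seqspace Y) R)
    (L : seqspace Y -> (X -> R[i]) -> (X -> R[i]))
    (h : seqspace Y -> X -> R) (lambda eps' : R) (D Dt : seqspace Y -> R) :
    Prop :=
  [/\ tempered P D, tempered P Dt &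
    \forall w \ae P, forall n : nat,
      [/\ bvop_le m v (fun g => Liter L n w (Pi m h w g))
            (D w * expR (- (lambda * n%:R))),
          bvop_le m v (fun g => Liter L n w (coPi m h w g))
            (D w * expR (eps' * n%:R)),
          bvop_le m v (fun g => Lnormd L h n w (Pitilde m h w g))
            (Dt w * expR (- (lambda * n%:R))) &
          bvop_le m v (fun g => Lnormd L h n w (coPitilde m h w g)) (Dt w)]].

Definition Ktilde (R : realType) (dX dY : measure_display)
    (X : measurableType dX) (Y : measurableType dY) (m : probability X R)
    (v : (X -> R[i]) -> \bar R) (h : seqspace Y -> X -> R)
    (D Dt Nv : seqspace Y -> R) (w : seqspace Y) : \bar R :=
  maxe (maxe (maxe (D w)%:E (Dt w)%:E) (Nv w)%:E)
       (bvnorm m v (creal (fun x => (h w x)^-1))).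

Definition is_adapted (R : realType) (dX dY : measure_display)
    (X : measurableType dX) (Y : measurableType dY) (m : probability X R)
    (v : (X -> R[i]) -> \bar R) (P : probability (seqspace Y) R)
    (h : seqspace Y -> X -> R) (D Dt Nv : seqspace Y -> R) (eps : R)
    (K : seqspace Y -> R) : Prop :=
  [/\ tempered P K, forall w, 1 < K w &
    \forall w \ae P,
      (((K w)^-1)%:E <= Ktilde m v h D Dt Nv w <= (K w)%:E)%E /\
      forall n : int,
        K w * expR (- (eps * `|n|%N%:R)) <= K (shiftZ n w)
          <= K w * expR (eps * `|n|%N%:R)].

(* [mu] is the integral over [P] of the measures d mu_w = h_w dm. *)
Definition is_skew_measure (R : realType) (dX dY : measure_display)
    (X : measurableType dX) (Y : measurableType dY) (m : probability X R)
    (P : probability (seqspace Y) R) (h : seqspace Y -> X -> R)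
    (mu : probability (seqspace Y * X)%type R) : Prop :=
  forall A, measurable A ->
    (mu A = \int[P]_w \int[m]_(x in xsection A w) (h w x)%:E)%E.

(** * Observables, Birkhoff sums and cumulants *)

Definition observable (R : realType) (dX dY : measure_display)
    (X : measurableType dX) (Y : measurableType dY) (phi : Y -> X -> R)
    (p : seqspace Y * X) : R := phi (p.1 0) p.2.

Definition normK (R : realType) (dX dY : measure_display)
    (X : measurableType dX) (Y : measurableType dY) (m : probability X R)
    (v : (X -> R[i]) -> \bar R) (P : probability (seqspace Y) R)
    (K : seqspace Y -> R) (phi : Y -> X -> R) : \bar R :=
  ess_sup P (fun w => ((K w)%:E * bvnorm m v (creal (phi (w 0%R))))%E).

Definition Bsum (R : realType) (dX dY : measure_display)
    (X : measurableType dX) (Y : measurableType dY) (T : Y -> X -> X)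
    (phi : Y -> X -> R) (n : nat) (p : seqspace Y * X) : R :=
  \sum_(0 <= j < n) observable phi (iter j (@skew_product _ _ X Y T) p).

(* Principal argument, with values in ]-pi, pi], and logarithm. *)
Definition carg (R : realType) (z : R[i]) : R :=
  let: Complex x y := z in
  if 0 < x then atan (y / x)
  else if x < 0 then (if 0 <= y then atan (y / x) + pi else atan (y / x) - pi)
  else if 0 < y then pi / 2 else if y < 0 then - (pi / 2) else 0.

Definition cln (R : realType) (z : R[i]) : R[i] :=
  Complex (ln (normc z)) (carg z).

Definition char_fun (R : realType) (d : measure_display) (T : measurableType d)
    (mu : probability T R) (W : T -> R) (t : R) : R[i] :=
  Complex (\int[mu]_p cos (t * W p)) (\int[mu]_p sin (t * W p)).

Definition cumulant (R : realType) (d : measure_display) (T : measurableType d)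
    (mu : probability T R) (W : T -> R) (k : nat) : R[i] :=
  Complex 0 1 ^- k *
  Complex (derive1n k (fun t => complex.Re (cln (char_fun mu W t))) 0)
          (derive1n k (fun t => complex.Im (cln (char_fun mu W t))) 0).

(* Main.v *)
(** For a fixed sequence of maps, the transfer operators twisted by [exp (z phi)]
are expanded as formal power series in [z]. Recentring the evolved density at
every step by a multiple of the constant 1 gives quenched weights [W[c, d)],
which depend only on the coordinates in [c, d), are bounded by
[A B^p rho^(d - c)] in degree [p], and satisfy
[Z[0, n + 1) = \sum_c Z[0, c) W[c, n + 1)] for the quenched moment series [Z].
The factor [1 / K] in the bound on [phi] absorbs the non-uniformity [K] of the
decay, so these bounds are uniform in the environment.

Averaging over the environment turns this into a renewal equation whose error
terms are indexed by families of disjoint intervals and weighted by iterated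
centred products of the [W]. Mixing bounds such a product by the mixing
coefficient of its largest gap. If gaps are measured in units of [k^(1/eta)], a
stretched exponential bound is at most the power [-3k] of the gap in degrees up
to [k]; this is enough for a cluster expansion to show that consecutive averaged
series have a ratio close to 1 in a weighted norm of radius [C k^(1/eta)]. The
[k]-th cumulant is a coefficient of the logarithmic derivative of the averaged
series, which is a sum over time of the logarithmic derivatives of these ratios:
this gives [n k! (C k^(1/eta))^k].

The sum is started from [m] after a delay, and the delay is sent to infinity to
reach the invariant measure. *)

From HB Require Import structures.
Require Import Defs.
From mathcomp Require Import all_boot all_order all_algebra.
From mathcomp Require Import complex ring lra zify.
From mathcomp Require Import all_classical all_reals all_analysis ess_sup_inf measurable_realfun.

Set Implicit Arguments.
Unset Strict Implicit.
Unset Printing Implicit Defensive.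

Import Order.TTheory GRing.Theory Num.Theory.
Import numFieldNormedType.Exports.
Import ComplexField.Normc.

Local Open Scope classical_set_scope.
Local Open Scope ring_scope.

(** * Formal power series *)

(** Recentring by the constant 1, and not by the equivariant density, is what makes mixing usable:
    that density depends on the whole past of the environment, whereas a density restarted from 1 at
    time [c] sees nothing before [c]. The obstacle in the cluster expansion is that a family
    reaching back to time c is multiplied by Z_c / Z_n, whose norm may grow exponentially in n - c,
    while mixing gives only a negative power of the largest gap S, in units of m. The way out is to
    measure each family at its own radius, smaller by the factor S. A ratio Z_(i+1) / Z_i minus 1
    has no constant term, so its norm shrinks by S, and the growth over a gap of at most S units
    stays bounded. Returning to the original radius costs S^k, because only degrees up to k matter.
    Of the power S^(-3k), k factors pay for the radius and 2k leave an inverse square for each of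
    the at most k gaps, so that the sums over gap lengths converge. *)

Definition fps (R : realType) : Type := nat -> R.

Section FormalPowerSeries.
Variable R : realType.
Implicit Types f g h : fps R.

HB.instance Definition _ := GRing.Zmodule.copy (fps R) (nat -> R).

Definition fpsM f g : fps R := fun n => \sum_(i < n.+1) f i * g (n - i)%N.
Definition fps1 : fps R := fun n => (n == 0)%:R.

(** Coefficient i of a product involves only coefficients up to i, so truncation above i is exact
    there and the ring laws are inherited from polynomials. *)
Let trunc (n : nat) f : {poly R} := \poly_(i < n) f i.

Let coef_trunc n f i : (i < n)%N -> (trunc n f)`_i = f i.
Proof. by move=> lin; rewrite coef_poly lin. Qed.

Let coef_truncM n f g i : (i < n)%N -> (trunc n f * trunc n g)`_i = fpsM f g i.
Proof.
move=> lin; rewrite coefM; apply: eq_bigr => j _.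
by rewrite !coef_trunc// (leq_ltn_trans _ lin)// ?leq_subr// -ltnS.
Qed.

Let fpsMA : associative fpsM.
Proof.
move=> f g h; apply/funext => n.
have -> : fpsM f (fpsM g h) n = (trunc n.+1 f * (trunc n.+1 g * trunc n.+1 h))`_n.
  rewrite coefM; apply: eq_bigr => j _.
  by rewrite coef_trunc// coef_truncM// ltnS leq_subr.
rewrite mulrA coefM; apply: eq_bigr => j _.
by rewrite coef_truncM// coef_trunc// ltnS leq_subr.
Qed.

Let fpsMC : commutative fpsM.
Proof.
move=> f g; apply/funext => n.
by rewrite -!(@coef_truncM n.+1)// mulrC.
Qed.

Let fps1M : left_id fps1 fpsM.
Proof.
move=> f; apply/funext => n; rewrite /fpsM big_ord_recl /= mul1r subn0 big1 ?addr0//.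
by move=> i _; rewrite /fps1 /= mul0r.
Qed.

Let fpsMDl : left_distributive fpsM +%R.
Proof.
move=> f g h; apply/funext => n; rewrite /fpsM [RHS]/GRing.add/= -big_split/=.
by apply: eq_bigr => i _; rewrite mulrDl.
Qed.

Let fps1_neq0 : fps1 != 0 :> fps R.
Proof.
apply/eqP => /(congr1 (fun f : fps R => f 0%N)) /eqP.
by rewrite /fps1 eqxx oner_eq0.
Qed.

HB.instance Definition _ := GRing.Zmodule_isComNzRing.Build (fps R)
  fpsMA fpsMC fps1M fpsMDl fps1_neq0.

Lemma fpsME f g n : (f * g) n = \sum_(i < n.+1) f i * g (n - i)%N.
Proof. by []. Qed.
Lemma fps1E n : (1 : fps R) n = (n == 0)%:R. Proof. by []. Qed.
Lemma fpsDE f g n : (f + g) n = f n + g n. Proof. by []. Qed.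
Lemma fpsNE f n : (- f) n = - f n. Proof. by []. Qed.
Lemma fps0E n : (0 : fps R) n = 0. Proof. by []. Qed.
Lemma fpsBE f g n : (f - g) n = f n - g n. Proof. by []. Qed.

Lemma fps_sumE (I : Type) (r : seq I) (P : pred I) (F : I -> fps R) n :
  (\sum_(i <- r | P i) F i) n = \sum_(i <- r | P i) F i n.
Proof.
elim/big_rec2: _ => // i x y _ <-; by rewrite fpsDE.
Qed.

Lemma fps_inv f : f 0%N = 1 -> exists g, f * g = 1.
Proof.
move=> f0.
(* The inverse is built coefficient by coefficient: as f has constant term 1, each new coefficient
   is determined by the list of the previous ones. *)
pose step (s : seq R) := rcons s (- \sum_(i < size s) s`_i * f (size s - i)%N).
pose l n := iter n step [:: 1].
have szl n : size (l n) = n.+1.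
  by elim: n => // n IH; rewrite /l iterS size_rcons -/(l n) IH.
have lE n i : (i <= n)%N -> (l n.+1)`_i = (l n)`_i.
  by move=> lin; rewrite /l iterS nth_rcons -/(l n) szl ltnS lin.
pose g : fps R := fun n => (l n)`_n.
have gE n i : (i <= n)%N -> (l n)`_i = g i.
  elim: n => [|n IH]; first by rewrite leqn0 => /eqP ->.
  by rewrite leq_eqVlt => /predU1P[->//|lin]; rewrite lE// IH.
exists g; rewrite mulrC; apply/funext => -[|n].
  by rewrite fpsME big_ord1 subnn f0 mulr1.
rewrite fpsME big_ord_recr/= subnn f0 mulr1 fps1E/=.
rewrite {2}/g /l iterS nth_rcons -/(l n) szl ltnn eqxx.
apply/eqP; rewrite subr_eq0; apply/eqP.
by apply: eq_bigr => i _; rewrite gE// -ltnS.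
Qed.

Definition mono (a : R) (p : nat) : fps R := fun n => if n == p then a else 0.

Lemma monoME a p f n : (mono a p * f) n = if (p <= n)%N then a * f (n - p)%N else 0.
Proof.
rewrite fpsME; case: ifPn => [lpn|]; last first.
  rewrite -ltnNge => ltnp; apply: big1 => i _.
  rewrite /mono ifF ?mul0r//; apply/negbTE; rewrite neq_ltn.
  by rewrite (leq_ltn_trans _ ltnp)// -ltnS.
have lt : (p < n.+1)%N by [].
rewrite (bigD1 (Ordinal lt))//= /mono eqxx big1 ?addr0// => i.
by rewrite -val_eqE/= => /negbTE ->; rewrite mul0r.
Qed.

(* The derivation [z d/dz]. *)
Definition fpsD f : fps R := fun n => n%:R * f n.

Lemma fpsDM f g : fpsD (f * g) = fpsD f * g + f * fpsD g.
Proof.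
apply/funext => n; rewrite fpsDE !fpsME -big_split/= /fpsD fpsME mulr_sumr.
apply: eq_bigr => i _.
have -> : n%:R = i%:R + (n - i)%:R :> R by rewrite -natrD subnKC// -ltnS.
ring.
Qed.

Lemma fpsD1 : fpsD 1 = 0.
Proof.
by apply/funext => -[|n]; rewrite /fpsD fps1E ?mul0r// mulr0.
Qed.

(** * Weighted norms truncated at degree k *)

Section Norm.
Variable k : nat.

Definition fnorm (t : R) f := \sum_(j < k.+1) `|f j| * t ^+ j.

Lemma fnorm_ge0 t f : 0 <= t -> 0 <= fnorm t f.
Proof. by move=> t0; apply: sumr_ge0 => i _; rewrite mulr_ge0// exprn_ge0. Qed.

Lemma eq_fnorm t f g : (forall j, (j <= k)%N -> f j = g j) -> fnorm t f = fnorm t g.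
Proof. by move=> fg; apply: eq_bigr => i _; rewrite fg// -ltnS. Qed.

Lemma fnormD t f g : 0 <= t -> fnorm t (f + g) <= fnorm t f + fnorm t g.
Proof.
move=> t0; rewrite -big_split/=; apply: ler_sum => i _.
by rewrite -mulrDl ler_wpM2r ?exprn_ge0// ler_normD.
Qed.

Lemma fnorm0 t : fnorm t 0 = 0.
Proof. by apply: big1 => i _; rewrite fps0E normr0 mul0r. Qed.

Lemma fnormN t f : fnorm t (- f) = fnorm t f.
Proof. by apply: eq_bigr => i _; rewrite fpsNE normrN. Qed.

Lemma fnorm1 t : fnorm t 1 = 1.
Proof.
rewrite /fnorm big_ord_recl/= fps1E/= normr1 expr0 mulr1 big1 ?addr0// => i _.
by rewrite fps1E normr0 mul0r.
Qed.

Lemma fnorm_sum (I : Type) (r : seq I) (P : pred I) (F : I -> fps R) t : 0 <= t ->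
  fnorm t (\sum_(i <- r | P i) F i) <= \sum_(i <- r | P i) fnorm t (F i).
Proof.
move=> t0; elim/big_rec2: _ => [|i x y _ IH]; first by rewrite fnorm0.
by apply: le_trans (fnormD _ _ t0) _; rewrite lerD2l.
Qed.

(** The right-hand side is the value at 1 of a product of polynomials with nonnegative coefficients;
    truncation only drops its terms of degree above k. *)
Lemma fnormM t f g : 0 <= t -> fnorm t (f * g) <= fnorm t f * fnorm t g.
Proof.
move=> t0; pose F i := `|f i| * t ^+ i; pose G i := `|g i| * t ^+ i.
have F0 i : 0 <= F i by rewrite mulr_ge0// exprn_ge0.
have G0 i : 0 <= G i by rewrite mulr_ge0// exprn_ge0.
rewrite [leRHS](_ : _ = (\poly_(i < k.+1) F i).[1] * (\poly_(i < k.+1) G i).[1]);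
  last first.
  rewrite !horner_poly /fnorm; congr (_ * _); apply: eq_bigr => i _;
  by rewrite expr1n mulr1.
rewrite -hornerM; set p := (X in X.[1]).
have szp : (size p <= k.+1 + k.+1)%N.
  apply: (leq_trans (size_polyMleq _ _)); apply: (leq_trans (leq_pred _)).
  by apply: leq_add; exact: size_poly.
rewrite (horner_coef_wide _ szp) big_split_ord/= -[leLHS]addr0.
have p0 i : 0 <= p`_i.
  rewrite coefM; apply: sumr_ge0 => j _; rewrite !coef_poly.
  by apply: mulr_ge0; case: ifP.
apply: lerD; last by apply: sumr_ge0 => i _; rewrite expr1n mulr1.
apply: ler_sum => i _; rewrite expr1n mulr1 /p coefM fpsME.
have -> : (\sum_(j < i.+1) (\poly_(i0 < k.+1) F i0)`_j * (\poly_(i0 < k.+1) G i0)`_(i - j))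
   = \sum_(j < i.+1) F j * G (i - j)%N.
  apply: eq_bigr => j _; rewrite !coef_poly.
  rewrite (leq_ltn_trans (leq_subr _ _) (ltn_ord i)).
  by rewrite (leq_trans (ltn_ord j) (ltn_ord i)).
apply: (@le_trans _ _ ((\sum_(j < i.+1) `|f j| * `|g (i - j)%N|) * t ^+ i)).
  rewrite ler_wpM2r ?exprn_ge0//; apply: (le_trans (ler_norm_sum _ _ _)).
  by apply: ler_sum => j _; rewrite normrM.
rewrite mulr_suml; apply: ler_sum => j _; rewrite /F /G.
have -> : t ^+ i = t ^+ j * t ^+ (i - j)%N by rewrite -exprD subnKC// -ltnS.
by rewrite mulrACA.
Qed.

Lemma fnorm_mono t a p : 0 <= t -> fnorm t (mono a p) <= `|a| * t ^+ p.
Proof.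
move=> t0; have [lpk|ltkp] := ltnP p k.+1; last first.
  rewrite /fnorm big1 ?mulr_ge0 ?exprn_ge0// => i _.
  rewrite /mono ifF ?normr0 ?mul0r//; apply/negbTE.
  by rewrite neq_ltn (leq_trans (ltn_ord i) ltkp).
rewrite /fnorm (bigD1 (Ordinal lpk))//= /mono eqxx big1 ?addr0// => i.
by rewrite -val_eqE/= => /negbTE ->; rewrite normr0 mul0r.
Qed.

(** Without a constant term, every monomial gains at least one factor s. *)
Lemma fnorm_scale_down s t f : 0 <= t -> 0 <= s <= 1 -> f 0%N = 0 ->
  fnorm (s * t) f <= s * fnorm t f.
Proof.
move=> t0 /andP[s0 s1] f0; rewrite /fnorm mulr_sumr; apply: ler_sum => -[[|j] lj] _/=.
  by rewrite f0 normr0 !mul0r mulr0.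
rewrite exprMn [leRHS]mulrCA ler_wpM2l// ler_wpM2r ?exprn_ge0//.
by rewrite exprS ler_piMr// exprn_ile1.
Qed.

(** The truncation is essential here: no monomial loses more than y^k. *)
Lemma fnorm_scale_up y t f : 0 <= t -> 1 <= y ->
  fnorm t f <= y ^+ k * fnorm (y^-1 * t) f.
Proof.
move=> t0 y1; have y0 : 0 < y by exact: lt_le_trans y1.
rewrite /fnorm mulr_sumr; apply: ler_sum => -[j lj] _/=.
rewrite exprMn mulrCA ler_wpM2l// mulrA -[leLHS]mul1r ler_wpM2r ?exprn_ge0//.
rewrite exprVn ler_pdivlMr ?exprn_gt0// mul1r.
by apply: ler_weXn2l => //; rewrite -ltnS.
Qed.

(** From g = 1 - (f - 1) g one gets |g| <= 1 + th |g|, which can be solved for |g| because the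
    truncated norm is always finite. *)
Lemma fnorm_inv t (th : R) f g : 0 <= t -> f * g = 1 -> fnorm t (f - 1) <= th ->
  th < 1 -> fnorm t g <= (1 - th)^-1.
Proof.
move=> t0 fg fth th1.
have gE : g = 1 - (f - 1) * g by rewrite mulrBl fg mul1r; ring.
have : fnorm t g <= 1 + th * fnorm t g.
  rewrite {1}gE; apply: (le_trans (fnormD _ _ t0)); rewrite fnorm1 fnormN lerD2l.
  by apply: (le_trans (fnormM _ _ t0)); rewrite ler_wpM2r// fnorm_ge0.
move=> H; rewrite -[leRHS]mul1r ler_pdivlMr ?subr_gt0//; lra.
Qed.

Lemma fnorm_coef t f j : 0 <= t -> (j <= k)%N -> `|f j| * t ^+ j <= fnorm t f.
Proof.
move=> t0 ljk; rewrite /fnorm (bigD1 (Ordinal (ljk : (j < k.+1)%N)))//= lerDl.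
by apply: sumr_ge0 => i _; rewrite mulr_ge0// exprn_ge0.
Qed.

Lemma fnormDz t f : 0 <= t -> fnorm t (fpsD f) <= k%:R * fnorm t (f - mono (f 0%N) 0).
Proof.
move=> t0; rewrite /fnorm mulr_sumr; apply: ler_sum => -[[|j] lj] _/=.
  by rewrite /fpsD mul0r normr0 mul0r mulr_ge0// mulr_ge0// exprn_ge0.
rewrite /fpsD fpsBE /mono/= subr0 normrM mulrA ler_wpM2r ?exprn_ge0//.
by rewrite ler_wpM2r// ger0_norm// ler_nat -ltnS.
Qed.

End Norm.
End FormalPowerSeries.

(** * Cluster expansion over families of intervals *)

(* A family is a list of triples [(c, d, p)], read from right to left on the
   time axis: an interval [c, d) carrying a term of order [p] in [z]. *)
Section Families.
Variables (V : nmodType) (k : nat).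
Notation elt := (nat * nat * nat)%type.

(** The rightmost interval is chosen first and bounds the others from the right. Orders are at least
    one, so degrees up to k never require more than k intervals. *)
Fixpoint fsum (N c : nat) (F : seq elt -> V) : V :=
  if N is N'.+1 then
    \sum_(d < c.+1) \sum_(c' < d) \sum_(p < k)
      fsum N' c' (fun t => F ((c' : nat, d : nat, p.+1) :: t))
  else F [::].

End Families.

Fixpoint famOK (c : nat) (t : seq (nat * nat * nat)) : bool :=
  if t is (c', d, p) :: t' then
    [&& (c' < d)%N, (d <= c)%N, (0 < p)%N & famOK c' t']
  else true.

Definition ord (t : seq (nat * nat * nat)) : nat := sumn (map snd t).

Fixpoint strt (c : nat) (t : seq (nat * nat * nat)) : nat :=
  if t is (c', _, _) :: t' then strt c' t' else c.

Lemma famOK_strt c t : famOK c t -> (strt c t <= c)%N.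
Proof.
elim: t c => //= -[[c' d] p] t IH c /and4P[lt le _ /IH].
by move=> /leq_trans; apply; apply: leq_trans (ltnW lt) le.
Qed.

Lemma fsum_fpsE (R : realType) k N c (F : seq (nat * nat * nat) -> fps R) n :
  fsum k N c F n = fsum k N c (fun t => F t n).
Proof.
elim: N c F => [//|N IH] c F /=.
rewrite fps_sumE; apply: eq_bigr => d _; rewrite fps_sumE; apply: eq_bigr => c' _.
by rewrite fps_sumE; apply: eq_bigr => p _.
Qed.

Lemma fsumMr (R : realType) k N c (F : seq (nat * nat * nat) -> fps R) f :
  fsum k N c F * f = fsum k N c (fun t => F t * f).
Proof.
elim: N c F => [//|N IH] c F /=.
rewrite mulr_suml; apply: eq_bigr => d _; rewrite mulr_suml; apply: eq_bigr => c' _.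
by rewrite mulr_suml; apply: eq_bigr => p _.
Qed.

Lemma half_le_1B (R : realType) (z : R) : z <= 2^-1 -> 2^-1 <= 1 - z.
Proof. lra. Qed.

(** * Ratios of consecutive series *)

Section Gas.
Variables (R : realType) (k : nat).
Variables (A B rho sig m Rad C3 th : R).
Hypotheses (A0 : 0 <= A) (B0 : 0 <= B) (rho0 : 0 <= rho) (m1 : 1 <= m).
Hypotheses (Rad0 : 0 < Rad) (C30 : 0 <= C3) (th0 : 0 <= th) (th_half : th <= 2^-1).
Hypotheses (thm : 2 * th * m <= 1) (x_half : B / Rad <= 2^-1).
Hypotheses (sigE : rho * expR (2 * th) <= sig) (sig1 : sig < 1).

Let t0 := Rad^-1.
Let t0_ge0 : 0 <= t0. Proof. by rewrite invr_ge0 ltW. Qed.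
Let m0 : 0 < m. Proof. exact: lt_le_trans m1. Qed.
Let sig0 : 0 <= sig. Proof. by apply: le_trans sigE; rewrite mulr_ge0// expR_ge0. Qed.
Let x := B / Rad.
Let x0 : 0 <= x. Proof. by rewrite mulr_ge0. Qed.

(** A gap measured in units of m; the floor 1 makes gaps shorter than one unit free. *)
Definition Yg (g : nat) : R := Num.max 1 (g%:R / m).

Fixpoint ymax (c : nat) (t : seq (nat * nat * nat)) : R :=
  if t is (c', d, _) :: t' then Num.max (Yg (c - d)) (ymax c' t') else 1.

Fixpoint wgt (t : seq (nat * nat * nat)) : R :=
  if t is (c', d, p) :: t' then A * B ^+ p * rho ^+ (d - c') * wgt t' else 1.

(** What an interval costs once the exponential growth of the ratios is paid for: [sig] instead of
    [rho] covers the growth along the interval, and [expR 1] the growth across the gap on its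
    right. *)
Let q1 (l p : nat) : R := A * x ^+ p * sig ^+ l * expR 1.

Let qw (g l p : nat) : R := q1 l p * Yg g ^- 2.

Fixpoint gwt (c : nat) (t : seq (nat * nat * nat)) : R :=
  if t is (c', d, p) :: t' then qw (c - d) (d - c') p * gwt c' t' else 1.

Lemma Yg_ge1 g : 1 <= Yg g. Proof. by rewrite le_max lexx. Qed.

Lemma ymax_ge1 c t : 1 <= ymax c t.
Proof. by case: t => //= -[[? ?] ?] ?; rewrite le_max Yg_ge1. Qed.

Lemma wgt_ge0 t : 0 <= wgt t.
Proof.
by elim: t => //= -[[? ?] ?] t IH; rewrite !mulr_ge0// exprn_ge0.
Qed.

Let q1_ge0 l p : 0 <= q1 l p.
Proof. by rewrite !mulr_ge0// ?exprn_ge0// expR_ge0. Qed.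

Let qw_ge0 g l p : 0 <= qw g l p.
Proof. by rewrite mulr_ge0// invr_ge0 exprn_ge0// (le_trans _ (Yg_ge1 g)). Qed.

Lemma gwt_ge0 c t : 0 <= gwt c t.
Proof. by elim: t c => //= -[[? ?] ?] t IH c; rewrite mulr_ge0. Qed.

(** The time from [strt c t] to c splits into gaps and intervals. A gap is at most S m long, so its
    exponential is at most exp (2 th m) <= e; on an interval rho exp (2 th) <= sig; and one factor
    S^(-2) per interval is at most the inverse square of its own gap. *)
Let wgt_gwt c t S : famOK c t -> ymax c t <= S ->
  wgt t * t0 ^+ ord t * expR (2 * (S^-1 * th) * (c - strt c t)%:R) * S ^- (2 * size t)
    <= gwt c t.
Proof.
elim: t c => [|[[c' d] p] t IH] c /=.
  by move=> _ _; rewrite subnn mulr0 expR0 muln0 expr0 invr1 /ord/= expr0 !mulr1.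
move=> /and4P[lt le p0 tok]; rewrite ge_max => /andP[YS yS].
have S1 : 1 <= S by exact: le_trans (Yg_ge1 _) YS.
have S0 : 0 < S by exact: lt_le_trans S1.
have := IH c' tok yS; set Q := gwt c' t => HQ.
have lst := famOK_strt tok.
have -> : (c - strt c' t = (c - d) + ((d - c') + (c' - strt c' t)))%N.
  by move: lst lt le; clear; move: (strt c' t) => b; lia.
rewrite 2!natrD 2!mulrDr 2!expRD /ord/= -/(ord t) exprD mulnS exprD invfM.
set E3 := expR (_ * (c' - _)%:R) in HQ *.
set E1 := expR (_ * (c - d)%:R); set E2 := expR (_ * (d - c')%:R).
rewrite [leLHS](_ : _ = (A * (B ^+ p * t0 ^+ p) * (rho ^+ (d - c') * E2) * E1 * S ^- 2)
   * (wgt t * t0 ^+ ord t * E3 * S ^- (2 * size t))); last by ring.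
apply: ler_pM => //.
- by rewrite !mulr_ge0// ?exprn_ge0// ?expR_ge0// invr_ge0 exprn_ge0// ltW.
- by rewrite !mulr_ge0 ?wgt_ge0// ?exprn_ge0// ?expR_ge0// invr_ge0 exprn_ge0// ltW.
rewrite /qw /q1 -exprMn -/x.
have sth : 2 * (S^-1 * th) <= 2 * th.
  by rewrite ler_pM2l// ler_piMl// invf_le1.
apply: ler_pM => //.
- by rewrite !mulr_ge0// ?exprn_ge0// ?expR_ge0.
- by rewrite invr_ge0 exprn_ge0// ltW.
- apply: ler_pM => //; rewrite ?expR_ge0//.
  + by rewrite !mulr_ge0// ?exprn_ge0// ?expR_ge0.
  + apply: ler_wpM2l; first by rewrite !mulr_ge0// exprn_ge0.
    rewrite /E2.
    have -> : expR ((2 * (S^-1 * th)) * (d - c')%:R) = expR (2 * (S^-1 * th)) ^+ (d - c').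
      by rewrite mulrC expRM_natl.
    rewrite -exprMn; apply: lerXn2r; rewrite ?nnegrE//.
      by rewrite mulr_ge0// expR_ge0.
    by apply: le_trans sigE; rewrite ler_wpM2l// ler_expR.
  + rewrite ler_expR; apply: le_trans thm.
    rewrite -!mulrA ler_pM2l// mulrCA ler_wpM2l//.
    rewrite mulrC ler_pdivrMr// mulrC -ler_pdivrMr//.
    by apply: le_trans YS; rewrite le_max lexx orbT.
- rewrite lef_pV2 ?posrE ?exprn_gt0//; last by rewrite (lt_le_trans _ (Yg_ge1 _)).
  by apply: lerXn2r => //; rewrite nnegrE ?(ltW S0)// (le_trans _ (Yg_ge1 _)).
Qed.

(** [kappa1] bounds the sum of [q1] over the length and the order of an interval with fixed right
    end; [kappa] also includes the sum over the gap on its right, which gives the factor 8 m. *)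
Let kappa1 := A * expR 1 * (2 * x) * (1 - sig)^-1.
Let kappa := kappa1 * (8 * m).
Let kappa1_ge0 : 0 <= kappa1.
Proof. by rewrite !mulr_ge0// ?expR_ge0// invr_ge0 subr_ge0 ltW. Qed.
Let kappa_ge0 : 0 <= kappa.
Proof. by rewrite mulr_ge0// mulr_ge0// ltW. Qed.

Let sum_geom (z : R) n : 0 <= z < 1 -> \sum_(i < n) z ^+ i <= (1 - z)^-1.
Proof.
move=> /andP[z0 z1]; rewrite -[leRHS]mul1r ler_pdivlMr ?subr_gt0//.
have := subrX1 z n => /(congr1 -%R); rewrite opprB -mulNr opprB mulrC => <-.
by rewrite gerBl exprn_ge0.
Qed.

Let sum_x : \sum_(p < k) x ^+ p.+1 <= 2 * x.
Proof.
under eq_bigr do rewrite exprS.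
rewrite -mulr_sumr mulrC ler_wpM2r//.
have xlt1 : x < 1 by apply: le_lt_trans x_half _; rewrite invf_lt1// ltr1n.
apply: le_trans (sum_geom _ _) _; first by rewrite x0 xlt1.
rewrite -[leRHS]invrK lef_pV2 ?posrE ?subr_gt0// ?invr_gt0//.
have := x_half; rewrite -/x; lra.
Qed.

Let sum_sig d : \sum_(c < d) sig ^+ (d - c) <= (1 - sig)^-1.
Proof.
rewrite (reindex_inj rev_ord_inj)/=.
apply: le_trans (sum_geom d _); last by rewrite sig0 sig1.
apply: ler_sum => i _; rewrite subKn//; apply: ler_wiXn2l => //; exact: ltW.
Qed.

(** Since Yg g >= (m + g) / (2 m), the sum is compared with that of 1 / (m + g)^2, whose terms are
    dominated by the telescoping differences of 1 / (m + g). *)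
Let sum_Yg c : \sum_(d < c.+1) Yg (c - d) ^- 2 <= 8 * m.
Proof.
rewrite (reindex_inj rev_ord_inj)/=.
rewrite (eq_bigr (fun i : 'I_c.+1 => Yg i ^- 2)); last first.
  by move=> i _; rewrite subSS subKn// -ltnS.
have YE g : Yg g ^- 2 <= 4 * m ^+ 2 / (m + g%:R) ^+ 2.
  have mg : 0 < m + g%:R by rewrite ltr_pwDl.
  have h : (m + g%:R) / (2 * m) <= Yg g.
    rewrite ler_pdivrMr ?mulr_gt0// /Yg.
    have [h|h] := leP 1 (g%:R / m).
      by rewrite mulrCA divfK ?gt_eqF//; move: h; rewrite ler_pdivlMr// mul1r; lra.
    by move: h; rewrite ltr_pdivrMr// !mul1r; lra.
  rewrite -[leRHS]invrK lef_pV2 ?posrE; last 2 first.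
  - by rewrite exprn_gt0// (lt_le_trans _ (Yg_ge1 _)).
  - by rewrite invr_gt0 divr_gt0// ?mulr_gt0// exprn_gt0.
  rewrite invfM invrK [leLHS](_ : _ = ((m + g%:R) / (2 * m)) ^+ 2).
    have h0 : 0 <= (m + g%:R) / (2 * m) by rewrite divr_ge0 ?(ltW mg)// mulr_ge0// ltW.
    by apply: lerXn2r => //; rewrite nnegrE// (le_trans h0 h).
  rewrite expr_div_n exprMn mulrC; congr (_ / (_ * _)); ring.
have H n : \sum_(g < n.+1) Yg g ^- 2 <= 4 * m ^+ 2 * (m ^- 2 + (m^-1 - (m + n%:R)^-1)).
  elim: n => [|n IH].
    by rewrite big_ord1 addr0 subrr addr0; apply: le_trans (YE 0%N) _; rewrite addr0.
  rewrite big_ord_recr/=; apply: le_trans (lerD IH (YE n.+1)) _.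
  have mn : 0 < m + n%:R by rewrite ltr_pwDl.
  have mn1 : 0 < m + n.+1%:R by rewrite ltr_pwDl.
  have key : (m + n.+1%:R) ^- 2 <= (m + n%:R)^-1 - (m + n.+1%:R)^-1.
    rewrite -subr_ge0.
    have -> : (m + n%:R)^-1 - (m + n.+1%:R)^-1 - (m + n.+1%:R) ^- 2
       = ((m + n%:R)^-1) * (m + n.+1%:R) ^- 2.
      move: mn1; rewrite -natr1 => mn1; field.
      by rewrite (gt_eqF mn) addrA in mn1 *; rewrite gt_eqF.
    by rewrite mulr_ge0// invr_ge0 ?exprn_ge0// ltW.
  rewrite -mulrDr ler_pM2l ?mulr_gt0 ?exprn_gt0//.
  by move: key; lra.
apply: le_trans (H c) _.
have : m ^- 2 + (m^-1 - (m + c%:R)^-1) <= 2 / m.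
  have : m ^- 2 <= m^-1.
    by rewrite lef_pV2 ?posrE ?exprn_gt0// expr2 ler_peMl// ltW.
  have : 0 <= (m + c%:R)^-1 by rewrite invr_ge0 addr_ge0// ltW.
  lra.
move=> h; apply: le_trans (ler_wpM2l _ h) _; first by rewrite mulr_ge0// exprn_ge0// ltW.
rewrite le_eqVlt; apply/orP; left; apply/eqP; field; exact: lt0r_neq0.
Qed.

Let sum_q1 n : \sum_(c < n) \sum_(p < k) q1 (n - c) p.+1 <= kappa1.
Proof.
rewrite /q1 /kappa1.
under eq_bigr => c _ do under eq_bigr => p _ do rewrite mulrAC [A * _ * _]mulrAC -mulrA.
under eq_bigr => c _ do rewrite -mulr_sumr -mulr_suml mulrA.
rewrite -mulr_sumr ler_pM//.
- by rewrite mulr_ge0 ?sumr_ge0// => [|i _]; rewrite ?mulr_ge0 ?expR_ge0 ?exprn_ge0.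
- by rewrite sumr_ge0// => i _; rewrite exprn_ge0.
- by rewrite ler_wpM2l// mulr_ge0 ?expR_ge0.
Qed.

Let sum_qw c :
  \sum_(d < c.+1) \sum_(c' < d) \sum_(p < k) qw (c - d) (d - c') p.+1 <= kappa.
Proof.
rewrite /kappa mulrC.
apply: (@le_trans _ _ (\sum_(d < c.+1) Yg (c - d) ^- 2 * kappa1)).
  apply: ler_sum => d _; rewrite /qw.
  under eq_bigr => c' _ do rewrite -mulr_suml.
  rewrite -mulr_suml mulrC ler_wpM2l//.
  by rewrite invr_ge0 exprn_ge0// (le_trans _ (Yg_ge1 _)).
by rewrite -mulr_suml ler_wpM2r.
Qed.

Let fsum_norm N c (F : seq (nat * nat * nat) -> fps R) X : 0 <= X ->
  (forall t, famOK c t -> size t = N -> fnorm k t0 (F t) <= X * gwt c t) ->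
  fnorm k t0 (fsum k N c F) <= X * kappa ^+ N.
Proof.
elim: N c F X => [|N IH] c F X X0 FX /=; first exact: (FX [::]).
apply: (le_trans (fnorm_sum _ _ _ _ t0_ge0)).
apply: (@le_trans _ _ (\sum_(d < c.+1) \sum_(c' < d) \sum_(p < k)
    X * qw (c - d) (d - c') p.+1 * kappa ^+ N)).
  apply: ler_sum => d _; apply: (le_trans (fnorm_sum _ _ _ _ t0_ge0)).
  apply: ler_sum => c' _; apply: (le_trans (fnorm_sum _ _ _ _ t0_ge0)).
  apply: ler_sum => p _; apply: IH => [|t tok szt]; first by rewrite mulr_ge0.
  rewrite -mulrA; apply: FX; last by rewrite /= szt.
  by rewrite /= ltn_ord -ltnS ltn_ord tok.
under eq_bigr => d _ do under eq_bigr => c' _ do rewrite -mulr_suml -mulr_sumr.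
under eq_bigr => d _ do rewrite -mulr_suml -mulr_sumr.
rewrite -mulr_suml -mulr_sumr exprS mulrA ler_wpM2r//.
  by rewrite exprn_ge0.
by rewrite ler_wpM2l.
Qed.

Hypotheses (kap : kappa <= 2^-1) (kap1 : 2 * C3 * kappa1 <= th).

Variables (Z : nat -> fps R) (e : seq (nat * nat * nat) -> R).
Hypothesis Z00 : Z 0%N = 1.
Hypothesis Z_const : forall n, Z n 0%N = 1.
Hypothesis Z_rec : forall n q, (q <= k)%N -> Z n.+1 q - Z n q =
  \sum_(N < k) \sum_(c < n.+1) \sum_(p < k) fsum k N c
     (fun t => let t' := (c : nat, n.+1, p.+1) :: t in
        (mono (e t') (ord t') * Z (strt n.+1 t')) q).
Hypothesis e_bound : forall n c p t, famOK n ((c, n, p) :: t) ->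
  (ord ((c, n, p) :: t) <= k)%N ->
  `|e ((c, n, p) :: t)| <=
     C3 * wgt ((c, n, p) :: t) * ymax n ((c, n, p) :: t) ^- (3 * k).

Lemma gas_inverse : exists Zi : nat -> fps R, forall n, Z n * Zi n = 1.
Proof.
have [Zi ZiE] := boolp.choice (fun n => fps_inv (Z_const n)).
by exists Zi.
Qed.

Variables (Zi : nat -> fps R) (ZiE : forall n, Z n * Zi n = 1).

Let r n := Z n.+1 * Zi n.
Let u n := Z n * Zi n.+1.

Let ru n : r n * u n = 1.
Proof.
by rewrite /r /u [Z n * _]mulrC mulrACA ZiE [Zi n * _]mulrC ZiE mulr1.
Qed.

Let r0 n : r n 0%N = 1.
Proof.
have := congr1 (fun f : fps R => f 0%N) (ZiE n).
rewrite fpsME big_ord1 subnn Z_const mul1r => Zi0.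
by rewrite /r fpsME big_ord1 subnn Z_const mul1r Zi0.
Qed.

(** [r n - 1] has no constant term, so reducing the radius by s reduces its norm to s th: this is
    where the growth rate becomes proportional to the radius. *)
Let u_norm s n : 0 <= s <= 1 -> fnorm k t0 (r n - 1) <= th ->
  fnorm k (s * t0) (u n) <= expR (2 * (s * th)).
Proof.
move=> s01 H; have /andP[s0 s1] := s01.
have sth : s * th <= 2^-1.
  by apply: le_trans th_half; rewrite ler_piMl.
have sth0 : 0 <= s * th by rewrite mulr_ge0.
apply: (le_trans (@fnorm_inv _ _ _ (s * th) _ _ _ (ru n) _ _)).
- by rewrite mulr_ge0.
- apply: le_trans (fnorm_scale_down k t0_ge0 s01 _) _.
    by rewrite fpsBE r0 fps1E subrr.
  by rewrite ler_wpM2l.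
- by apply: le_lt_trans sth _; rewrite invf_lt1// ltr1n.
set a := s * th in sth sth0 *.
rewrite -[leLHS]mul1r ler_pdivrMr ?subr_gt0; last first.
  by apply: le_lt_trans sth _; rewrite invf_lt1// ltr1n.
(* 1 / (1 - a) <= exp (2 a), from exp (2 a) >= 1 + 2 a and (1 + 2 a) (1 - a) >= 1 on [0, 1/2]. *)
apply: le_trans (ler_wpM2r _ (expR_ge1Dx (2 * a))); last first.
  by rewrite subr_ge0; apply: le_trans sth _; rewrite invf_le1// ler1n.
nra.
Qed.

Let ZZ_norm s c n : (c <= n)%N -> 0 <= s <= 1 ->
  (forall i, (i < n)%N -> fnorm k t0 (r i - 1) <= th) ->
  fnorm k (s * t0) (Z c * Zi n) <= expR (2 * (s * th) * (n - c)%:R).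
Proof.
move=> lcn s01 H; have /andP[s0 s1] := s01; have st0 : 0 <= s * t0 by rewrite mulr_ge0.
elim: n lcn H => [|n IH].
  by rewrite leqn0 => /eqP -> _; rewrite ZiE subnn mulr0 expR0 fnorm1.
rewrite leq_eqVlt => /predU1P[-> _|]; first by rewrite ZiE subnn mulr0 expR0 fnorm1.
rewrite ltnS => lcn H.
have -> : Z c * Zi n.+1 = (Z c * Zi n) * u n.
  by rewrite /u -mulrA [Zi n * _]mulrA [Zi n * Z n]mulrC ZiE mul1r.
apply: le_trans (fnormM _ _ _ st0) _.
rewrite subSn// -[(n - c).+1%:R]natr1 mulrDr mulr1 expRD; apply: ler_pM; rewrite ?fnorm_ge0//.
  by apply: IH => // i /ltnW; exact: H.
by apply: u_norm => //; exact: H.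
Qed.

(** Strong induction in time: dividing the renewal equation by [Z n] leaves factors Z_c / Z_n with c
    <= n, which are products of inverses of earlier ratios. *)
Lemma gas_ratio n : fnorm k t0 (Z n.+1 * Zi n - 1) <= th.
Proof.
rewrite -/(r n); elim/ltn_ind: n => n IH.
pose F c p t := let t' := (c, n.+1, p) :: t in
  mono (e t') (ord t') * Z (strt n.+1 t') * Zi n.
have -> : fnorm k t0 (r n - 1) = fnorm k t0
   (\sum_(N < k) \sum_(c < n.+1) \sum_(p < k) fsum k N c (F c p.+1)).
  have -> : r n - 1 = (Z n.+1 - Z n) * Zi n by rewrite mulrBl ZiE.
  pose G := \sum_(N < k) \sum_(c < n.+1) \sum_(p < k) fsum k N c
     (fun t => let t' := (c : nat, n.+1, p.+1) :: t in
        (mono (e t') (ord t') * Z (strt n.+1 t'))).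
  transitivity (fnorm k t0 (G * Zi n)).
    (* The recursion is available only in degrees up to k, which is all that the norm sees. *)
    apply: eq_fnorm => q qk; rewrite !fpsME; apply: eq_bigr => i _.
    congr (_ * _); rewrite fpsBE Z_rec; last by rewrite (leq_trans _ qk)// -ltnS.
    rewrite /G fps_sumE; apply: eq_bigr => N _; rewrite fps_sumE; apply: eq_bigr => c _.
    by rewrite fps_sumE; apply: eq_bigr => p _; rewrite fsum_fpsE.
  congr fnorm; rewrite mulr_suml; apply: eq_bigr => N _.
  rewrite mulr_suml; apply: eq_bigr => c _; rewrite mulr_suml; apply: eq_bigr => p _.
  by rewrite fsumMr.
have Fle (N : nat) c p t : (N < k)%N -> (c < n.+1)%N -> (0 < p)%N -> famOK c t -> size t = N ->
  fnorm k t0 (F c p t) <= C3 * q1 (n.+1 - c) p * gwt c t.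
  move=> Nk cn p0 tok szt; rewrite /F; set t' := (c, n.+1, p) :: t => /=.
  have t'ok : famOK n.+1 t' by rewrite /= cn leqnn p0.
  (* Families of order above k have zero norm, so [e_bound] is needed only up to order k. *)
  have [okt|kot] := leqP (ord t') k; last first.
    apply: (@le_trans _ _ 0); last by rewrite mulr_ge0 ?gwt_ge0// mulr_ge0.
    rewrite /fnorm big1// => i _; rewrite -mulrA monoME.
    rewrite ifN ?normr0 ?mul0r// -ltnNge.
    by rewrite (leq_trans _ kot)// ltnS -ltnS.
  have [C30' |] := ltP 0 C3; last first.
    move=> C3n; have C3z : C3 = 0 by apply/eqP; rewrite eq_le C3n C30.
    have : `|e t'| <= 0 by rewrite (le_trans (e_bound t'ok okt))// C3z !mul0r.
    rewrite normr_le0 => /eqP ->; rewrite C3z !mul0r -mulrA.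
    by rewrite /fnorm big1// => i _; rewrite monoME; case: ifP => _; rewrite ?mul0r normr0 mul0r.
  set S := ymax n.+1 t'; have S1 : 1 <= S := ymax_ge1 _ _.
  have S0 : 0 < S by exact: lt_le_trans S1.
  have stle : (strt c t <= n)%N.
    by apply: leq_trans (famOK_strt tok) _; rewrite -ltnS.
  rewrite -mulrA; apply: le_trans (fnormM _ _ _ t0_ge0) _.
  (* The radius is reduced by the largest gap S of this very family: the growth rate drops to th /
     S, at the price S^k. *)
  have Zle : fnorm k t0 (Z (strt c t) * Zi n) <=
      S ^+ k * expR (2 * (S^-1 * th) * (n.+1 - strt c t)%:R).
    apply: le_trans (fnorm_scale_up _ _ t0_ge0 S1) _.
    rewrite ler_wpM2l ?exprn_ge0 ?(ltW S0)//.
    apply: le_trans (ZZ_norm stle _ IH) _.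
      by rewrite invr_ge0 ltW//= invf_le1.
    rewrite ler_expR ler_wpM2l ?ler_nat ?leq_sub2r//.
    by rewrite !mulr_ge0// invr_ge0 ltW.
  apply: (@le_trans _ _ (C3 * (wgt t' * S ^- (3 * k)) * t0 ^+ ord t' *
      (S ^+ k * expR (2 * (S^-1 * th) * (n.+1 - strt c t)%:R)))).
    apply: ler_pM => //; rewrite ?fnorm_ge0//.
    apply: le_trans (fnorm_mono _ _ _ t0_ge0) _; rewrite ler_wpM2r ?exprn_ge0//.
    by rewrite mulrA; exact: e_bound.
  have -> : C3 * q1 (n.+1 - c) p * gwt c t = C3 * gwt n.+1 t'.
    by rewrite /= subnn /qw /Yg mul0r max_l// expr1n invr1 mulr1 mulrA.
  (* After the price S^k there remains S^(-2) for each interval, since [t'] has at most k of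
     them. *)
  have Sx : S ^- (3 * k) * S ^+ k <= S ^- (2 * size t').
    have -> : S ^- (3 * k) * S ^+ k = S ^- (2 * k).
      have -> : (3 * k = 2 * k + k)%N by rewrite -mulSnr.
      by rewrite exprD invfM divfK// expf_neq0// gt_eqF.
    rewrite lef_pV2 ?posrE ?exprn_gt0//; apply: ler_weXn2l => //.
    by rewrite leq_pmul2l//= szt.
  have := wgt_gwt t'ok (lexx S).
  have -> : strt n.+1 t' = strt c t by [].
  have := wgt_ge0 t'; move: (wgt t') => w w0 /(ler_wpM2l C30).
  apply: le_trans.
  rewrite [leLHS](_ : _ = C3 * (w * t0 ^+ ord t' *
    expR (2 * (S^-1 * th) * (n.+1 - strt c t)%:R) * (S ^- (3 * k) * S ^+ k))).
    rewrite ler_pM2l// ler_wpM2l//.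
    by rewrite !mulr_ge0 ?exprn_ge0 ?expR_ge0.
  by move: (S ^- (3 * k)) (t0 ^+ ord t') (expR _) (S ^+ k) => a1 a2 a3 a4; ring.
apply: (@le_trans _ _ (\sum_(N < k) \sum_(c < n.+1) \sum_(p < k)
   C3 * q1 (n.+1 - c) p.+1 * kappa ^+ N)).
  apply: le_trans (fnorm_sum _ _ _ _ t0_ge0) _; apply: ler_sum => N _.
  apply: le_trans (fnorm_sum _ _ _ _ t0_ge0) _; apply: ler_sum => c _.
  apply: le_trans (fnorm_sum _ _ _ _ t0_ge0) _; apply: ler_sum => p _.
  apply: fsum_norm => [|t tok szt]; first by rewrite mulr_ge0.
  exact: (@Fle N).
under eq_bigr => N _ do under eq_bigr => c _ do rewrite -mulr_suml -mulr_sumr.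
under eq_bigr => N _ do rewrite -mulr_suml -mulr_sumr.
rewrite -mulr_sumr.
apply: le_trans kap1.
rewrite [leRHS](_ : _ = (C3 * kappa1) * 2); last by ring.
apply: ler_pM.
- rewrite mulr_ge0// sumr_ge0// => c _; exact: sumr_ge0.
- by apply: sumr_ge0 => i _; rewrite exprn_ge0.
- by rewrite ler_wpM2l.
- apply: le_trans (sum_geom _ _) _.
    by rewrite kappa_ge0/= (le_lt_trans kap)// invf_lt1// ltr1n.
  have kap_lt1 : kappa < 1 by rewrite (le_lt_trans kap)// invf_lt1// ltr1n.
  have kap2 : 2^-1 <= 1 - kappa by exact: half_le_1B.
  by rewrite -[leRHS]invrK lef_pV2 ?posrE ?subr_gt0 ?invr_gt0.
Qed.

(** [Z T] is the product of its ratios and logarithmic derivatives add up. Each active step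
    contributes at most k th / (1 - th) <= k in norm; the factor Rad^k extracts the coefficient. *)
Lemma gas_log_derivative T T0 : (forall n, (n <= T0)%N -> Z n = 1) ->
  `|(fpsD (Z T) * Zi T) k| <= (T - T0)%:R * k%:R * Rad ^+ k.
Proof.
move=> Z1.
have H : fnorm k t0 (fpsD (Z T) * Zi T) <= (T - T0)%:R * k%:R.
  elim: T => [|T IH].
    by rewrite Z00 fpsD1 mul0r fnorm0.
  have [le|lt] := leqP T.+1 T0.
    by rewrite Z1// fpsD1 mul0r fnorm0 mulr_ge0.
  have -> : fpsD (Z T.+1) * Zi T.+1 = fpsD (Z T) * Zi T + fpsD (r T) * u T.
    have E : Z T.+1 = r T * Z T by rewrite /r -mulrA [Zi T * _]mulrC ZiE mulr1.
    have E2 : Zi T.+1 = Zi T * u T.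
      by rewrite /u mulrA [Zi T * _]mulrC ZiE mul1r.
    rewrite {1}E fpsDM mulrDl addrC; congr (_ + _).
      rewrite E2 [RHS]mulrC.
      rewrite -[RHS]mul1r -(ru T); ring.
    rewrite E2 -[RHS]mul1r -(ZiE T); ring.
  apply: le_trans (fnormD _ _ _ t0_ge0) _.
  rewrite subSn// -[(T - T0).+1%:R]natr1 mulrDl mul1r; apply: lerD => //.
  apply: le_trans (fnormM _ _ _ t0_ge0) _.
  have rth := gas_ratio T; rewrite -/(r T) in rth.
  have ule : fnorm k t0 (u T) <= (1 - th)^-1.
    apply: (fnorm_inv t0_ge0 (ru T) rth).
    by apply: le_lt_trans th_half _; rewrite invf_lt1// ltr1n.
  have Dle : fnorm k t0 (fpsD (r T)) <= k%:R * th.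
    apply: le_trans (fnormDz _ _ t0_ge0) _; rewrite ler_wpM2l// r0.
    have -> : mono 1 0 = 1 :> fps R by apply/funext => -[|j].
    exact: rth.
  apply: le_trans (ler_pM _ _ Dle ule) _; rewrite ?fnorm_ge0//.
  have th2 := half_le_1B th_half.
  have th1 : 0 < 1 - th by apply: lt_le_trans th2; rewrite invr_gt0.
  by rewrite -mulrA ler_piMr// ler_pdivrMr ?mul1r// (le_trans th_half).
rewrite -ler_pdivrMr ?exprn_gt0// -exprVn.
exact: le_trans (fnorm_coef _ t0_ge0 (leqnn k)) H.
Qed.

End Gas.

(** * Bounded measurable functions and the norm of BV *)

Definition bmeas (R : realType) (d : measure_display) (X : measurableType d)
    (f : X -> R) : Prop :=
  measurable_fun setT f /\ exists M : R, forall x, `|f x| <= M.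

Section BoundedMeasurable.
Variables (R : realType) (d : measure_display) (X : measurableType d).
Implicit Types f g : X -> R.

Lemma bmeas_cst (c : R) : bmeas (fun _ : X => c).
Proof. by split; [exact: measurable_cst | exists `|c|]. Qed.

Lemma bmeasD f g : bmeas f -> bmeas g -> bmeas (fun x => f x + g x).
Proof.
move=> [mf [M Mf]] [mg [N Ng]]; split; first exact: measurable_funD.
by exists (M + N) => x; rewrite (le_trans (ler_normD _ _))// lerD.
Qed.

Lemma bmeasM f g : bmeas f -> bmeas g -> bmeas (fun x => f x * g x).
Proof.
move=> [mf [M Mf]] [mg [N Ng]]; split; first exact: measurable_funM.
by exists (M * N) => x; rewrite normrM ler_pM.
Qed.

Lemma bmeasZ (c : R) f : bmeas f -> bmeas (fun x => c * f x).
Proof. by move=> bf; apply: bmeasM => //; exact: bmeas_cst. Qed.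

Lemma bmeasB f g : bmeas f -> bmeas g -> bmeas (fun x => f x - g x).
Proof.
move=> bf bg; have := bmeasD bf (bmeasZ (-1) bg).
by under eq_fun do rewrite mulN1r.
Qed.

Lemma bmeasX f n : bmeas f -> bmeas (fun x => f x ^+ n).
Proof.
move=> bf; elim: n => [|n IH].
  by under eq_fun do rewrite expr0; exact: bmeas_cst.
by under eq_fun do rewrite exprS; exact: bmeasM.
Qed.

Lemma bmeas_sum (I : Type) (s : seq I) (P : pred I) (F : I -> X -> R) :
  (forall i, P i -> bmeas (F i)) -> bmeas (fun x => \sum_(i <- s | P i) F i x).
Proof.
move=> bF; elim: s => [|i s IH].
  by under eq_fun do rewrite big_nil; exact: bmeas_cst.
under eq_fun do rewrite big_cons; case: (boolP (P i)) => [Pi|nPi].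
  exact: (bmeasD (bF i Pi) IH).
by [].
Qed.

Lemma bmeas_comp (d' : measure_display) (X' : measurableType d') (h : X' -> X) f :
  measurable_fun setT h -> bmeas f -> bmeas (f \o h).
Proof.
move=> mh [mf [M Mf]]; split; first exact: measurableT_comp.
by exists M => x; exact: Mf.
Qed.

Variable mu : probability X R.
Notation ig f := (mu.-integrable setT (EFin \o f)).

Lemma ig_bmeas f : bmeas f -> ig f.
Proof.
move=> [mf [M Mf]]; apply: measurable_bounded_integrable => //.
  by rewrite (@le_lt_trans _ _ 1%E) ?probability_le1 ?ltry.
by exists M; split; rewrite ?num_real// => y My x _; exact: le_trans (Mf x) (ltW My).
Qed.

Lemma igM f g : bmeas f -> ig g -> ig (fun x => f x * g x).
Proof.
move=> [mf [M Mf]] ig_g; apply: (@integrableMr _ _ _ mu setT measurableT f (EFin \o g)) => //.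
by exists M; split; rewrite ?num_real// => y My x _; exact: le_trans (Mf x) (ltW My).
Qed.

Lemma igD f g : ig f -> ig g -> ig (fun x => f x + g x).
Proof. by move=> iF iG; exact: (integrableD measurableT iF iG). Qed.

Lemma igZ (c : R) f : ig f -> ig (fun x => c * f x).
Proof. exact/igM/bmeas_cst. Qed.

Lemma igB f g : ig f -> ig g -> ig (fun x => f x - g x).
Proof. by move=> iF iG; exact: (integrableB measurableT iF iG). Qed.

Lemma ig_sum (I : Type) (s : seq I) (P : pred I) (F : I -> X -> R) :
  (forall i, P i -> ig (F i)) -> ig (fun x => \sum_(i <- s | P i) F i x).
Proof.
move=> iF; elim: s => [|i s IH].
  by under [X in EFin \o X]eq_fun do rewrite big_nil; apply/ig_bmeas/bmeas_cst.
under [X in EFin \o X]eq_fun do rewrite big_cons; case: (boolP (P i)) => [Pi|nPi].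
  exact: (igD (iF i Pi) IH).
by [].
Qed.

Lemma ig_measurable f : ig f -> measurable_fun setT f.
Proof. by move=> /measurable_int /measurable_EFinP. Qed.

Lemma Rint_cst (c : R) : \int[mu]_x c = c.
Proof. by rewrite Rintegral_cst// /fine/= probability_setT mulr1. Qed.

Lemma RintD f g : ig f -> ig g ->
  \int[mu]_x (f x + g x) = \int[mu]_x f x + \int[mu]_x g x.
Proof. by move=> iF iG; exact: RintegralD. Qed.

Lemma RintB f g : ig f -> ig g ->
  \int[mu]_x (f x - g x) = \int[mu]_x f x - \int[mu]_x g x.
Proof. by move=> iF iG; exact: RintegralB. Qed.

Lemma RintZ (c : R) f : ig f -> \int[mu]_x (c * f x) = c * \int[mu]_x f x.
Proof. by move=> iF; exact: RintegralZl. Qed.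

Lemma Rint_sum (I : Type) (s : seq I) (P : pred I) (F : I -> X -> R) :
  (forall i, P i -> ig (F i)) ->
  \int[mu]_x (\sum_(i <- s | P i) F i x) = \sum_(i <- s | P i) \int[mu]_x F i x.
Proof.
move=> iF; elim: s => [|i s IH].
  by under eq_Rintegral do rewrite big_nil; rewrite Rint_cst big_nil.
under eq_Rintegral do rewrite big_cons; rewrite big_cons; case: (boolP (P i)) => [Pi|nPi].
  by rewrite RintD ?IH//; [exact: iF | exact: ig_sum].
exact: IH.
Qed.

Lemma Rint_le f (M : R) : bmeas f -> (forall x, `|f x| <= M) -> `|\int[mu]_x f x| <= M.
Proof.
move=> bf fM; have ifm := ig_bmeas bf.
apply: le_trans (le_normr_Rintegral measurableT ifm) _.
rewrite -[leRHS]Rint_cst; apply: le_Rintegral => //.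
- exact: (integrable_norm ifm).
- exact/ig_bmeas/bmeas_cst.
Qed.

Lemma Rint_ae f g : ig f -> ig g -> (\forall x \ae mu, f x = g x) ->
  \int[mu]_x f x = \int[mu]_x g x.
Proof.
move=> iF iG fg; congr fine; apply: ae_eq_integral => //.
- exact: measurable_int iF.
- exact: measurable_int iG.
by apply: filterS fg => x -> _.
Qed.

Lemma Rint_ge0_le f g : ig f -> ig g -> (\forall x \ae mu, f x <= g x) ->
  \int[mu]_x f x <= \int[mu]_x g x.
Proof.
move=> iF iG fg; rewrite -subr_ge0 -RintB//.
pose h x := Num.max (g x - f x) 0.
have ih : ig (fun x => g x - f x) by exact: igB.
have mh : measurable_fun setT h by apply: measurable_maxr => //; exact: ig_measurable ih.
have igh : ig h.
  apply: (le_integrable measurableT _ _ ih) => //; first exact/measurable_EFinP.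
  move=> x _ /=; rewrite lee_fin /h; have [|] := leP 0 (g x - f x) => hx.
    by rewrite ger0_norm.
  by rewrite normr0.
rewrite (@Rint_ae _ h)//; last first.
  by apply: filterS fg => x fgx; rewrite /h max_l// subr_ge0.
by apply: Rintegral_ge0 => x _; rewrite /h le_max lexx orbT.
Qed.

Lemma Rint_norm_ae f (M : R) : ig f -> (\forall x \ae mu, `|f x| <= M) ->
  `|\int[mu]_x f x| <= M.
Proof.
move=> iF fM; apply: le_trans (le_normr_Rintegral measurableT iF) _.
rewrite -[leRHS]Rint_cst; apply: Rint_ge0_le => //.
- exact: (integrable_norm iF).
- exact/ig_bmeas/bmeas_cst.
Qed.

(** The sign of f is an admissible test function and turns the integral into that of |f|. *)
Lemma ae_eq0_test f : ig f ->
  (forall g, bmeas g -> \int[mu]_x (f x * g x) = 0) -> \forall x \ae mu, f x = 0.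
Proof.
move=> iF H; have mf := ig_measurable iF.
pose g x := if f x < 0 then -1 else 1 : R.
have bg : bmeas g.
  split; last first.
    by exists 1 => x; rewrite /g; case: ifP; rewrite ?normrN normr1.
  apply: measurable_fun_ifT => //; exact: measurable_fun_ltr.
have := H g bg.
have -> : (fun x => f x * g x) = (fun x => `|f x|).
  apply/funext => x; rewrite /g; case: ltP => fx; first by rewrite mulrN1 ltr0_norm.
  by rewrite mulr1 ger0_norm.
move=> H0; have : (\int[mu]_x `|(EFin \o f) x| = 0)%E.
  rewrite -[LHS]fineK; first by rewrite -[X in X%:E]/(\int[mu]_x `|f x|) H0.
  exact: (integrable_fin_num _ (integrable_norm iF)).
move=> /ae_eq_integral_abs -/(_ measurableT (measurable_int _ iF)).
by apply: filterS => x /(_ I)/= [].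
Qed.

(** Transfer operators are given by duality alone, so this test is the source of every almost
    everywhere identity about them. *)
Lemma ae_eq_test f g : ig f -> ig g ->
  (forall u, bmeas u -> \int[mu]_x (f x * u x) = \int[mu]_x (g x * u x)) ->
  \forall x \ae mu, f x = g x.
Proof.
move=> iF iG H.
have H0 : \forall x \ae mu, f x - g x = 0.
  apply: ae_eq0_test => [|u bu]; first exact: igB.
  under eq_Rintegral do rewrite mulrBl.
  rewrite RintB ?H ?subrr//.
  - by under [X in EFin \o X]eq_fun do rewrite mulrC; exact: igM.
  - by under [X in EFin \o X]eq_fun do rewrite mulrC; exact: igM.
by apply: filterS H0 => x /eqP; rewrite subr_eq0 => /eqP.
Qed.

End BoundedMeasurable.

(** * The norm of BV on real functions *)

Section VariationNorm.
Variables (R : realType) (d : measure_display) (X : measurableType d).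
Variables (m : probability X R) (v : (X -> R[i]) -> \bar R) (Cv : R).
Hypothesis Hv : is_variation m v Cv.
Notation ig f := (m.-integrable setT (EFin \o f)).

Lemma normc_creal (f : X -> R) x : normc (creal f x) = `|f x|.
Proof. by rewrite /creal/= expr0n/= addr0 sqrtr_sqr. Qed.

Lemma cabs_creal (f : X -> R) : cabs (creal f) = (fun x => `|f x|%:E).
Proof. by apply/funext => x; rewrite /cabs normc_creal. Qed.

Lemma norm1_creal (f : X -> R) : norm1 m (creal f) = (\int[m]_x `|f x|%:E)%E.
Proof.
rewrite /norm1 Lnorm1 cabs_creal; apply: eq_integral => x _.
by rewrite /= normr_id.
Qed.

Lemma inL1_creal (f : X -> R) : inL1 m (creal f) <-> ig f.
Proof.
rewrite /inL1 norm1_creal /cmeasurable/=; split=> [[[mf _] fi]|iF].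
  by apply/integrableP; split; first exact/measurable_EFinP.
split; first by split; [exact: ig_measurable iF|exact: measurable_cst].
by case/integrableP : iF.
Qed.

(** Integrability is included because [v] is arbitrary outside L^1. *)
Definition bvle (u : X -> R) (c : R) : Prop :=
  ig u /\ (bvnorm m v (creal u) <= c%:E)%E.

Lemma bvle_inBV u c : bvle u c -> inBV m v (creal u).
Proof.
move=> [iu H]; split; first exact/inL1_creal.
apply: le_lt_trans (lt_le_trans (ltry c) (lexx _)).
by apply: le_trans H; rewrite /bvnorm leeDr// norm1_creal integral_ge0.
Qed.

Lemma bvle_ae u w c : bvle u c -> ig w -> (\forall x \ae m, u x = w x) -> bvle w c.
Proof.
move=> [iu H] iw uw; split=> //; apply: le_trans H.
rewrite /bvnorm !norm1_creal le_eqVlt; apply/orP; left; apply/eqP; congr (_ + _)%E.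
  apply: ae_eq_integral => //.
  - exact/measurable_EFinP/measurableT_comp/(ig_measurable iw).
  - exact/measurable_EFinP/measurableT_comp/(ig_measurable iu).
  - by apply: filterS uw => x -> _.
apply: (var_ae Hv); [exact/inL1_creal|exact/inL1_creal|].
by apply: filterS uw => x; rewrite /creal => ->.
Qed.

Lemma bvle_ge0 u c : bvle u c -> 0 <= c.
Proof.
move=> [iu H]; rewrite -lee_fin; apply: le_trans H.
by rewrite adde_ge0 ?(var_ge0 Hv)// norm1_creal integral_ge0.
Qed.

Lemma bvle_le u a b : a <= b -> bvle u a -> bvle u b.
Proof. by move=> ab [iu H]; split=> //; rewrite (le_trans H)// lee_fin. Qed.

Lemma bvle_int u c : bvle u c -> `|\int[m]_x u x| <= c.
Proof.
move=> [iu H]; apply: le_trans (le_normr_Rintegral measurableT iu) _.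
rewrite -lee_fin; apply: le_trans H.
rewrite /Rintegral fineK; last exact: (integrable_fin_num _ (integrable_norm iu)).
by rewrite /bvnorm norm1_creal leeDl// (var_ge0 Hv).
Qed.

Lemma bvleD u w a b : bvle u a -> bvle w b -> bvle (fun x => u x + w x) (a + b).
Proof.
move=> [iu Hu] [iw Hw]; split; first exact: igD.
rewrite EFinD; apply: le_trans (leeD Hu Hw); rewrite /bvnorm addeACA; apply: leeD.
  rewrite !norm1_creal -ge0_integralD//; last 2 first.
  - exact/measurable_EFinP/measurableT_comp/(ig_measurable iu).
  - exact/measurable_EFinP/measurableT_comp/(ig_measurable iw).
  apply: ge0_le_integral => //.
  - exact/measurable_EFinP/measurableT_comp/(ig_measurable (igD iu iw)).
  - apply: emeasurable_funD.
      exact/measurable_EFinP/measurableT_comp/(ig_measurable iu).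
    exact/measurable_EFinP/measurableT_comp/(ig_measurable iw).
  - by move=> x _; rewrite -EFinD lee_fin ler_normD.
have -> : creal (fun x => u x + w x) = (fun x => creal u x + creal w x).
  by apply/funext => x; rewrite /creal; congr Complex; rewrite addr0.
by apply: (V2 Hv); exact/inL1_creal.
Qed.

Lemma bvleZ (t : R) u a : bvle u a -> bvle (fun x => t * u x) (`|t| * a).
Proof.
move=> [iu Hu]; split; first exact: igZ.
have -> : bvnorm m v (creal (fun x => t * u x)) = (`|t|%:E * bvnorm m v (creal u))%E.
  rewrite /bvnorm muleDr//; last first.
    by rewrite ge0_adde_def// inE ?(var_ge0 Hv)// norm1_creal integral_ge0.
  congr (_ + _)%E.
    rewrite !norm1_creal -ge0_integralZl//.
      by apply: eq_integral => x _; rewrite normrM.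
    exact/measurable_EFinP/measurableT_comp/(ig_measurable iu).
  have -> : creal (fun x => t * u x) = (fun x => Complex t 0 * creal u x).
    by apply/funext => x; rewrite /creal; congr Complex; rewrite ?mulr0 ?mul0r ?subr0 ?addr0.
  rewrite (V1 Hv); last exact/inL1_creal.
  by rewrite /= expr0n/= addr0 sqrtr_sqr.
by rewrite EFinM lee_wpmul2l.
Qed.

Lemma bvle_cst (c : R) : bvle (fun=> c) `|c|.
Proof.
have -> : (fun _ : X => c) = (fun x => c * (fun=> 1) x) by apply/funext => x; rewrite mulr1.
rewrite -[`|c|]mulr1; apply: bvleZ; split; first exact/ig_bmeas/bmeas_cst.
rewrite /bvnorm norm1_creal.
have -> : v (creal (fun=> 1)) = 0%E := V5 Hv.
rewrite adde0 normr1 integral_cst//. by rewrite mul1e probability_le1.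
Qed.

Lemma bvleB u w a b : bvle u a -> bvle w b -> bvle (fun x => u x - w x) (a + b).
Proof.
move=> Hu Hw; have := bvleD Hu (bvleZ (-1) Hw).
rewrite normrN normr1 mul1r.
by under [X in bvle X]eq_fun do rewrite mulN1r.
Qed.

Lemma bvle_sum (I : Type) (s : seq I) (P : pred I) (F : I -> X -> R) (c : I -> R) :
  (forall i, P i -> bvle (F i) (c i)) ->
  bvle (fun x => \sum_(i <- s | P i) F i x) (\sum_(i <- s | P i) c i).
Proof.
move=> iF; elim: s => [|i s IH].
  under [X in bvle X]eq_fun do rewrite big_nil; rewrite big_nil.
  by have := bvle_cst 0; rewrite normr0.
under [X in bvle X]eq_fun do rewrite big_cons; rewrite big_cons; case: (boolP (P i)) => [Pi|nPi].
  exact: (bvleD (iF i Pi) IH).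
exact: IH.
Qed.

Lemma normoo_le u a : bvle u a -> (normoo m (creal u) <= (Cv * a)%:E)%E.
Proof.
move=> [iu Hu]; apply: le_trans (V3 Hv _) _; first exact/inL1_creal.
by rewrite EFinM lee_wpmul2l// lee_fin (le_trans _ (V3_ge1 Hv)).
Qed.

Lemma bvle_sup u a : bvle u a -> \forall x \ae m, `|u x| <= Cv * a.
Proof.
move=> Hu; have := normoo_le Hu; rewrite /normoo unlock/= probability_setT lte01 cabs_creal.
by move=> /ess_supP; apply: filterS => x /=; rewrite lee_fin normr_id.
Qed.

(** By [V3] the supremum norms are at most Cv a and Cv b. The L^1 norm of the product and the first
    term of [V8] together give Cv a b, and the second term of [V8] gives another Cv a b. *)
Lemma bvleM f g a b : bmeas f -> bvle f a -> bvle g b ->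
  bvle (fun x => f x * g x) (2 * Cv * a * b).
Proof.
move=> bf Hf Hg; have [iF Hf'] := Hf; have [iG Hg'] := Hg.
have ifg : ig (fun x => f x * g x) by exact: igM.
split=> //.
have a0 := bvle_ge0 Hf; have b0 := bvle_ge0 Hg.
have Cv0 : 0 <= Cv by apply: le_trans (V3_ge1 Hv).
have nf := normoo_le Hf; have ng := normoo_le Hg.
have E : creal (fun x => f x * g x) = (fun x => creal f x * creal g x).
  by apply/funext => x; rewrite /creal; congr Complex; rewrite ?mulr0 ?mul0r ?subr0 ?addr0.
have vfg : (v (creal (fun x => f x * g x)%R) <= (Cv * a)%:E * v (creal g) + (Cv * b)%:E * a%:E)%E.
  rewrite E; apply: le_trans (V8 Hv _ _ _) _; [exact/inL1_creal|exact/inL1_creal| |].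
    by rewrite -E; exact/inL1_creal.
  apply: leeD; first by apply: lee_wpmul2r => //; exact: (var_ge0 Hv).
  apply: lee_pmul => //.
  - by rewrite /normoo Lnorm_ge0.
  - exact: (var_ge0 Hv).
  - by apply: le_trans Hf'; rewrite /bvnorm leeDr// norm1_creal integral_ge0.
have nfg : (norm1 m (creal (fun x => f x * g x)%R) <= (Cv * a)%:E * norm1 m (creal g))%E.
  rewrite !norm1_creal -ge0_integralZl//; last 2 first.
  - exact/measurable_EFinP/measurableT_comp/(ig_measurable iG).
  - by rewrite lee_fin mulr_ge0.
  have mg := ig_measurable iG.
  apply: ae_ge0_le_integral => //.
  - exact/measurable_EFinP/measurableT_comp/(ig_measurable ifg).
  - by move=> x _; rewrite mule_ge0// lee_fin mulr_ge0.
  - by apply: emeasurable_funM => //; exact/measurable_EFinP/measurableT_comp.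
  - apply: filterS (bvle_sup Hf) => x fx _.
    by rewrite -EFinM lee_fin normrM ler_wpM2r.
apply: le_trans (leeD nfg vfg) _.
rewrite addeA -ge0_muleDr ?(var_ge0 Hv) ?norm1_creal ?integral_ge0//.
rewrite -norm1_creal -/(bvnorm m v (creal g)).
have -> : (2 * Cv * a * b)%:E = ((Cv * a)%:E * b%:E + (Cv * b)%:E * a%:E)%E.
  by rewrite -!EFinM -EFinD; congr EFin; ring.
by rewrite leeD2r// lee_wpmul2l// lee_fin mulr_ge0.
Qed.

End VariationNorm.

(** * Averaging over the environment *)

Section AnnealedExpansion.
Variables (R : realType) (d : measure_display) (Om : measurableType d).
Variables (P : probability Om R) (k : nat).
Notation ig f := (P.-integrable setT (EFin \o f)).
Notation E f := (\int[P]_w f w).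

(** [Lt c] and [Ge c] stand for the bounded functions of the environment before time c and from time
    c on. *)
Variables (Lt Ge : nat -> (Om -> R) -> Prop).
Hypothesis Lt_b : forall c f, Lt c f -> bmeas f.
Hypothesis Ge_b : forall c f, Ge c f -> bmeas f.
Hypothesis Lt_le : forall c c' f, (c <= c')%N -> Lt c f -> Lt c' f.
Hypothesis Ge_le : forall c c' f, (c' <= c)%N -> Ge c f -> Ge c' f.
Hypothesis Lt_step : forall c f g (a : R), Lt c f -> Lt c g ->
  Lt c (fun w => f w * (g w - a)).
Hypothesis Ge_step : forall c f g (a : R), Ge c f -> Ge c g ->
  Ge c (fun w => f w * (g w - a)).

Variable ab : nat -> R.
Hypothesis cov_le : forall c c' f g (F G : R), (c <= c')%N -> Lt c f -> Ge c' g ->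
  (forall w, `|f w| <= F) -> (forall w, `|g w| <= G) ->
  `|E (fun w => f w * g w) - E f * E g| <= F * G * ab (c' - c).

Variables (Zq : nat -> Om -> fps R) (V : nat -> nat -> nat -> Om -> R).
Variables (A B rho : R).
Hypothesis Zq_b : forall n q, bmeas (fun w => Zq n w q).
Hypothesis Zq0 : forall w, Zq 0 w = 1.
Hypothesis Zq_const : forall n w, Zq n w 0%N = 1.
Hypothesis Zq_rec : \forall w \ae P, forall n q, Zq n.+1 w q = Zq n w q +
  \sum_(c < n.+1) \sum_(p < q) V c n.+1 p.+1 w * Zq c w (q - p.+1)%N.
Hypothesis V_Lt : forall c c' p, Lt c' (V c c' p).
Hypothesis V_Ge : forall c c' p, Ge c (V c c' p).
Hypothesis V_le : forall c c' p w, `|V c c' p w| <= A * B ^+ p * rho ^+ (c' - c).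

Definition Zann (n : nat) : fps R := fun q => E (fun w => Zq n w q).

(** Everything accumulated on the right is centred before the next weight on its left multiplies
    it. *)
Fixpoint Yfold (Y : Om -> R) (t : seq (nat * nat * nat)) : Om -> R :=
  if t is (c, c', p) :: t' then Yfold (fun w => V c c' p w * (Y w - E Y)) t' else Y.

(** The same product nested from the other end, with the left part centred; it depends only on the
    past and is the adjoint of [Yfold]. *)
Fixpoint Lfold (t : seq (nat * nat * nat)) : Om -> R :=
  match t with
  | [::] => fun=> 1
  | [:: (c, c', p)] => V c c' p
  | (c, c', p) :: t' => fun w => V c c' p w * (Lfold t' w - E (Lfold t'))
  end.

(** These are centred moments in the sense of Statulevicius, not classical joint cumulants. *)
Definition fam_cumulant (t : seq (nat * nat * nat)) : R :=
  if t is (c, c', p) :: t' then E (Yfold (V c c' p) t') else 0.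

Let V_b c c' p : bmeas (V c c' p). Proof. exact: Lt_b (V_Lt c c' p). Qed.

Let Yfold_b Y t : bmeas Y -> bmeas (Yfold Y t).
Proof.
elim: t Y => //= -[[c c'] p] t IH Y bY; apply: IH; apply: bmeasM => //.
by apply: bmeasB => //; exact: bmeas_cst.
Qed.

Let mean_le (Y : Om -> R) (G : R) : bmeas Y -> (forall w, `|Y w| <= G) ->
  forall w, `|Y w - E Y| <= 2 * G.
Proof.
move=> bY YG w; apply: le_trans (ler_normB _ _) _.
by have := YG w; have := Rint_le P bY YG; lra.
Qed.

Let vb_ge0 c c' p : 0 <= A * B ^+ p * rho ^+ (c' - c).
Proof.
by have [w _] : exists w : Om, True;
  [by exists point | exact: le_trans (normr_ge0 _) (V_le c c' p w)].
Qed.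

Let wgt0 t : 0 <= wgt A B rho t.
Proof. by elim: t => //= -[[c c'] p] t IH; rewrite mulr_ge0. Qed.

Let Yfold_le Y t (G : R) : bmeas Y -> (forall w, `|Y w| <= G) ->
  forall w, `|Yfold Y t w| <= 2 ^+ size t * wgt A B rho t * G.
Proof.
elim: t Y G => [|[[c c'] p] t IH] Y G bY YG w /=; first by rewrite !mul1r.
have b1 : bmeas (fun w => V c c' p w * (Y w - E Y)).
  by apply: bmeasM => //; apply: bmeasB => //; exact: bmeas_cst.
have H w' : `|V c c' p w' * (Y w' - E Y)| <= A * B ^+ p * rho ^+ (c' - c) * (2 * G).
  by rewrite normrM; apply: ler_pM => //; exact: mean_le.
apply: le_trans (IH _ _ b1 H w) _.
by rewrite le_eqVlt; apply/orP; left; apply/eqP; rewrite exprS; ring.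
Qed.

Let Lfold_Lt c t : famOK c t -> t != [::] -> Lt c (Lfold t).
Proof.
elim: t c => // -[[c1 c'] p] t IH c /= /and4P[lt le p0 tok] _.
case: t IH tok => [_ _|a t IH tok]; first exact: Lt_le le (V_Lt _ _ _).
apply: Lt_step; first exact: Lt_le le (V_Lt _ _ _).
by apply: Lt_le (IH c1 tok isT); exact: leq_trans (ltnW lt) le.
Qed.

Let Lfold_bnd c t : famOK c t -> t != [::] ->
  forall w, `|Lfold t w| <= 2 ^+ size t * wgt A B rho t.
Proof.
elim: t c => // -[[c1 c'] p] t IH c /= /and4P[lt le p0 tok] _ w.
have h2 : 0 <= A * B ^+ p * rho ^+ (c' - c1) by exact: vb_ge0.
case: t IH tok => [_ _|a t IH tok].
  rewrite /= expr1 mulr1; apply: le_trans (V_le _ _ _ _) _.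
  by rewrite ler_peMl// ler1n.
have bL : bmeas (Lfold (a :: t)) by apply: Lt_b (Lfold_Lt tok _).
rewrite normrM; apply: le_trans (ler_pM _ _ (V_le _ _ _ _) (mean_le bL (IH c1 tok isT) w)) _ => //.
by rewrite le_eqVlt; apply/orP; left; apply/eqP; rewrite exprS; ring.
Qed.

Let centred_selfadjoint (f g : Om -> R) : bmeas f -> bmeas g ->
  E (fun w => f w * (g w - E g)) = E (fun w => (f w - E f) * g w).
Proof.
move=> bf bg.
under eq_Rintegral do rewrite mulrBr; under [RHS]eq_Rintegral do rewrite mulrBl.
have ifg := ig_bmeas P (bmeasM bf bg).
have bZ := bmeasZ (E f) bg.
rewrite RintB//; last by apply/ig_bmeas/bmeasM => //; exact: bmeas_cst.
rewrite RintB//; last exact: ig_bmeas.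
rewrite RintZ; last exact: ig_bmeas.
under [X in _ - X = _]eq_Rintegral do rewrite mulrC.
by rewrite RintZ; [rewrite mulrC | exact: ig_bmeas].
Qed.

Let mean_centred (f : Om -> R) : bmeas f -> E (fun w => f w - E f) = 0.
Proof.
move=> bf; rewrite RintB ?Rint_cst ?subrr//; first exact: ig_bmeas.
exact/ig_bmeas/bmeas_cst.
Qed.

(** Centring is self-adjoint, so the brackets can be moved one after the other from the right factor
    to the left one. *)
Lemma Yfold_adjoint c Y t : bmeas Y -> famOK c t -> t != [::] ->
  E (Yfold Y t) = E (fun w => Lfold t w * (Y w - E Y)).
Proof.
elim: t c Y => // -[[c1 c'] p] t IH c Y bY /= /and4P[lt le p0 tok] _.
have bYc : bmeas (fun w => Y w - E Y) by apply: bmeasB => //; exact: bmeas_cst.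
have bW : bmeas (fun w => V c1 c' p w * (Y w - E Y)) by exact: bmeasM.
case: t IH tok => [//|a t] IH tok.
rewrite (IH c1 _ bW tok isT).
have bL : bmeas (Lfold (a :: t)) by apply: Lt_b (Lfold_Lt tok _).
rewrite centred_selfadjoint//; apply: eq_Rintegral => w _.
by rewrite mulrA [_ * V _ _ _ _]mulrC.
Qed.

Lemma Yfold_cat Y t1 t2 : Yfold Y (t1 ++ t2) = Yfold (Yfold Y t1) t2.
Proof. by elim: t1 Y => //= -[[c c'] p] t1 IH Y; rewrite IH. Qed.

Lemma Yfold_Ge c Y t : Ge c Y -> famOK c t -> Ge (strt c t) (Yfold Y t).
Proof.
elim: t c Y => //= -[[c1 c'] p] t IH c Y GY /and4P[lt le p0 tok].
apply: IH => //; apply: Ge_step; first exact: V_Ge.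
by apply: Ge_le GY; exact: leq_trans (ltnW lt) le.
Qed.

Let famOK_cat c t1 t2 : famOK c (t1 ++ t2) = famOK c t1 && famOK (strt c t1) t2.
Proof.
elim: t1 c => //= -[[c1 c'] p] t1 IH c; rewrite IH -!andbA; congr (_ && (_ && (_ && _))).
Qed.

Let wgt_cat t1 t2 : wgt A B rho (t1 ++ t2) = wgt A B rho t1 * wgt A B rho t2.
Proof. by elim: t1 => [|[[c c'] p] t1 IH] /=; rewrite ?mul1r// IH mulrA. Qed.

(** Cut at the gap between t1 and the interval ending at c': by adjointness the expectation is the
    covariance of a function of the past before c' with one of the future from [strt c t1]. The cut
    is free, so the largest gap can be used. *)
Let fam_split c Y (G : R) t1 c1 c' p t2 : Ge c Y -> (forall w, `|Y w| <= G) ->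
  famOK c (t1 ++ (c1, c', p) :: t2) ->
  `|E (Yfold Y (t1 ++ (c1, c', p) :: t2))| <=
    2 ^+ size (t1 ++ (c1, c', p) :: t2) * wgt A B rho (t1 ++ (c1, c', p) :: t2) * G
      * ab (strt c t1 - c').
Proof.
move=> GY YG; rewrite famOK_cat => /andP[ok1 ok2].
have GY1 := Yfold_Ge GY ok1.
have bY1 := Ge_b GY1.
rewrite Yfold_cat (Yfold_adjoint bY1 ok2)//.
have le' : (c' <= strt c t1)%N by move: ok2 => /= /and4P[].
have ok2' : famOK c' ((c1, c', p) :: t2).
  by move: ok2 => /= /and4P[-> _ -> ->]; rewrite leqnn.
have LL := Lfold_Lt ok2' isT.
have LB := Lfold_bnd ok2' isT.
have YB := Yfold_le t1 (Ge_b GY) YG.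
have := cov_le le' LL GY1 LB YB.
have -> : E (fun w => Lfold ((c1, c', p) :: t2) w * (Yfold Y t1 w - E (Yfold Y t1))) =
   E (fun w => Lfold ((c1, c', p) :: t2) w * Yfold Y t1 w) -
   E (Lfold ((c1, c', p) :: t2)) * E (Yfold Y t1).
  have bL := Lt_b LL.
  under eq_Rintegral do rewrite mulrBr.
  rewrite RintB; [|exact/ig_bmeas/bmeasM|apply/ig_bmeas/bmeasM => //; exact: bmeas_cst].
  under [X in _ - X = _]eq_Rintegral do rewrite mulrC.
  by rewrite RintZ ?[_ * E (Lfold _)]mulrC//; exact: ig_bmeas.
move=> /le_trans; apply; rewrite le_eqVlt; apply/orP; left; apply/eqP.
by rewrite wgt_cat size_cat exprD; ring.
Qed.

Variables (mm C3 : R).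
Hypothesis C31 : 1 <= C3.
Hypothesis ab_le : forall g, ab g <= C3 * Yg mm g ^- (3 * k).

Let ymax_bound c t (x C : R) : 0 <= C -> x <= C ->
  (forall t1 c1 c' p t2, t = t1 ++ (c1, c', p) :: t2 ->
     x <= C * Yg mm (strt c t1 - c') ^- (3 * k)) ->
  x <= C * ymax mm c t ^- (3 * k).
Proof.
elim: t c => [|[[c1 c'] p] t IH] c C0 xC H /=; first by rewrite expr1n invr1 mulr1.
have [h|h] := leP (Yg mm (c - c')) (ymax mm c1 t).
  apply: IH => // t1 c2 c3 p2 t2 tE.
  by apply: (H ((c1, c', p) :: t1) c2 c3 p2 t2); rewrite tE.
exact: (H [::]).
Qed.

(** Each centring may double the supremum; the doubling is absorbed into A. *)
Lemma wgt2 t : wgt (2 * A) B rho t = 2 ^+ size t * wgt A B rho t.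
Proof.
by elim: t => [|[[c c'] p] t IH] /=; rewrite ?mulr1// IH exprS; ring.
Qed.

Lemma fam_cumulant_bound n c p t : famOK n ((c, n, p) :: t) ->
  `|fam_cumulant ((c, n, p) :: t)| <=
     C3 * wgt (2 * A) B rho ((c, n, p) :: t) * ymax mm n ((c, n, p) :: t) ^- (3 * k).
Proof.
move=> ok; have := ok => /= /and4P[lt _ p0 tok].
set w0 := A * B ^+ p * rho ^+ (n - c).
have w00 : 0 <= w0 by exact: vb_ge0.
have YB w : `|V c n p w| <= w0 by exact: V_le.
set W := 2 ^+ size t * wgt A B rho t * w0.
have W0 : 0 <= W by rewrite /W mulr_ge0// mulr_ge0// exprn_ge0.
have key : `|E (Yfold (V c n p) t)| <= (C3 * W) * ymax mm c t ^- (3 * k).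
  apply: ymax_bound.
  - by rewrite mulr_ge0// (le_trans _ C31).
  - have := Rint_le P (Yfold_b t (V_b c n p)) (Yfold_le t (V_b c n p) YB).
    by move=> /le_trans; apply; rewrite ler_peMl.
  - move=> t1 c1 c' p1 t2 tE; rewrite {1}tE.
    apply: le_trans (fam_split (V_Ge c n p) YB _) _; first by rewrite -tE.
    rewrite -tE -/W; apply: le_trans (ler_wpM2l W0 (ab_le _)) _.
    by rewrite mulrA [W * C3]mulrC.
rewrite subnn; have -> : Num.max (Yg mm 0) (ymax mm c t) = ymax mm c t.
  by rewrite max_r// /Yg mul0r max_l// ymax_ge1.
apply: le_trans key _; apply: ler_wpM2r.
  by rewrite invr_ge0 exprn_ge0// (le_trans _ (ymax_ge1 mm c t)).
rewrite wgt2 /W -/w0.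
have X0 : 0 <= 2 ^+ size t * wgt A B rho t by rewrite mulr_ge0// exprn_ge0.
have -> : 2 * A * B ^+ p * rho ^+ (n - c) = 2 * w0 by rewrite /w0; ring.
rewrite ler_wpM2l ?(le_trans _ C31)//.
rewrite [leRHS](_ : _ = 2 * W); last by rewrite /W; ring.
by rewrite -/W ler_peMl// ler1n.
Qed.

(** [Zq c] is unrolled down to [Zq 0] = 1, where only E Y = 0 is left. The terms with index d' come
    from the step from d' - 1 to d'. *)
Let expand_gap c q Y : bmeas Y -> E Y = 0 ->
  E (fun w => Zq c w q * Y w) = \sum_(d' < c.+1) \sum_(c' < d') \sum_(p < q)
    E (fun w => Zq c' w (q - p.+1)%N * (V c' d' p.+1 w * Y w)).
Proof.
move=> bY Y0; elim: c => [|c IH].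
  rewrite big_ord1 big_ord0; under eq_Rintegral do rewrite Zq0 fps1E.
  by rewrite RintZ ?Y0 ?mulr0//; exact: ig_bmeas.
rewrite big_ord_recr/= -IH.
transitivity (E (fun w => Zq c w q * Y w + \sum_(c' < c.+1) \sum_(p < q)
    Zq c' w (q - p.+1)%N * (V c' c.+1 p.+1 w * Y w))).
  apply: Rint_ae.
  - exact/ig_bmeas/bmeasM.
  - apply/ig_bmeas/bmeasD; first exact: bmeasM.
    apply: bmeas_sum => c' _; apply: bmeas_sum => p _.
    by apply: bmeasM => //; exact: bmeasM.
  - apply: filterS Zq_rec => w ->; rewrite mulrDl mulr_suml; congr (_ + _).
    apply: eq_bigr => c' _; rewrite mulr_suml; apply: eq_bigr => p _; ring.
have bT c' p : bmeas (fun w => Zq c' w (q - p.+1)%N * (V c' c.+1 p.+1 w * Y w)).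
  by apply: bmeasM => //; exact: bmeasM.
rewrite RintD; last 2 first.
- exact/ig_bmeas/bmeasM.
- by apply/ig_bmeas/bmeas_sum => c' _; apply: bmeas_sum.
congr (_ + _); rewrite Rint_sum; last by move=> c' _; apply/ig_bmeas/bmeas_sum.
by apply: eq_bigr => c' _; rewrite Rint_sum// => p _; exact: ig_bmeas.
Qed.

Let term (Y : Om -> R) c q t : R :=
  if (ord t <= q)%N then E (Yfold Y t) * Zann (strt c t) (q - ord t)%N else 0.

Let fsum0 N c (F : seq (nat * nat * nat) -> R) : (forall t, F t = 0) -> fsum k N c F = 0.
Proof.
move=> F0; elim: N c F F0 => [|N IH] c F F0 /=; first exact: F0.
by apply: big1 => i _; apply: big1 => j _; apply: big1 => p _; apply: IH.
Qed.

(** Y is split into its mean, which yields the empty family, and its centred part, to which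
    [expand_gap] applies. Each round uses up at least one order in z, so it ends after q rounds. *)
Let expand_all J c q Y : bmeas Y -> (q <= k)%N -> (q <= J)%N ->
  E (fun w => Zq c w q * Y w) = \sum_(N < J.+1) fsum k N c (term Y c q).
Proof.
elim: J c q Y => [|J IH] c q Y bY qk qJ.
  move: qJ; rewrite leqn0 => /eqP ->; rewrite big_ord1 /= /term /ord/= subnn.
  under eq_Rintegral do rewrite Zq_const mul1r.
  rewrite /Zann; under [X in _ * X]eq_Rintegral do rewrite Zq_const.
  by rewrite Rint_cst mulr1.
have bYc : bmeas (fun w => Y w - E Y) by apply: bmeasB => //; exact: bmeas_cst.
have -> : E (fun w => Zq c w q * Y w) =
    E Y * Zann c q + E (fun w => Zq c w q * (Y w - E Y)).
  rewrite /Zann -RintZ; last exact/ig_bmeas.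
  rewrite -RintD; last 2 first.
  - exact/ig_bmeas/bmeasZ.
  - exact/ig_bmeas/bmeasM.
  by apply: eq_Rintegral => w _; ring.
rewrite big_ord_recl/= {1}/term /ord/= subn0; congr (_ + _).
rewrite expand_gap//; last exact: mean_centred.
rewrite [RHS]exchange_big/=; apply: eq_bigr => d' _.
rewrite [RHS]exchange_big/=; apply: eq_bigr => c' _.
rewrite [RHS]exchange_big/= (big_ord_widen k (fun p => E (fun w =>
  Zq c' w (q - p.+1)%N * (V c' d' p.+1 w * (Y w - E Y)))) qk) big_mkcond/=.
apply: eq_bigr => p _; case: ifPn => [pq|npq]; last first.
  rewrite big1// => N _; apply: fsum0 => t; rewrite /term ifF//.
  apply/negbTE; rewrite -ltnNge /ord/=; apply: leq_trans (leq_addr _ _).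
  by rewrite ltnS leqNgt.
rewrite IH.
- apply: eq_bigr => N _; congr fsum; apply/funext => t; rewrite /term /ord/= -/(ord t).
  rewrite -[in RHS](subnK pq) addnC leq_add2r subnDr.
  by case: ifP.
- by apply: bmeasM.
- exact: leq_trans (leq_subr _ _) qk.
- by rewrite leq_subLR (leq_trans qJ)// addSn ltnS leq_addl.
Qed.

Lemma Zann_rec n q : (q <= k)%N -> Zann n.+1 q - Zann n q =
  \sum_(N < k) \sum_(c < n.+1) \sum_(p < k) fsum k N c
     (fun t => let t' := (c : nat, n.+1, p.+1) :: t in
        (mono (fam_cumulant t') (ord t') * Zann (strt n.+1 t')) q).
Proof.
move=> qk.
have bT c p : bmeas (fun w => V c n.+1 p.+1 w * Zq c w (q - p.+1)%N) by exact: bmeasM.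
have -> : Zann n.+1 q - Zann n q =
    \sum_(c < n.+1) \sum_(p < q) E (fun w => Zq c w (q - p.+1)%N * V c n.+1 p.+1 w).
  rewrite /Zann -RintB; [|exact: ig_bmeas|exact: ig_bmeas].
  transitivity (E (fun w => \sum_(c < n.+1) \sum_(p < q)
      V c n.+1 p.+1 w * Zq c w (q - p.+1)%N)).
    apply: Rint_ae; first by apply/ig_bmeas/bmeasB.
      by apply/ig_bmeas/bmeas_sum => c _; apply: bmeas_sum.
    by apply: filterS Zq_rec => w ->; rewrite addrC addKr.
  rewrite Rint_sum; last by move=> c _; apply/ig_bmeas/bmeas_sum.
  apply: eq_bigr => c _; rewrite Rint_sum; last by move=> p _; exact: ig_bmeas.
  by apply: eq_bigr => p _; apply: eq_Rintegral => w _; rewrite mulrC.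
rewrite [RHS]exchange_big/=; apply: eq_bigr => c _; rewrite [RHS]exchange_big/=.
rewrite (big_ord_widen k (fun p => E (fun w =>
  Zq c w (q - p.+1)%N * V c n.+1 p.+1 w)) qk) big_mkcond/=.
apply: eq_bigr => p _; case: ifPn => [pq|npq]; last first.
  rewrite big1// => N _; apply: fsum0 => t; rewrite monoME ifF//.
  apply/negbTE; rewrite -ltnNge /ord/=; apply: leq_trans (leq_addr _ _).
  by rewrite ltnS leqNgt.
(* The interval ending at [n.+1] already takes one order, so k - 1 rounds suffice for the rest. *)
have kE : k = k.-1.+1 by rewrite prednK// (leq_ltn_trans _ (ltn_ord p)).
rewrite (@expand_all k.-1)//.
- rewrite -kE; apply: eq_bigr => N _; congr fsum; apply/funext => t.
  rewrite /term monoME /ord/= -/(ord t).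
  rewrite -[in RHS](subnK pq) addnC leq_add2r subnDr.
  by case: ifP.
- exact: leq_trans (leq_subr _ _) qk.
- by rewrite (leq_trans (leq_sub2l q (ltn0Sn p)))// -[k.-1]subn1 leq_sub2r.
Qed.

End AnnealedExpansion.

(** * Twisted transfer operators in a fixed environment *)

Lemma exprD_fact (R : realType) (x y : R) p :
  (x + y) ^+ p / p`!%:R =
  \sum_(q < p.+1) (x ^+ (p - q) / (p - q)`!%:R) * (y ^+ q / q`!%:R).
Proof.
rewrite exprDn mulr_suml; apply: eq_bigr => q _.
have qp : (q <= p)%N by rewrite -ltnS.
rewrite -mulr_natr -(bin_fact qp) !natrM !invfM.
have C0 : 'C(p, q)%:R != 0 :> R by rewrite pnatr_eq0 -lt0n bin_gt0.
have q0 : q`!%:R != 0 :> R by rewrite pnatr_eq0 -lt0n fact_gt0.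
have pq0 : (p - q)`!%:R != 0 :> R by rewrite pnatr_eq0 -lt0n fact_gt0.
by field; rewrite C0 q0 pq0.
Qed.

Lemma sum_geom_half (R : realType) (y : R) p : 0 <= y <= 2^-1 ->
  \sum_(q < p) y ^+ q.+1 <= 2 * y.
Proof.
move=> /andP[y0 y2].
have H : \sum_(q < p) y ^+ q.+1 + 2 * y ^+ p.+1 <= 2 * y.
  elim: p => [|p IH]; first by rewrite big_ord0 add0r expr1.
  apply: le_trans IH; rewrite big_ord_recr/= -addrA lerD2l.
  have h : 0 <= y ^+ p.+1 by rewrite exprn_ge0.
  by rewrite [y ^+ p.+2]exprS; nra.
by apply: le_trans H; rewrite lerDl mulr_ge0// exprn_ge0.
Qed.

(* The series of coefficients of [\sum_q z ^ q f_q]. *)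
Definition diagsum (R : realType) (f : nat -> fps R) : fps R :=
  fun p => \sum_(q < p.+1) f q (p - q)%N.

Lemma diagsum_mono (R : realType) (f : nat -> fps R) p P : (p <= P)%N ->
  diagsum f p = (\sum_(q < P.+1) mono 1 q * f q) p.
Proof.
move=> pP; rewrite fps_sumE /diagsum.
rewrite (big_ord_widen P.+1 (fun q => f q (p - q)%N))// big_mkcond/=.
by apply: eq_bigr => q _; rewrite monoME ltnS mul1r.
Qed.

Lemma mul_diagsum (R : realType) (Z : fps R) (f : nat -> fps R) :
  Z * diagsum f = diagsum (fun q => Z * f q).
Proof.
apply/funext => p; rewrite (diagsum_mono _ (leqnn p)).
under [in RHS]eq_bigr do rewrite mulrCA.
rewrite -mulr_sumr !fpsME; apply: eq_bigr => i _.
by rewrite (diagsum_mono _ (leq_subr i p)).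
Qed.

Lemma diagsum_sum (R : realType) n (f : 'I_n -> nat -> fps R) :
  diagsum (fun q => \sum_(c < n) f c q) = \sum_(c < n) diagsum (f c).
Proof.
apply/funext => p; rewrite fps_sumE /diagsum exchange_big/=.
by apply: eq_bigr => q _; rewrite fps_sumE.
Qed.

(** * The renewal equation along a fixed sequence of maps *)

Section TransferChain.
Variables (R : realType) (d : measure_display) (X : measurableType d).
Variables (m : probability X R).
Variables (l : nat -> (X -> R) -> X -> R) (tau : nat -> X -> X) (phi : nat -> X -> R).
Notation ig f := (m.-integrable setT (EFin \o f)).

Fixpoint orbit_map (a n : nat) (x : X) : X :=
  if n is n'.+1 then tau (a + n') (orbit_map a n' x) else x.

Fixpoint orbit_sum (a n : nat) (x : X) : R :=
  if n is n'.+1 then orbit_sum a n' x + phi (a + n') (orbit_map a n' x) else 0.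

Definition qmoment (a n : nat) : fps R :=
  fun p => \int[m]_x (orbit_sum a n x ^+ p / p`!%:R).

Definition twist (j : nat) (f : nat -> X -> R) (p : nat) (x : X) : R :=
  \sum_(q < p.+1) phi j x ^+ q / q`!%:R * f (p - q)%N x.

(* The [z^p]-coefficients of the density started from the constant 1 at time
   [c] and recentred at every step by a multiple of 1. *)
Fixpoint nu (c n p : nat) : X -> R :=
  if n is n'.+1 then
    fun x => l (c + n') (twist (c + n') (nu c n') p) x
             - \int[m]_y twist (c + n') (nu c n') p y
  else fun=> (p == 0)%:R.

(* [weight c n] is carried by the interval [c, c + n + 1). *)
Definition weight (c n : nat) : fps R :=
  fun p => \int[m]_y twist (c + n) (nu c n) p y.

(** [l j] is not assumed linear: integrability and duality determine it almost everywhere, and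
    linearity follows almost everywhere. *)
Hypothesis l_ig : forall j u, ig u -> ig (l j u).
Hypothesis tau_meas : forall j, measurable_fun setT (tau j).
Hypothesis l_dual : forall j u g, ig u -> bmeas g ->
  \int[m]_x (l j u x * g x) = \int[m]_x (u x * g (tau j x)).
Hypothesis phi_b : forall j, bmeas (phi j).

Lemma orbit_map_meas a n : measurable_fun setT (orbit_map a n).
Proof.
elim: n => [|n IH]; first exact: measurable_id.
exact: (measurableT_comp (tau_meas _) IH).
Qed.

Lemma orbit_sum_bmeas a n : bmeas (orbit_sum a n).
Proof.
elim: n => [|n IH]; first exact: bmeas_cst.
apply: bmeasD IH _; exact: bmeas_comp (orbit_map_meas a n) (phi_b _).
Qed.

Lemma phi_fact_b j q : bmeas (fun x => phi j x ^+ q / q`!%:R).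
Proof. by apply: bmeasM; [exact: bmeasX | exact: bmeas_cst]. Qed.

Lemma orbit_fact_b a n q : bmeas (fun x => orbit_sum a n x ^+ q / q`!%:R).
Proof. by apply: bmeasM; [apply/bmeasX/orbit_sum_bmeas | exact: bmeas_cst]. Qed.

Lemma twist_ig j f p : (forall q, ig (f q)) -> ig (twist j f p).
Proof. by move=> fi; apply: ig_sum => q _; apply: igM => //; exact: phi_fact_b. Qed.

Lemma nu_ig c n p : ig (nu c n p).
Proof.
elim: n p => [|n IH] p /=; first exact/ig_bmeas/bmeas_cst.
apply: igB; last exact/ig_bmeas/bmeas_cst.
exact/l_ig/twist_ig.
Qed.

Lemma l_mean j u : ig u -> \int[m]_x l j u x = \int[m]_x u x.
Proof.
move=> iu; have := l_dual j iu (bmeas_cst X (1 : R)).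
by under eq_Rintegral do rewrite mulr1; under [in RHS]eq_Rintegral do rewrite mulr1.
Qed.

Lemma nu_mean c n p : \int[m]_x nu c n.+1 p x = 0.
Proof.
have it : ig (twist (c + n) (nu c n) p) by apply: twist_ig => q; exact: nu_ig.
rewrite /= RintB ?Rint_cst ?l_mean ?subrr//; first exact: l_ig.
exact/ig_bmeas/bmeas_cst.
Qed.

Let gq (j q : nat) (g : X -> R) (x : X) := phi j x ^+ q / q`!%:R * g (tau j x).

Let gq_b j q g : bmeas g -> bmeas (gq j q g).
Proof.
move=> bg; apply: bmeasM; first exact: phi_fact_b.
exact: bmeas_comp (tau_meas j) bg.
Qed.

Let igMr (u g : X -> R) : ig u -> bmeas g -> ig (fun x => u x * g x).
Proof.
by move=> iu bg; under [X in EFin \o X]eq_fun do rewrite mulrC; exact: igM.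
Qed.

(** Evolved densities are represented by their action on test functions g, which keeps the
    identities exact instead of almost everywhere. *)
Let tested (a n : nat) (g : X -> R) : fps R :=
  fun p => \int[m]_x (orbit_sum a n x ^+ p / p`!%:R * g (orbit_map a n x)).

Let nu_tested (c n : nat) (g : X -> R) : fps R :=
  fun p => \int[m]_x (nu c n p x * g x).

Let testedS a n g : bmeas g ->
  tested a n.+1 g = diagsum (fun q => tested a n (gq (a + n) q g)).
Proof.
move=> bg; apply/funext => p; rewrite /tested/= /diagsum.
rewrite -Rint_sum; last first.
  move=> q _; apply/ig_bmeas/bmeasM; first exact: orbit_fact_b.
  exact: bmeas_comp (orbit_map_meas a n) (gq_b _ _ bg).
apply: eq_Rintegral => x _; rewrite exprD_fact mulr_suml.
by apply: eq_bigr => q _; rewrite /gq !mulrA.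
Qed.

(** Duality moves one twisted step from g to the density; the mass subtracted by the recentring
    reappears as the weight times the integral of g. *)
Let nu_testedS c n g : bmeas g ->
  diagsum (fun q => nu_tested c n (gq (c + n) q g)) =
  nu_tested c n.+1 g + weight c n * (fun p => if p == 0 then \int[m]_x g x else 0).
Proof.
move=> bg; apply/funext => p.
have it : ig (twist (c + n) (nu c n) p) by apply: twist_ig => q; exact: nu_ig.
rewrite fpsDE.
have -> : (weight c n * (fun p => if p == 0 then \int[m]_x g x else 0)) p =
    weight c n p * \int[m]_x g x.
  by rewrite mulrC -/(mono (\int[m]_x g x) 0) monoME/= subn0 mulrC.
rewrite /nu_tested/= /diagsum.
under [in RHS]eq_Rintegral do rewrite mulrBl.
rewrite RintB; last 2 first.
- by apply: igMr => //; exact: l_ig.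
- by apply/ig_bmeas/bmeasZ.
rewrite [X in _ = _ - X + _]RintZ; last exact: ig_bmeas.
rewrite subrK l_dual// -Rint_sum; last first.
  by move=> q _; apply: igMr; [exact: nu_ig | exact: gq_b].
apply: eq_Rintegral => x _; rewrite mulr_suml; apply: eq_bigr => q _.
by rewrite /gq; ring.
Qed.

Lemma qmoment0 a n : qmoment a n 0 = 1.
Proof. by rewrite /qmoment; under eq_Rintegral do rewrite expr0 divr1; rewrite Rint_cst. Qed.

Lemma qmoment_start a : qmoment a 0 = 1.
Proof.
apply/funext => -[|p]; first by rewrite qmoment0 fps1E.
rewrite /qmoment/= fps1E/=.
by under eq_Rintegral do rewrite expr0n/= mul0r; rewrite Rint_cst.
Qed.

Let pointed (c : R) : fps R := fun p => if p == 0 then c else 0.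

(** The mass removed at a recentring restarts as a multiple of the density 1, and the total multiple
    started at time a + c is the moment series up to that time. *)
Let expansion a n := forall g, bmeas g ->
  tested a n g = \sum_(c < n.+1) qmoment a c * nu_tested (a + c) (n - c) g.

Let expansionS a n g : expansion a n -> bmeas g -> tested a n.+1 g =
  \sum_(c < n.+1) qmoment a c * (nu_tested (a + c) (n - c).+1 g +
    weight (a + c) (n - c) * pointed (\int[m]_x g x)).
Proof.
move=> IH bg; rewrite testedS//.
transitivity (diagsum (fun q => \sum_(c < n.+1) qmoment a c *
    nu_tested (a + c) (n - c) (gq (a + n) q g))).
  by congr diagsum; apply/funext => q; rewrite IH//; exact: gq_b.
rewrite diagsum_sum; apply: eq_bigr => c _; rewrite -mul_diagsum; congr (_ * _).
rewrite -nu_testedS//; congr diagsum; apply/funext => q.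
by rewrite -addnA subnKC// -ltnS.
Qed.

Let qmomentS_of a n : expansion a n ->
  qmoment a n.+1 = \sum_(c < n.+1) qmoment a c * weight (a + c) (n - c).
Proof.
move=> IH; have -> : qmoment a n.+1 = tested a n.+1 (fun=> 1).
  by apply/funext => p; apply: eq_Rintegral => x _; rewrite mulr1.
rewrite expansionS//; last exact: bmeas_cst.
apply: eq_bigr => c _; congr (_ * _).
have -> : nu_tested (a + c) (n - c).+1 (fun=> 1) = 0.
  apply/funext => p; rewrite fps0E -[RHS](nu_mean (a + c) (n - c) p).
  by apply: eq_Rintegral => x _; rewrite mulr1.
rewrite add0r -[RHS]mulr1; congr (_ * _); apply/funext => p.
by rewrite /pointed Rint_cst fps1E; case: p.
Qed.

Let tested_expand a n : expansion a n.
Proof.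
elim: n => [|n IH] g bg.
  rewrite big_ord1 subnn qmoment_start mul1r; apply/funext => p.
  rewrite /tested /nu_tested/=; apply: eq_Rintegral => x _.
  by case: p => [|p]; rewrite ?expr0 ?divr1// expr0n/= mul0r.
rewrite expansionS// (eq_bigr (fun c : 'I_n.+1 =>
    qmoment a c * nu_tested (a + c) (n - c).+1 g +
    qmoment a c * weight (a + c) (n - c) * pointed (\int[m]_x g x))); last first.
  by move=> c _; rewrite mulrDr mulrA.
(* By the renewal equation the removed masses add up to [qmoment a n.+1], the coefficient of the new
   start at time [n.+1]. *)
rewrite big_split/= -mulr_suml -(qmomentS_of IH) [RHS]big_ord_recr/= subnn.
congr (_ + _).
  by apply: eq_bigr => c _; rewrite subSn// -ltnS.
congr (_ * _); apply/funext => p; rewrite /nu_tested /pointed.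
by case: p => [|p]/=; under [RHS]eq_Rintegral do rewrite ?mul1r ?mul0r; rewrite ?Rint_cst.
Qed.

Lemma qmomentS a n :
  qmoment a n.+1 = \sum_(c < n.+1) qmoment a c * weight (a + c) (n - c).
Proof. exact/qmomentS_of/tested_expand. Qed.

(** * Exponential decay of the weights, uniform in the environment *)

Section Decay.
Variables (v : (X -> R[i]) -> \bar R) (Cv : R) (Hv : is_variation m v Cv).
Variables (K : nat -> R) (h : nat -> X -> R) (lam eps B0 B rho : R).

Fixpoint lit (j r : nat) (u : X -> R) : X -> R :=
  if r is r'.+1 then l (j + r') (lit j r' u) else u.

Hypotheses (eps_lam : eps < lam) (B00 : 0 <= B0) (Bpos : 0 < B).
Let B1 := 2 * Cv * B0.
Hypotheses (B1B : 2 * B1 <= B) (rho_ge : expR (- (lam - eps)) + 8 * (B1 / B) <= rho).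
Hypothesis K_ge1 : forall j, 1 <= K j.
Hypothesis K_slow : forall j r, K j <= K (j + r)%N * expR (eps * r%:R).
Hypothesis phi_bv : forall j, bvle m v (phi j) (B0 / K j).
Hypothesis decay : forall j r u c, bvle m v u c -> \int[m]_x u x = 0 ->
  bvle m v (lit j r u) (K j * expR (- (lam * r%:R)) * c).
Hypothesis h_ig : forall j, ig (h j).
Hypothesis h_eq : forall j, \forall x \ae m, l j (h j) x = h j.+1 x.
Hypothesis decay1 : forall j r,
  bvle m v (lit j r (fun x => 1 - h j x)) (K j * expR (- (lam * r%:R))).

Lemma l_ae j u w : ig u -> ig w -> (\forall x \ae m, u x = w x) ->
  \forall x \ae m, l j u x = l j w x.
Proof.
move=> iu iw uw; apply: ae_eq_test => [||g bg]; [exact: l_ig|exact: l_ig|].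
have bgt := bmeas_comp (tau_meas j) bg.
rewrite !l_dual//; apply: Rint_ae; [exact: igMr|exact: igMr|].
by apply: filterS uw => x ->.
Qed.

Lemma l_add j u w : ig u -> ig w ->
  \forall x \ae m, l j (fun y => u y + w y) x = l j u x + l j w x.
Proof.
move=> iu iw; apply: ae_eq_test => [||g bg]; first exact/l_ig/igD.
  by apply: igD; exact: l_ig.
have bgt := bmeas_comp (tau_meas j) bg.
rewrite l_dual//; last exact: igD.
under eq_Rintegral do rewrite mulrDl; under [RHS]eq_Rintegral do rewrite mulrDl.
rewrite RintD; [|exact: igMr|exact: igMr].
by rewrite RintD ?l_dual//; apply: igMr => //; exact: l_ig.
Qed.

Lemma l_scale j (t : R) u : ig u ->
  \forall x \ae m, l j (fun y => t * u y) x = t * l j u x.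
Proof.
move=> iu; apply: ae_eq_test => [||g bg]; first exact/l_ig/igZ.
  exact/igZ/l_ig.
have bgt := bmeas_comp (tau_meas j) bg.
rewrite l_dual//; last exact: igZ.
under eq_Rintegral do rewrite -mulrA; under [RHS]eq_Rintegral do rewrite -mulrA.
rewrite RintZ; last exact: igMr.
by rewrite RintZ ?l_dual//; apply: igMr => //; exact: l_ig.
Qed.

Lemma lit_ig j r u : ig u -> ig (lit j r u).
Proof. by move=> iu; elim: r => //= r IH; exact: l_ig. Qed.

Lemma lit_ae j r u w : ig u -> ig w -> (\forall x \ae m, u x = w x) ->
  \forall x \ae m, lit j r u x = lit j r w x.
Proof.
by move=> iu iw uw; elim: r => //= r IH; apply: l_ae => //; exact: lit_ig.
Qed.

Lemma lit_add j r u w : ig u -> ig w ->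
  \forall x \ae m, lit j r (fun y => u y + w y) x = lit j r u x + lit j r w x.
Proof.
move=> iu iw; elim: r => [|r IH] /=; first exact: aeW.
have h1 := l_ae (j + r) (lit_ig j r (igD iu iw)) (igD (lit_ig j r iu) (lit_ig j r iw)) IH.
have h2 := l_add (j + r) (lit_ig j r iu) (lit_ig j r iw).
by apply: filterS2 h1 h2 => x -> ->.
Qed.

Lemma lit_scale j r (t : R) u : ig u ->
  \forall x \ae m, lit j r (fun y => t * u y) x = t * lit j r u x.
Proof.
move=> iu; elim: r => [|r IH] /=; first exact: aeW.
have h1 := l_ae (j + r) (lit_ig j r (igZ t iu)) (igZ t (lit_ig j r iu)) IH.
have h2 := l_scale (j + r) t (lit_ig j r iu).
by apply: filterS2 h1 h2 => x -> ->.
Qed.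

Lemma lit_succ j r u : lit j r.+1 u = lit j.+1 r (l j u).
Proof.
elim: r => [|r IH]; first by rewrite /= addn0.
by rewrite [LHS]/= -[l (j + r) _]/(lit j r.+1 u) IH /= addSnnS.
Qed.

Let lam' := lam - eps.

(* Zero mean, and decaying at rate [lam - eps] in the BV norm at time [j + r]
   divided by [K (j + r)]: multiplication by [phi] absorbs this division, so
   these functions are stable under the perturbed transfer operators. *)
Definition adm (j : nat) (f : X -> R) (c : R) : Prop :=
  [/\ ig f, \int[m]_x f x = 0 &
      forall r, bvle m v (lit j r f) (c * K (j + r)%N * expR (- (lam' * r%:R)))].

Let K0 j : 0 < K j. Proof. exact: lt_le_trans (K_ge1 j). Qed.
Let Cv1 : 1 <= Cv. Proof. exact: V3_ge1 Hv. Qed.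
Let Cv0 : 0 <= Cv. Proof. exact: le_trans Cv1. Qed.
Let B10 : 0 <= B1. Proof. by rewrite !mulr_ge0. Qed.

(** Moving K from the starting time to the final time costs eps in the rate. *)
Let Kexp j r : K j * expR (- (lam * r%:R)) <= K (j + r)%N * expR (- (lam' * r%:R)).
Proof.
apply: le_trans (ler_wpM2r (expR_ge0 _) (K_slow j r)) _.
rewrite -mulrA -expRD ler_pM2l// ler_expR /lam' le_eqVlt; apply/orP; left.
by apply/eqP; ring.
Qed.

Lemma adm_ae j f g c : adm j f c -> ig g -> (\forall x \ae m, f x = g x) -> adm j g c.
Proof.
move=> [iF f0 fr] iG fg; split=> //; first by rewrite -f0; apply/esym; exact: Rint_ae.
by move=> r; apply: (bvle_ae Hv (fr r)); [exact: lit_ig | exact: lit_ae].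
Qed.

Lemma adm_le j f a b : a <= b -> adm j f a -> adm j f b.
Proof.
move=> ab [iF f0 fr]; split=> // r; apply: bvle_le (fr r).
by rewrite ler_wpM2r ?expR_ge0// ler_wpM2r// ltW.
Qed.

Lemma admD j f g a b : adm j f a -> adm j g b -> adm j (fun x => f x + g x) (a + b).
Proof.
move=> [iF f0 fr] [iG g0 gr]; split; first exact: igD.
  by rewrite RintD// f0 g0 addr0.
move=> r; rewrite mulrDl mulrDl.
apply: (bvle_ae Hv (bvleD Hv (fr r) (gr r))); first exact/lit_ig/igD.
by apply: filterS (lit_add j r iF iG) => x ->.
Qed.

Lemma admZ j (t : R) f a : adm j f a -> adm j (fun x => t * f x) (`|t| * a).
Proof.
move=> [iF f0 fr]; split; first exact: igZ.
  by rewrite RintZ// f0 mulr0.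
move=> r; rewrite -!mulrA [X in _ * X]mulrA.
apply: (bvle_ae Hv (bvleZ Hv t (fr r))); first exact/lit_ig/igZ.
by apply: filterS (lit_scale j r t iF) => x ->.
Qed.

Lemma adm_l j f c : adm j f c -> adm j.+1 (l j f) (c * expR (- lam')).
Proof.
move=> [iF f0 fr]; split; [exact: l_ig|by rewrite l_mean|move=> r].
rewrite -lit_succ; apply: bvle_le (fr r.+1).
rewrite addSnnS le_eqVlt; apply/orP; left; apply/eqP.
have -> : - (lam' * r.+1%:R) = - lam' + - (lam' * r%:R) by rewrite -natr1; ring.
by rewrite expRD; ring.
Qed.

Lemma adm_strong j f c : bvle m v f c -> \int[m]_x f x = 0 -> adm j f c.
Proof.
move=> fc f0; split=> //; first by case: fc.
move=> r; apply: bvle_le (decay j r fc f0).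
have c0 := bvle_ge0 Hv fc.
by rewrite mulrC -mulrA ler_wpM2l.
Qed.

Lemma adm_bv j f c : adm j f c -> bvle m v f (c * K j).
Proof.
by move=> [_ _ /(_ 0%N)]; rewrite /= addn0 mulr0 oppr0 expR0 mulr1.
Qed.

Let ig1 : ig (fun _ : X => 1 : R). Proof. exact/ig_bmeas/bmeas_cst. Qed.

(** By equivariance l_j 1 - 1 = l_j (1 - h_j) - (1 - h_(j+1)), and both terms decay by [decay1]. The
    density h is used only here and does not enter the weights. *)
Lemma adm_one j : adm j.+1 (fun x => l j (fun=> 1) x - 1) 2.
Proof.
have i1h k : ig (fun x => 1 - h k x) by exact: igB.
split; first by apply: igB => //; exact: l_ig.
  by rewrite RintB ?l_mean ?Rint_cst ?subrr//; exact: l_ig.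
move=> r; have D0 := decay1 j r.+1; have D1 := decay1 j.+1 r.
have := bvleB Hv D0 D1; rewrite lit_succ => D.
have iw : ig (fun x => l j (fun=> 1) x - 1) by apply: igB => //; exact: l_ig.
apply: (bvle_ae Hv (bvle_le _ D)) => //; last 2 first.
- exact: lit_ig.
- have E : \forall x \ae m, l j (fun x => 1 - h j x) x =
      (l j (fun=> 1) x - 1) + (1 - h j.+1 x).
    have e1 := l_add j ig1 (igZ (-1) (h_ig j)).
    have e2 := l_scale j (-1) (h_ig j).
    have e3 : \forall x \ae m, l j (fun x => 1 - h j x) x =
       l j (fun y => 1 + -1 * h j y) x.
      by apply: aeW => x; congr (l j _ x); apply/funext => y; rewrite mulN1r.
    apply: filterS2 (filterI e1 e2) (filterI e3 (h_eq j)) => x [e1x e2x] [e3x e4x].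
    by rewrite e3x e1x e2x e4x mulN1r; ring.
  have F := lit_ae j.+1 r (l_ig j (i1h j)) (igD iw (i1h j.+1)) E.
  have G := lit_add j.+1 r iw (i1h j.+1).
  by apply: filterS2 F G => x -> ->; rewrite addrK.
have h0 : K j * expR (- (lam * r.+1%:R)) <= K (j.+1 + r)%N * expR (- (lam' * r%:R)).
  apply: le_trans (Kexp j r.+1) _; rewrite addSnnS ler_pM2l// ler_expR lerN2.
  by rewrite ler_wpM2l ?ler_nat// subr_ge0 ltW.
have := Kexp j.+1 r; lra.
Qed.

(** Write I for the integral of f: l f - I = l (f - I) + I (l 1 - 1), and each part contributes at
    most 2 c. *)
Lemma adm_step j f c : bvle m v f c ->
  adm j.+1 (fun x => l j f x - \int[m]_y f y) (4 * c).
Proof.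
move=> fc; have iF : ig f by case: fc.
have c0 := bvle_ge0 Hv fc; have If := bvle_int Hv fc.
set I0 := \int[m]_y f y in If *.
have f'c : bvle m v (fun x => f x - I0) (2 * c).
  apply: bvle_le (bvleB Hv fc (bvle_cst Hv I0)); lra.
have f'0 : \int[m]_x (f x - I0) = 0.
  by rewrite RintB ?Rint_cst ?subrr//; exact/ig_bmeas/bmeas_cst.
have A1 := adm_l (adm_strong j f'c f'0).
have A2 := admZ I0 (adm_one j).
have A3 := admD A1 A2.
have if' : ig (fun x => f x - I0) by case: f'c.
apply: (adm_ae (adm_le _ A3)).
- have e1 : expR (- lam') <= 1 by rewrite expR_le1 oppr_le0 subr_ge0 ltW.
  have h1 : 2 * c * expR (- lam') <= 2 * c by rewrite ler_piMr// mulr_ge0.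
  by lra.
- by apply: igB; [exact: l_ig | exact/ig_bmeas/bmeas_cst].
have e1 := l_add j if' (igZ I0 ig1).
have e2 := l_scale j I0 ig1.
have e3 : \forall x \ae m, l j f x = l j (fun y => (f y - I0) + I0 * 1) x.
  by apply: aeW => x; congr (l j _ x); apply/funext => y; rewrite mulr1 subrK.
apply: filterS2 (filterI e1 e2) e3 => x [e1x e2x] e3x.
by rewrite e3x e1x e2x; ring.
Qed.

(** Of the factors 1 / K only one is kept: it will cancel the K in [adm]. *)
Lemma phi_fact_bv j q :
  bvle m v (fun x => phi j x ^+ q.+1 / q.+1`!%:R) ((2 * Cv) ^+ q * B0 ^+ q.+1 / K j).
Proof.
have H : bvle m v (fun x => phi j x ^+ q.+1) ((2 * Cv) ^+ q * B0 ^+ q.+1 / K j).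
  elim: q => [|q IH].
    by rewrite expr0 mul1r expr1; under [X in bvle _ _ X]eq_fun do rewrite expr1.
  under [X in bvle _ _ X]eq_fun do rewrite exprS.
  apply: bvle_le (bvleM Hv (phi_b j) (phi_bv j) IH).
  rewrite [leLHS](_ : _ = (2 * Cv) ^+ q.+1 * B0 ^+ q.+2 / K j * (K j)^-1); last first.
    by rewrite !exprS; ring.
  rewrite ler_piMr//; last by rewrite invf_le1.
  by rewrite mulr_ge0 ?invr_ge0 ?(ltW (K0 j))// mulr_ge0 ?exprn_ge0 ?mulr_ge0.
have H2 := bvleZ Hv (q.+1`!%:R)^-1 H.
under [X in bvle _ _ X]eq_fun do rewrite mulrC.
apply: bvle_le H2; apply: ler_piMl; first exact: (bvle_ge0 Hv H).
by rewrite ger0_norm ?invr_ge0// invf_le1 ?ler1n ?ltr0n fact_gt0.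
Qed.

Let twist_tail (j : nat) (f : nat -> X -> R) (p : nat) (x : X) : R :=
  \sum_(q < p) phi j x ^+ q.+1 / q.+1`!%:R * f (p - q.+1)%N x.

Let twistE j f p x : twist j f p x = f p x + twist_tail j f p x.
Proof. by rewrite /twist big_ord_recl/= expr0 divr1 mul1r subn0. Qed.

Let y := B1 / B.
Let y_bnd : 0 <= y <= 2^-1.
Proof.
rewrite divr_ge0 ?(ltW Bpos)//= ler_pdivrMr//; move: B1B; lra.
Qed.

(** Every term contains at least one factor phi, whose 1 / K cancels the K of [adm]; the result is
    bounded in the plain BV norm, as [adm_step] demands. *)
Let twist_tail_bv j f p c : (forall q, adm j (f q) (c * B ^+ q)) ->
  bvle m v (twist_tail j f p) (c * B ^+ p * (2 * y)).
Proof.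
move=> fA.
have c0 : 0 <= c.
  have := bvle_ge0 Hv (adm_bv (fA 0%N)); rewrite expr0 mulr1.
  by rewrite pmulr_lge0.
apply: (@bvle_le _ _ _ _ _ _ (\sum_(q < p) c * B ^+ p * y ^+ q.+1)).
  rewrite -mulr_sumr ler_wpM2l//; first by rewrite mulr_ge0// exprn_ge0// ltW.
  exact: sum_geom_half.
apply: (bvle_sum Hv) => q _.
apply: bvle_le (bvleM Hv (phi_fact_b _ _) (phi_fact_bv j q) (adm_bv (fA _))).
rewrite le_eqVlt; apply/orP; left; apply/eqP.
have -> : B ^+ p = B ^+ (p - q.+1) * B ^+ q.+1 by rewrite -exprD subnK.
rewrite /y expr_div_n /B1 !exprMn !exprS.
have Bq : B ^+ q != 0 by rewrite expf_neq0// gt_eqF.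
by field; rewrite Bq !gt_eqF//.
Qed.

Let nu0_bv c p : bvle m v (twist c (nu c 0) p) (B1 ^+ p).
Proof.
have -> : twist c (nu c 0) p = (fun x => phi c x ^+ p / p`!%:R).
  apply/funext => x; rewrite /twist big_ord_recr/= subnn mulr1 big1 ?add0r// => q _.
  by rewrite subn_eq0 leqNgt ltn_ord/= mulr0.
case: p => [|p].
  under [X in bvle _ _ X]eq_fun do rewrite expr0 divr1.
  by have := bvle_cst Hv (1 : R); rewrite normr1 expr0.
apply: bvle_le (phi_fact_bv c p).
rewrite /B1 [leRHS]exprMn ler_pdivrMr// -[leLHS]mulr1; apply: ler_pM => //.
  by rewrite mulr_ge0 ?exprn_ge0// mulr_ge0.
apply: ler_wpM2r; first exact: exprn_ge0.
rewrite exprS ler_peMl ?exprn_ge0 ?mulr_ge0//; move: Cv1; lra.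
Qed.

(** In one step the part without phi contracts by exp (- lam'), while the recentred tail contributes
    4 times 2 y; by [rho_ge] the sum is at most rho. *)
Lemma nu_adm c n p : adm (c + n).+1 (nu c n.+1 p) (4 * rho ^+ n * B ^+ p).
Proof.
elim: n p => [|n IH] p.
  rewrite addn0 expr0 mulr1; have := adm_step c (nu0_bv c p).
  rewrite /= !addn0; apply: adm_le; rewrite ler_pM2l//.
  by apply: lerXn2r; rewrite ?nnegrE ?(ltW Bpos)//; move: B1B B10; lra.
have c0 : 0 <= 4 * rho ^+ n * B ^+ p.
  have := bvle_ge0 Hv (adm_bv (IH p)); rewrite pmulr_lge0//.
have tb := twist_tail_bv p IH.
have A1 := adm_l (IH p).
have A2 := adm_step (c + n).+1 tb.
have A3 := admD A1 A2.
rewrite addnS; apply: (adm_ae (adm_le _ A3)).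
- rewrite [leLHS](_ : _ = (4 * rho ^+ n * B ^+ p) * (expR (- lam') + 8 * y)); last by ring.
  rewrite [leRHS](_ : _ = (4 * rho ^+ n * B ^+ p) * rho); last by rewrite exprS; ring.
  by rewrite ler_wpM2l.
- exact: nu_ig.
set j := (c + n).+1; set f := nu c n.+1 in tb *.
have iF q : ig (f q) by exact: nu_ig.
have it : ig (twist_tail j f p) by case: tb.
have e1 := l_add j (iF p) it.
have E : twist j f p = (fun y => f p y + twist_tail j f p y).
  by apply/funext => z; exact: twistE.
apply: filterS e1 => x e1x.
change (nu c n.+2 p x) with (l (c + n.+1) (twist (c + n.+1) f p) x
  - \int[m]_y twist (c + n.+1) f p y).
rewrite addnS -/j E e1x RintD// nu_mean add0r; ring.
Qed.

Hypothesis rho1 : rho <= 1.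

Lemma weight_bound c n p : `|weight c n p| <= 4 / rho ^+ 2 * B ^+ p * rho ^+ n.+1.
Proof.
have /andP[y0 y2] := y_bnd.
have rho0 : 0 < rho.
  by apply: lt_le_trans rho_ge; rewrite ltr_pwDl ?expR_gt0// mulr_ge0.
have Bp : 0 <= B ^+ p by rewrite exprn_ge0// ltW.
rewrite /weight; case: n => [|n].
  have -> : 4 / rho ^+ 2 * B ^+ p * rho ^+ 1 = 4 / rho * B ^+ p.
    by field; rewrite gt_eqF.
  rewrite addn0; apply: le_trans (bvle_int Hv (nu0_bv c p)) _.
  have h1 : B1 ^+ p <= B ^+ p.
    by apply: lerXn2r; rewrite ?nnegrE ?(ltW Bpos)//; move: B1B B10; lra.
  apply: le_trans h1 _; rewrite ler_peMl// ler_pdivlMr//; move: rho1; lra.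
(* The recentred density has mean zero, so only the tail contributes to the integral. The interval
   of this weight has length n + 2 against rho^n in [nu_adm], whence the factor [rho ^- 2]. *)
set f := nu c n.+1.
have A q : adm (c + n.+1) (f q) (4 * rho ^+ n * B ^+ q) by rewrite addnS; exact: nu_adm.
have tb := twist_tail_bv p A.
have E : twist (c + n.+1) f p = (fun y => f p y + twist_tail (c + n.+1) f p y).
  by apply/funext => z; exact: twistE.
rewrite E RintD; [|exact: nu_ig|by case: tb].
rewrite nu_mean add0r; apply: le_trans (bvle_int Hv tb) _.
have -> : 4 / rho ^+ 2 * B ^+ p * rho ^+ n.+2 = 4 * rho ^+ n * B ^+ p.
  by rewrite !exprS; field; rewrite gt_eqF.
rewrite ler_piMr//; last by move: y2; lra.
by rewrite !mulr_ge0// exprn_ge0// ltW.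
Qed.

Lemma weight0 c n : weight c n 0 = (n == 0)%:R.
Proof.
rewrite /weight; case: n => [|n]; rewrite /twist.
  under eq_Rintegral do rewrite big_ord1 expr0 divr1 mul1r.
  by rewrite Rint_cst.
under eq_Rintegral do rewrite big_ord1 expr0 divr1 mul1r.
exact: nu_mean.
Qed.

End Decay.

End TransferChain.

(** * Cumulants and moments *)

Section ComplexDerivative.
Variable R : realType.
Implicit Types (f g : R -> R[i]) (t : R) (x y l : R[i]).

Lemma Re_mul x y : complex.Re (x * y) =
  complex.Re x * complex.Re y - complex.Im x * complex.Im y.
Proof. by case: x y => [? ?] [? ?]. Qed.

Lemma Im_mul x y : complex.Im (x * y) =
  complex.Re x * complex.Im y + complex.Im x * complex.Re y.
Proof. by case: x y => [? ?] [? ?]. Qed.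

Lemma complex_ext x y :
  complex.Re x = complex.Re y -> complex.Im x = complex.Im y -> x = y.
Proof. by case: x y => [? ?] [? ?] /= -> ->. Qed.

Definition cder f l t : Prop :=
  is_derive t (1 : R) (fun u => complex.Re (f u)) (complex.Re l) /\
  is_derive t (1 : R) (fun u => complex.Im (f u)) (complex.Im l).

Lemma cder_cst x t : cder (fun=> x) 0 t.
Proof. by split; exact: is_derive_cst. Qed.

Lemma cderD f g l l' t : cder f l t -> cder g l' t -> cder (fun u => f u + g u) (l + l') t.
Proof.
move=> [f1 f2] [g1 g2]; split.
- rewrite (_ : (fun u => _) = (fun u => complex.Re (f u)) + (fun u => complex.Re (g u))).
    by apply: is_derive_eq; case: l l' {f1 f2 g1 g2} => [? ?] [? ?].
  by apply/funext => u; rewrite !fctE; case: (f u) (g u) => [? ?] [? ?].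
- rewrite (_ : (fun u => _) = (fun u => complex.Im (f u)) + (fun u => complex.Im (g u))).
    by apply: is_derive_eq; case: l l' {f1 f2 g1 g2} => [? ?] [? ?].
  by apply/funext => u; rewrite !fctE; case: (f u) (g u) => [? ?] [? ?].
Qed.

Lemma cderM f g l l' t : cder f l t -> cder g l' t ->
  cder (fun u => f u * g u) (l * g t + f t * l') t.
Proof.
move=> [f1 f2] [g1 g2]; split.
- rewrite (_ : (fun u => _) = (fun u => complex.Re (f u)) * (fun u => complex.Re (g u)) -
     (fun u => complex.Im (f u)) * (fun u => complex.Im (g u))).
    apply: is_derive_eq; rewrite /= /GRing.scale/=.
    case: (f t) (g t) l l' {f1 f2 g1 g2} => [? ?] [? ?] [? ?] [? ?]/=; ring.
  by apply/funext => u; rewrite !fctE Re_mul.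
- rewrite (_ : (fun u => _) = (fun u => complex.Re (f u)) * (fun u => complex.Im (g u)) +
     (fun u => complex.Im (f u)) * (fun u => complex.Re (g u))).
    apply: is_derive_eq; rewrite /= /GRing.scale/=.
    case: (f t) (g t) l l' {f1 f2 g1 g2} => [? ?] [? ?] [? ?] [? ?]/=; ring.
  by apply/funext => u; rewrite !fctE Im_mul.
Qed.

Lemma normsq_derive f l t : cder f l t ->
  is_derive t (1 : R) (fun u => complex.Re (f u) ^+ 2 + complex.Im (f u) ^+ 2)
    (2 * complex.Re (f t) * complex.Re l + 2 * complex.Im (f t) * complex.Im l).
Proof.
move=> [f1 f2]; rewrite (_ : (fun u => _) =
  (fun u => complex.Re (f u)) ^+ 2 + (fun u => complex.Im (f u)) ^+ 2).
  by apply: is_derive_eq; rewrite /= /GRing.scale/= !expr1; ring.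
by apply/funext => u; rewrite !fctE.
Qed.

Lemma cderV f l t : f t != 0 -> cder f l t ->
  cder (fun u => (f u)^-1) (- l / f t ^+ 2) t.
Proof.
move=> ft0 fl; have [f1 f2] := fl.
pose N u := complex.Re (f u) ^+ 2 + complex.Im (f u) ^+ 2.
have N0 : N t != 0.
  apply: contra_neq ft0; rewrite /N => /eqP.
  rewrite paddr_eq0 ?sqr_ge0// !sqrf_eq0 => /andP[/eqP a0 /eqP b0].
  exact: complex_ext.
have dN := normsq_derive fl; rewrite -/N in dN.
have dNV := is_deriveV N0 dN.
have N0' : complex.Re (f t) * complex.Re (f t) + complex.Im (f t) * complex.Im (f t) != 0.
  by move: N0; rewrite /N !expr2.
split.
- rewrite (_ : (fun u => _) = (fun u => complex.Re (f u)) * (fun u => (N u)^-1)).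
    apply: is_derive_eq; rewrite /= /GRing.scale/= /N.
    case: (f t) l N0' {fl f1 f2 dN dNV N0 ft0} => [a b] [c e]/= N0'.
    have E : (a * a - b * b) ^+ 2 + (a * b + b * a) ^+ 2 = (a ^+ 2 + b ^+ 2) ^+ 2.
      by ring.
    by rewrite E; field; rewrite !expr2.
  by apply/funext => u; rewrite !fctE /N; case: (f u) => a b; rewrite /GRing.inv.
- rewrite (_ : (fun u => _) = - ((fun u => complex.Im (f u)) * (fun u => (N u)^-1))).
    apply: is_derive_eq; rewrite /= /GRing.scale/= /N.
    case: (f t) l N0' {fl f1 f2 dN dNV N0 ft0} => [a b] [c e]/= N0'.
    have E : (a * a - b * b) ^+ 2 + (a * b + b * a) ^+ 2 = (a ^+ 2 + b ^+ 2) ^+ 2.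
      by ring.
    by rewrite E; field; rewrite !expr2.
  by apply/funext => u; rewrite !fctE /N; case: (f u) => a b; rewrite /GRing.inv.
Qed.

Lemma cder_unique f g l l' t : (\forall u \near t, f u = g u) ->
  cder f l t -> cder g l' t -> l = l'.
Proof.
move=> fg [f1 f2] [g1 g2]; apply: complex_ext.
- rewrite -(@derive_val _ _ _ _ _ _ _ f1) -(@derive_val _ _ _ _ _ _ _ g1).
  apply: near_eq_derive.
  by apply: filterS fg => u ->.
- rewrite -(@derive_val _ _ _ _ _ _ _ f2) -(@derive_val _ _ _ _ _ _ _ g2).
  apply: near_eq_derive.
  by apply: filterS fg => u ->.
Qed.

Lemma cder_eq f l l' t : l = l' -> cder f l t -> cder f l' t.
Proof. by move=> ->. Qed.

Lemma cder_sum n (F : 'I_n -> R -> R[i]) (G : 'I_n -> R[i]) t :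
  (forall i, cder (F i) (G i) t) -> cder (fun u => \sum_i F i u) (\sum_i G i) t.
Proof.
elim: n F G => [|n IH] F G FG.
  by under [X in cder X]eq_fun do rewrite big_ord0; rewrite big_ord0; exact: cder_cst.
under [X in cder X]eq_fun do rewrite big_ord_recl; rewrite big_ord_recl.
by apply: cderD => //; exact: IH.
Qed.

(** In the open right half-plane the argument is atan (y / x), so only one branch of [carg] has to
    be differentiated. *)
Lemma carg_cder f l t : 0 < complex.Re (f t) -> cder f l t ->
  (\forall u \near t, 0 < complex.Re (f u)) ->
  cder (fun u => cln (f u)) (l / f t) t.
Proof.
move=> ft fl fpos; have [f1 f2] := fl.
pose N u := complex.Re (f u) ^+ 2 + complex.Im (f u) ^+ 2.
have N0 : 0 < N t by rewrite /N ltr_pwDl ?exprn_gt0// sqr_ge0.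
have dN := normsq_derive fl; rewrite -/N in dN.
have N0' : complex.Re (f t) * complex.Re (f t) + complex.Im (f t) * complex.Im (f t) != 0.
  by move: N0; rewrite /N !expr2 => /lt0r_neq0.
have ft0 := lt0r_neq0 ft.
split.
- apply: (@near_eq_is_derive _ _ _ (fun u => 2^-1 * ln (N u))).
  + apply: filterS fpos => u u0; rewrite /cln/=.
    have -> : normc (f u) = Num.sqrt (N u) by rewrite /N; case: (f u).
    have Nu : 0 < N u by rewrite /N ltr_pwDl ?exprn_gt0// sqr_ge0.
    have -> : ln (N u) = 2 * ln (Num.sqrt (N u)).
      by rewrite -{1}(sqr_sqrtr (ltW Nu)) lnXn ?sqrtr_gt0// mulr_natl.
    by rewrite mulrA mulVf ?mul1r.
  + have dln := is_derive1_ln N0.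
    have dc := @is_derive1_comp R (@ln R) N t _ _ dln dN.
    rewrite (_ : (fun u => _) = 2^-1 *: (@ln R \o N)).
      apply: is_derive_eq; rewrite /= /GRing.scale/= /N.
      case: (f t) l N0' {fl f1 f2 dN N0 dln dc ft ft0} => [a b] [c e]/= N0'.
      by field; rewrite !expr2.
    by apply/funext => u; rewrite !fctE.
- apply: (@near_eq_is_derive _ _ _ (fun u => atan (complex.Im (f u) / complex.Re (f u)))).
  + by apply: filterS fpos => u u0; rewrite /cln/= /carg; case: (f u) u0 => a b /= ->.
  + have dV := is_deriveV ft0 f1.
    have dq : is_derive t (1 : R) (fun u => complex.Im (f u) / complex.Re (f u))
       (complex.Im (f t) * (- complex.Re (f t) ^- 2 * complex.Re l) +
        (complex.Re (f t))^-1 * complex.Im l).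
      rewrite (_ : (fun u => _) = (fun u => complex.Im (f u)) * (fun u => (complex.Re (f u))^-1)).
        by apply: is_derive_eq; rewrite /= /GRing.scale/=.
      by apply/funext => u; rewrite !fctE.
    have da := is_derive1_atan (complex.Im (f t) / complex.Re (f t)).
    have dc := @is_derive1_comp R (@atan R) _ t _ _ da dq.
    apply: is_derive_eq; rewrite /=.
    case: (f t) l ft0 N0' {fl f1 f2 dN N0 dV dq da dc ft} => [a b] [c e]/= ft0 N0'.
    have N1 : a ^+ 2 + b ^+ 2 != 0 by rewrite !expr2.
    by field; rewrite ft0 N1.
Qed.

End ComplexDerivative.

Definition moment_series (R : realType) (d : measure_display)
    (T : measurableType d) (mu : probability T R) (W : T -> R) : fps R :=
  fun j => (\int[mu]_p W p ^+ j) / j`!%:R.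

(** * Cumulants as coefficients of a logarithmic derivative *)

Section Cumulants.
Variables (R : realType) (d : measure_display) (T : measurableType d).
Variables (mu : probability T R) (W : T -> R).
Hypothesis bW : bmeas W.
Notation ii := (Complex 0 1 : R[i]).

Let cosW j t := \int[mu]_p (W p ^+ j * cos (t * W p)).
Let sinW j t := \int[mu]_p (W p ^+ j * sin (t * W p)).

Let cos_b t : bmeas (fun p => cos (t * W p)).
Proof.
split.
  apply: measurableT_comp; last by case: (bmeasZ t bW).
  by apply: continuous_measurable_fun; exact: continuous_cos.
by exists 1 => p; rewrite ler_norml cos_geN1 cos_le1.
Qed.

Let sin_b t : bmeas (fun p => sin (t * W p)).
Proof.
split.
  apply: measurableT_comp; last by case: (bmeasZ t bW).
  by apply: continuous_measurable_fun; exact: continuous_sin.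
by exists 1 => p; rewrite ler_norml sin_geN1 sin_le1.
Qed.

Let der_cos j t p : is_derive t (1 : R) (fun u => W p ^+ j * cos (u * W p))
  (- (W p ^+ j.+1 * sin (t * W p))).
Proof.
have d1 : is_derive t (1 : R) (fun u => u * W p) (W p).
  rewrite (_ : (fun u => _) = W p *: id).
    by apply: is_derive_eq; rewrite /GRing.scale/= mulr1.
  by apply/funext => u; rewrite !fctE /GRing.scale/= mulrC.
have d2 := @is_derive1_comp R (@cos R) _ t _ _ (is_derive_cos (t * W p)) d1.
rewrite (_ : (fun u => _) = (W p ^+ j) *: (cos \o (fun u => u * W p))).
  by apply: is_derive_eq; rewrite /GRing.scale/= exprS; ring.
by apply/funext => u; rewrite !fctE.
Qed.

Let der_sin j t p : is_derive t (1 : R) (fun u => W p ^+ j * sin (u * W p))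
  (W p ^+ j.+1 * cos (t * W p)).
Proof.
have d1 : is_derive t (1 : R) (fun u => u * W p) (W p).
  rewrite (_ : (fun u => _) = W p *: id).
    by apply: is_derive_eq; rewrite /GRing.scale/= mulr1.
  by apply/funext => u; rewrite !fctE /GRing.scale/= mulrC.
have d2 := @is_derive1_comp R (@sin R) _ t _ _ (is_derive_sin (t * W p)) d1.
rewrite (_ : (fun u => _) = (W p ^+ j) *: (sin \o (fun u => u * W p))).
  by apply: is_derive_eq; rewrite /GRing.scale/= exprS; ring.
by apply/funext => u; rewrite !fctE.
Qed.

Let under_int (f g : R -> T -> R) (M : R) t :
  (forall u, bmeas (f u)) -> (forall u p, is_derive u (1 : R) (f ^~ p) (g u p)) ->
  (forall u p, `|g u p| <= M) ->
  is_derive t (1 : R) (fun u => \int[mu]_p f u p) (\int[mu]_p g t p).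
Proof.
move=> bf fg gM.
have It : `]t - 1, t + 1[%classic t by rewrite /= in_itv/=; apply/andP; split; lra.
have i1 : forall x, `]t - 1, t + 1[%classic x -> mu.-integrable setT (EFin \o f x).
  by move=> x _; exact: ig_bmeas.
have i2 : forall x y, `]t - 1, t + 1[%classic x -> setT y -> derivable (f ^~ y) x 1.
  by move=> x y _ _; case: (fg x y).
have gE x y : partial1of2 f x y = g x y.
  by rewrite partial1of2E; exact: (@derive_val _ _ _ _ _ _ _ (fg x y)).
have M0 : forall y : T, 0 <= M by move=> y; exact: le_trans (normr_ge0 _) (gM t y).
have i3 : mu.-integrable setT (EFin \o (fun _ : T => M)) by exact/ig_bmeas/bmeas_cst.
have i4 : forall x y, `]t - 1, t + 1[%classic x -> setT y -> `|partial1of2 f x y| <= M.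
  by move=> x y _ _; rewrite gE.
have D := derivable_under_integral measurableT It i1 i2 M0 i3 i4.
have V := differentiation_under_integral measurableT It i1 i2 M0 i3 i4.
apply: DeriveDef => //.
rewrite -derive1E V; apply: eq_Rintegral => p _; exact: gE.
Qed.

Let cosW_der j t : is_derive t (1 : R) (cosW j) (- sinW j.+1 t).
Proof.
have [mW [M WM]] := bW.
have E : - sinW j.+1 t = \int[mu]_p (- (W p ^+ j.+1 * sin (t * W p))).
  rewrite /sinW -mulN1r -RintZ; last exact/ig_bmeas/bmeasM/sin_b/bmeasX.
  by apply: eq_Rintegral => p _; rewrite mulN1r.
rewrite E; apply: (@under_int (fun u p => W p ^+ j * cos (u * W p))
  (fun u p => - (W p ^+ j.+1 * sin (u * W p))) (M ^+ j.+1)).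
- by move=> u; apply: bmeasM; [exact: bmeasX | exact: cos_b].
- by move=> u p; exact: der_cos.
- move=> u p; rewrite normrN normrM normrX -[leRHS]mulr1; apply: ler_pM => //.
    by apply: lerXn2r; rewrite ?nnegrE ?(le_trans _ (WM p)).
  by rewrite ler_norml sin_geN1 sin_le1.
Qed.

Let sinW_der j t : is_derive t (1 : R) (sinW j) (cosW j.+1 t).
Proof.
have [mW [M WM]] := bW.
apply: (@under_int (fun u p => W p ^+ j * sin (u * W p))
  (fun u p => W p ^+ j.+1 * cos (u * W p)) (M ^+ j.+1)).
- by move=> u; apply: bmeasM; [exact: bmeasX | exact: sin_b].
- by move=> u p; exact: der_sin.
- move=> u p; rewrite normrM normrX -[leRHS]mulr1; apply: ler_pM => //.
    by apply: lerXn2r; rewrite ?nnegrE ?(le_trans _ (WM p)).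
  by rewrite ler_norml cos_geN1 cos_le1.
Qed.

(** The j-th derivative of the characteristic function. *)
Let chi j t : R[i] := ii ^+ j * Complex (cosW j t) (sinW j t).

Let chi_der j t : cder (chi j) (chi j.+1 t) t.
Proof.
have H : cder (fun t => Complex (cosW j t) (sinW j t))
    (Complex (- sinW j.+1 t) (cosW j.+1 t)) t.
  by split; [exact: cosW_der | exact: sinW_der].
apply: cder_eq (cderM (cder_cst (ii ^+ j) t) H).
rewrite mul0r add0r /chi exprSr -mulrA; congr (_ * _).
by apply: complex_ext; rewrite /=; ring.
Qed.

(** An open set containing 0 on which the characteristic function has a smooth principal
    logarithm. *)
Let U t := 0 < complex.Re (chi 0 t).

Let U0 : U 0.
Proof.
rewrite /U /chi expr0 mul1r /= /cosW.
by under eq_Rintegral do rewrite expr0 mul1r mul0r cos0; rewrite Rint_cst.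
Qed.

Let chi0_neq0 t : U t -> chi 0 t != 0.
Proof. by move=> Ut; apply: contraTneq Ut => ct; rewrite /U ct ltxx. Qed.

Let U_open t : U t -> \forall u \near t, U u.
Proof.
move=> Ut; have [[dRe _] _] := chi_der 0 t.
have /differentiable_continuous c := (derivable1_diffP _ _).1 dRe.
exact: (@cvgr_gt _ _ _ _ (fun u => complex.Re (chi 0 u)) _ c _ Ut).
Qed.

(* The functions obtained from the derivatives of the characteristic function
   and its inverse by ring operations; they are stable under derivation. *)
Inductive chi_alg : (R -> R[i]) -> Prop :=
| chi_alg_chi j : chi_alg (chi j)
| chi_alg_inv : chi_alg (fun t => (chi 0 t)^-1)
| chi_alg_cst x : chi_alg (fun=> x)
| chi_alg_add f g : chi_alg f -> chi_alg g -> chi_alg (fun t => f t + g t)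
| chi_alg_mul f g : chi_alg f -> chi_alg g -> chi_alg (fun t => f t * g t).

Let chi_alg_der f : chi_alg f ->
  exists2 g, chi_alg g & forall t, U t -> cder f (g t) t.
Proof.
elim=> {f} [j||x|f g _ [f' sf' f'E] _ [g' sg' g'E]|f g sf [f' sf' f'E] sg [g' sg' g'E]].
- by exists (chi j.+1) => [|t _]; [exact: chi_alg_chi | exact: chi_der].
- exists (fun t => (-1 * chi 1 t) * ((chi 0 t)^-1 * (chi 0 t)^-1)).
    apply: chi_alg_mul; first by apply: chi_alg_mul; [exact: chi_alg_cst|exact: chi_alg_chi].
    by apply: chi_alg_mul; exact: chi_alg_inv.
  move=> t Ut; apply: cder_eq (cderV (chi0_neq0 Ut) (chi_der 0 t)).
  by rewrite mulN1r expr2 invfM.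
- by exists (fun=> 0) => [|t _]; [exact: chi_alg_cst | exact: cder_cst].
- exists (fun t => f' t + g' t) => [|t Ut]; first exact: chi_alg_add.
  by apply: cderD; [exact: f'E | exact: g'E].
- exists (fun t => f' t * g t + f t * g' t) => [|t Ut].
    by apply: chi_alg_add; exact: chi_alg_mul.
  by apply: cderM; [exact: f'E | exact: g'E].
Qed.

(** [A n] is the n-th derivative of chi' / chi on U, obtained by iterating a choice of derivatives
    inside [chi_alg]. *)
Let jets : exists A : nat -> R -> R[i], (forall t, A 0%N t = chi 1 t * (chi 0 t)^-1) /\
  forall n t, U t -> cder (A n) (A n.+1 t) t.
Proof.
have step : forall f : {f | chi_alg f}, exists g : {f | chi_alg f},
    forall t, U t -> cder (sval f) (sval g t) t.
  by move=> [f sf]; have [g sg gE] := chi_alg_der sf; exists (exist _ g sg).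
have [nxt nxtE] := boolp.choice step.
have s0 : chi_alg (fun t => chi 1 t * (chi 0 t)^-1).
  by apply: chi_alg_mul; [exact: chi_alg_chi | exact: chi_alg_inv].
exists (fun n => sval (iter n nxt (exist _ _ s0))); split=> // n t Ut.
exact: nxtE.
Qed.

Let mom := moment_series mu W.

Let chi_at0 j : chi j 0 = ii ^+ j * Complex (j`!%:R * mom j) 0.
Proof.
rewrite /chi /mom /moment_series; congr (_ * Complex _ _).
  rewrite mulrCA mulfV ?mulr1 ?pnatr_eq0 -?lt0n ?fact_gt0//.
  by apply: eq_Rintegral => p _; rewrite mul0r cos0 mulr1.
rewrite /sinW -[RHS](Rint_cst mu).
by apply: eq_Rintegral => p _; rewrite mul0r sin0 mulr0.
Qed.

(** The n-th derivative of the identity (chi' / chi) chi = chi'. It must hold on all of U, because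
    the next derivative compares both sides near t. *)
Let leibniz (A : nat -> R -> R[i]) : (forall t, A 0%N t = chi 1 t * (chi 0 t)^-1) ->
  (forall n t, U t -> cder (A n) (A n.+1 t) t) -> forall n t, U t ->
  \sum_(i < n.+1) 'C(n, i)%:R * (A i t * chi (n - i) t) = chi n.+1 t.
Proof.
move=> A0 Ader; elim=> [|n IH] t Ut.
  by rewrite big_ord1 bin0 mul1r A0 mulfVK// chi0_neq0.
have D : cder (fun u => \sum_(i < n.+1) 'C(n, i)%:R * (A i u * chi (n - i) u))
    (\sum_(i < n.+1) 'C(n, i)%:R * (A i.+1 t * chi (n - i) t + A i t * chi (n - i).+1 t)) t.
  apply: cder_sum => i.
  apply: cder_eq (cderM (cder_cst _ t) (cderM (Ader i t Ut) (chi_der (n - i) t))).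
  by rewrite mul0r add0r.
rewrite -(cder_unique _ D (chi_der n.+1 t)); last first.
  by apply: filterS (U_open Ut) => u Uu; exact: IH.
rewrite big_ord_recl bin0 mul1r subn0.
under eq_bigr => i _ do rewrite lift0 binS natrD mulrDl subSS.
rewrite big_split/= [in LHS]addrA.
under [in RHS]eq_bigr => i _ do rewrite mulrDr.
rewrite [RHS]big_split/= addrC; congr (_ + _).
rewrite big_ord_recr/= bin_small// mul0r addr0 [RHS]big_ord_recl/= bin0 mul1r subn0.
congr (_ + _); apply: eq_bigr => i _; rewrite /bump/= add1n.
by rewrite subnSK// ltn_ord.
Qed.

(** At 0 the Leibniz identities for chi' / chi and the coefficient identities for D mom = lamb mom
    are the same triangular recursion, up to powers of i; it has one solution since mom has constant
    term 1. *)
Lemma cumulantE (momi : fps R) k : moment_series mu W * momi = 1 ->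
  cumulant mu W k.+1 = Complex (k`!%:R * (fpsD (moment_series mu W) * momi) k.+1) 0.
Proof.
rewrite -/mom => momiE; have [A [A0 Ader]] := jets.
set lamb := fpsD mom * momi.
have m0 : mom 0%N = 1.
  by rewrite /mom /moment_series divr1; under eq_Rintegral do rewrite expr0; rewrite Rint_cst.
have lambE : fpsD mom = lamb * mom.
  by rewrite /lamb -mulrA [momi * _]mulrC momiE mulr1.
have lamb0 : lamb 0%N = 0.
  by rewrite /lamb fpsME big_ord1 /fpsD mul0r mul0r.
(* Coefficient n + 1 of D mom = lamb mom, multiplied by n!. *)
have rec n : n.+1`!%:R * mom n.+1 =
    \sum_(i < n.+1) 'C(n, i)%:R * ((i`!%:R * lamb i.+1) * ((n - i)`!%:R * mom (n - i)%N)).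
  have := congr1 (fun f : fps R => f n.+1) lambE.
  rewrite fpsME big_ord_recl/= lamb0 mul0r add0r /fpsD => E.
  rewrite factS natrM mulrAC E mulr_suml; apply: eq_bigr => i _.
  rewrite /bump/= add1n subSS -(@bin_fact n i); last by rewrite -ltnS.
  by rewrite !natrM; ring.
have AE n : A n 0 = ii ^+ n.+1 * Complex (n`!%:R * lamb n.+1) 0.
  elim/ltn_ind: n => n IH.
  have := leibniz A0 Ader n U0.
  rewrite big_ord_recr/= binn mul1r subnn chi_at0 m0 expr0 mul1r mulr1.
  rewrite -[Complex 1 0]/(1 : R[i]) mulr1 => E.
  have -> : A n 0 = chi n.+1 0 -
     \sum_(i < n) 'C(n, i)%:R * (A i 0 * chi (n - i) 0) by rewrite -E addrAC subrr add0r.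
  rewrite chi_at0 rec big_ord_recr/= binn mul1r subnn m0 !mulr1.
  set S := \sum_(i < n) _ in E *; set S' := \sum_(i < n) _.
  have -> : S = ii ^+ n.+1 * Complex S' 0.
    have -> : Complex S' 0 = \sum_(i < n) ('C(n, i)%:R : R[i]) * ((Complex (i`!%:R * lamb i.+1) 0)
        * Complex ((n - i)`!%:R * mom (n - i)%N) 0).
      rewrite /S' -/(real_complex R _) rmorph_sum; apply: eq_bigr => i _.
      by rewrite rmorphM rmorph_nat rmorphM.
    rewrite mulr_sumr; apply: eq_bigr => i _; rewrite IH// chi_at0.
    have -> : ii ^+ n.+1 = ii ^+ i.+1 * ii ^+ (n - i).
      by rewrite -exprD addSn subnKC// ltnW.
    by ring.
  have -> : Complex (S' + n`!%:R * lamb n.+1) 0 = Complex S' 0 + Complex (n`!%:R * lamb n.+1) 0.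
    by apply: complex_ext; rewrite /= ?addr0.
  by rewrite mulrDr addrC addKr.
have clnE t : U t -> cder (fun t => cln (chi 0 t)) (A 0%N t) t.
  by move=> Ut; rewrite A0; apply: carg_cder; [exact: Ut|exact: chi_der|exact: U_open].
have charE : char_fun mu W = chi 0.
  apply/funext => t; rewrite /char_fun /chi expr0 mul1r.
  by congr Complex; apply: eq_Rintegral => p _; rewrite expr0 mul1r.
have dRe n t : U t ->
    derive1n n.+1 (fun t => complex.Re (cln (char_fun mu W t))) t = complex.Re (A n t).
  elim: n t => [|n IH] t Ut; rewrite derive1nS derive1E.
    rewrite derive1n0 charE; have [h _] := clnE t Ut; exact: derive_val.
  rewrite (@near_eq_derive _ _ _ _ (fun u => complex.Re (A n u))).
    by have [h _] := Ader n t Ut; exact: derive_val.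
  by apply: filterS (U_open Ut) => u; exact: IH.
have dIm n t : U t ->
    derive1n n.+1 (fun t => complex.Im (cln (char_fun mu W t))) t = complex.Im (A n t).
  elim: n t => [|n IH] t Ut; rewrite derive1nS derive1E.
    rewrite derive1n0 charE; have [_ h] := clnE t Ut; exact: derive_val.
  rewrite (@near_eq_derive _ _ _ _ (fun u => complex.Im (A n u))).
    by have [_ h] := Ader n t Ut; exact: derive_val.
  by apply: filterS (U_open Ut) => u; exact: IH.
rewrite /cumulant dRe// dIm//.
have -> : Complex (complex.Re (A k 0)) (complex.Im (A k 0)) = A k 0 by case: (A k 0).
rewrite AE mulKf// expf_neq0//.
by apply/eqP => /(congr1 (@complex.Im R))/eqP; rewrite /= oner_eq0.
Qed.

End Cumulants.

(** * Product measures and covariances *)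

Section ProductsAndDensities.
Variables (R : realType) (d d' : measure_display).
Variables (Om : measurableType d) (X : measurableType d').
Variables (P : probability Om R) (m : probability X R).

Lemma bmeas_section (f : Om * X -> R) w : bmeas f -> bmeas (fun x => f (w, x)).
Proof.
move=> [mf [M Mf]]; split; last by exists M => x; exact: Mf.
exact: (measurable_fun_pair2 w mf).
Qed.

Lemma bmeas_inner (f : Om * X -> R) : bmeas f -> bmeas (fun w => \int[m]_x f (w, x)).
Proof.
move=> bf; have [mf [M Mf]] := bf; split; last first.
  by exists M => w; apply: Rint_le => //; exact: bmeas_section.
have iF : (P \x m)%E.-integrable setT (EFin \o f) by exact: ig_bmeas.
by apply: measurableT_comp => //; exact: (measurable_fubini_F iF).
Qed.

Lemma Rfubini (f : Om * X -> R) : (P \x m)%E.-integrable setT (EFin \o f) ->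
  \int[(P \x m)%E]_z f z = \int[P]_w \int[m]_x f (w, x).
Proof.
move=> iF; congr fine; rewrite -(integral12_prod_meas1 iF).
have iFF := integrable_fubini_F iF.
have mF := measurable_fubini_F iF.
apply: ae_eq_integral => //.
  by apply/measurable_EFinP/measurableT_comp.
have := integrable_ae measurableT iFF.
by apply: filterS => w /(_ I) h _; rewrite /Rintegral fineK.
Qed.

End ProductsAndDensities.

(** H is almost everywhere the Radon-Nikodym derivative of mu, so the change of variables formula
    applies with H in its place. *)
Lemma density_integral (R : realType) (d : measure_display) (T : measurableType d)
    (Q mu : probability T R) (H : T -> R) :
  measurable_fun setT H -> (forall x, 0 <= H x) ->
  (forall A, measurable A -> mu A = (\int[Q]_(x in A) (H x)%:E)%E) ->
  Q.-integrable setT (EFin \o H) /\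
  forall f, bmeas f -> \int[mu]_x f x = \int[Q]_x (f x * H x).
Proof.
move=> mH H0 muE.
have iH : Q.-integrable setT (EFin \o H).
  apply/integrableP; split; first exact/measurable_EFinP.
  under eq_integral do rewrite gee0_abs ?lee_fin//.
  by rewrite -muE// probability_setT ltry.
split=> // f bf.
have dom : mu `<< Q.
  apply/null_content_dominatesP => A mA QA; rewrite muE//.
  by apply: null_set_integral => //; apply: measurable_funTS; exact/measurable_EFinP.
have RN := Radon_Nikodym_change_of_variables dom measurableT (ig_bmeas mu bf).
congr fine; rewrite -RN; apply: ae_eq_integral => //.
- apply: emeasurable_funM; first exact/measurable_EFinP/(proj1 bf).
  exact: measurable_int (Radon_Nikodym_integrable _).
- by apply/measurable_EFinP/measurable_funM => //; case: bf.
have E : ae_eq Q setT (Radon_Nikodym (charge_of_finite_measure mu) Q) (EFin \o H).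
  apply: integral_ae_eq => //.
  - exact: Radon_Nikodym_integrable.
  - exact/measurable_EFinP.
  - by move=> A _ mA; rewrite -Radon_Nikodym_integral//= muE.
by apply: filterS E => x /= + _ => -> //; rewrite EFinM.
Qed.

(** * From covariances of events to covariances of bounded functions *)

Section CovarianceFromEvents.
Variables (R : realType) (d : measure_display) (Om : measurableType d).
Variable P : probability Om R.
Notation E f := (\int[P]_w f w).

Lemma count_le_floor (x : R) n : 0 <= x <= n%:R ->
  x - 1 <= \sum_(j < n) (j.+1%:R <= x)%R%:R <= x.
Proof.
elim: n => [|n IH] /andP[x0 xn].
  have -> : x = 0 by apply/eqP; rewrite eq_le x0 xn.
  by rewrite big_ord0 lexx andbT sub0r oppr_le0.
rewrite big_ord_recr/=; have [h|h] := leP (n.+1%:R) x.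
  have -> : x = n.+1%:R by apply/eqP; rewrite eq_le h xn.
  rewrite (eq_bigr (fun=> 1)); last by move=> j _; rewrite ler_nat ltnW// ltnS.
  rewrite sumr_const card_ord natr1.
  by rewrite lexx andbT gerBl.
rewrite addr0; have [h'|h'] := leP x n%:R; first by apply: IH; rewrite x0.
rewrite (eq_bigr (fun=> 1)); last first.
  move=> j _; have -> // : (j.+1%:R <= x).
  by apply: le_trans (ltW h'); rewrite ler_nat.
rewrite sumr_const card_ord (ltW h') andbT.
by rewrite lerBlDr natr1 ltW.
Qed.

Let cov (f g : Om -> R) := E (fun w => f w * g w) - E f * E g.

Let covDl f f' g : bmeas f -> bmeas f' -> bmeas g ->
  cov (fun w => f w + f' w) g = cov f g + cov f' g.
Proof.
move=> bf bf' bg; rewrite /cov; under eq_Rintegral do rewrite mulrDl.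
rewrite RintD; [|exact: ig_bmeas|exact: ig_bmeas].
by rewrite RintD; [ring|apply/ig_bmeas/bmeasM|apply/ig_bmeas/bmeasM].
Qed.

Let covC f g : cov f g = cov g f.
Proof.
by rewrite /cov [E f * _]mulrC; congr (_ - _); apply: eq_Rintegral => w _; rewrite mulrC.
Qed.

Let covZl c f g : bmeas f -> bmeas g -> cov (fun w => c * f w) g = c * cov f g.
Proof.
move=> bf bg; rewrite /cov; under eq_Rintegral do rewrite -mulrA.
by rewrite RintZ ?RintZ; [ring|exact: ig_bmeas|exact/ig_bmeas/bmeasM].
Qed.

Let cov_cst c g : bmeas g -> cov (fun=> c) g = 0.
Proof.
by move=> bg; rewrite /cov RintZ ?Rint_cst ?subrr//; exact: ig_bmeas.
Qed.

Let cov_suml n (f : 'I_n -> Om -> R) g : (forall i, bmeas (f i)) -> bmeas g ->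
  cov (fun w => \sum_i f i w) g = \sum_i cov (f i) g.
Proof.
move=> bf bg; rewrite /cov; under eq_Rintegral do rewrite mulr_suml.
rewrite Rint_sum; last by move=> i _; exact: ig_bmeas.
rewrite Rint_sum; last by move=> i _; apply: ig_bmeas; exact: bmeasM.
by rewrite mulr_suml -sumrB.
Qed.

Let cov_small f g (a b : R) : bmeas f -> bmeas g ->
  (forall w, `|f w| <= a) -> (forall w, `|g w| <= b) -> `|cov f g| <= 2 * a * b.
Proof.
move=> bf bg fa gb.
have h1 : `|E (fun w => f w * g w)| <= a * b.
  apply: Rint_le; first exact: bmeasM.
  by move=> w; rewrite normrM ler_pM.
have h2 : `|E f * E g| <= a * b by rewrite normrM ler_pM// Rint_le.
by apply: le_trans (ler_normB _ _) _; lra.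
Qed.

Variable al : R.

Let level (f : Om -> R) (s : R) (w : Om) : R := (s <= f w)%R%:R.

Let level_b f s : bmeas f -> bmeas (level f s).
Proof.
move=> [mf _]; split; last by exists 1 => w; rewrite /level; case: (s <= f w); rewrite ?normr1 ?normr0.
rewrite (_ : level f s = fun w => if s <= f w then 1 else 0); last first.
  by apply/funext => w; rewrite /level; case: (_ <= _).
by apply: measurable_fun_ifT => //; exact: measurable_fun_ler.
Qed.

(** Each function is replaced by a staircase, the average of N indicators of its level sets, within
    1 / N; by bilinearity the staircases have covariance at most [al]. *)
Let cov_unit (f g : Om -> R) : bmeas f -> bmeas g ->
  (forall w, 0 <= f w <= 1) -> (forall w, 0 <= g w <= 1) ->
  (forall s t, `|cov (level f s) (level g t)| <= al) -> `|cov f g| <= al.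
Proof.
move=> bf bg f01 g01 Hal; apply/ler_addgt0Pr => e e0.
(* The two remainder covariances below are at most 2 / N each. *)
pose N := (Num.truncn (4 / e)).+1.
have N0 : 0 < N%:R :> R by rewrite ltr0n.
have Ne : 4 / N%:R <= e.
  rewrite ler_pdivrMr// mulrC -ler_pdivrMr//; apply/ltW.
  by rewrite /N truncnS_gt// ?num_real.
pose q (f : Om -> R) w := N%:R^-1 * \sum_(j < N) level f (j.+1%:R / N%:R) w.
have qb h : bmeas h -> bmeas (q h).
  by move=> bh; apply: bmeasZ; apply: bmeas_sum => j _; exact: level_b.
have qE h : (forall w, 0 <= h w <= 1) ->
    forall w, (0 <= q h w <= 1) /\ `|h w - q h w| <= N%:R^-1.
  move=> h01 w; have /andP[h0 h1] := h01 w.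
  have Nh : 0 <= N%:R * h w <= N%:R by rewrite mulr_ge0//= ler_piMr.
  have /andP[c1 c2] := count_le_floor Nh.
  have sE : \sum_(j < N) (j.+1%:R <= N%:R * h w)%R%:R =
      \sum_(j < N) level h (j.+1%:R / N%:R) w :> R.
    by apply: eq_bigr => j _; rewrite /level ler_pdivrMr// [h w * _]mulrC.
  rewrite sE in c1 c2; rewrite /q; set S := \sum_(j < N) _ in c1 c2 *.
  have S0 : 0 <= S by apply: sumr_ge0 => j _; rewrite /level.
  have S1 : N%:R^-1 * S <= h w by rewrite mulrC ler_pdivrMr// mulrC.
  have S2 : h w - N%:R^-1 * S <= N%:R^-1.
    rewrite -(ler_pM2l N0) mulrBr mulVKf ?gt_eqF// mulfV ?gt_eqF//.
    by move: c1; lra.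
  have T0 : 0 <= N%:R^-1 * S by rewrite mulr_ge0// invr_ge0 ltW.
  split; first by rewrite T0 (le_trans S1 h1).
  by rewrite ger0_norm ?subr_ge0.
have fq := qE f f01; have gq := qE g g01.
have qcov : `|cov (q f) (q g)| <= al.
  have bS h : bmeas h -> bmeas (fun w => \sum_(j < N) level h (j.+1%:R / N%:R) w).
    by move=> bh; apply: bmeas_sum => j _; exact: level_b.
  rewrite /q covZl; [|exact: bS|exact: bmeasZ (bS _ bg)].
  rewrite covC covZl; [|exact: bS|exact: bS].
  rewrite covC cov_suml; [|by move=> i; exact: level_b|exact: bS].
  rewrite mulrA normrM; apply: (@le_trans _ _ (`|N%:R^-1 * N%:R^-1| * (N%:R * (N%:R * al)))).
    rewrite ler_wpM2l//; apply: le_trans (ler_norm_sum _ _ _) _.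
    have -> : N%:R * (N%:R * al) = \sum_(i < N) \sum_(j < N) al.
      by rewrite !sumr_const !card_ord !mulr_natl.
    apply: ler_sum => i _; rewrite covC cov_suml; [|by move=> j; exact: level_b|exact: level_b].
    apply: le_trans (ler_norm_sum _ _ _) _; apply: ler_sum => j _.
    by rewrite covC.
  rewrite ger0_norm ?mulr_ge0 ?invr_ge0//.
  by rewrite le_eqVlt; apply/orP; left; apply/eqP; field; rewrite gt_eqF.
pose a w := f w - q f w; pose b w := g w - q g w.
have ba : bmeas a by apply: bmeasB => //; exact: qb.
have bb : bmeas b by apply: bmeasB => //; exact: qb.
have -> : cov f g = cov (q f) (q g) + cov (q f) b + cov a g.
  have {1}-> : f = fun w => q f w + a w by apply/funext => w; rewrite /a addrC subrK.
  rewrite covDl//; last exact: qb.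
  congr (_ + _); rewrite [LHS]covC.
  have {1}-> : g = fun w => q g w + b w by apply/funext => w; rewrite /b addrC subrK.
  by rewrite covDl//; [rewrite covC [cov b _]covC|exact: qb|exact: qb].
have n1 : `|cov (q f) b| <= 2 * 1 * N%:R^-1.
  apply: cov_small => //; first exact: qb.
    by move=> w; have [/andP[h0 h1] _] := fq w; rewrite ger0_norm.
  by move=> w; have [_] := gq w.
have n2 : `|cov a g| <= 2 * N%:R^-1 * 1.
  apply: cov_small => //; first by move=> w; have [_] := fq w.
  by move=> w; have /andP[h0 h1] := g01 w; rewrite ger0_norm.
apply: le_trans (ler_normD _ _) _; apply: le_trans (lerD (ler_normD _ _) (lexx _)) _.
by move: Ne; lra.
Qed.

(** The factor 4 comes from the affine maps of [-F, F] and [-G, G] onto [0, 1]. *)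
Lemma cov_le_events (f g : Om -> R) (F G : R) : bmeas f -> bmeas g ->
  (forall w, `|f w| <= F) -> (forall w, `|g w| <= G) ->
  (forall s t, `|cov (level f s) (level g t)| <= al) -> `|cov f g| <= F * G * (4 * al).
Proof.
move=> bf bg fF gG Hal.
have F0 : 0 <= F by exact: le_trans (normr_ge0 _) (fF point).
have G0 : 0 <= G by exact: le_trans (normr_ge0 _) (gG point).
have [F0' | Fn] := ltP 0 F; last first.
  have Fz : F = 0 by apply/eqP; rewrite eq_le F0 Fn.
  have := cov_small bf bg fF gG; rewrite Fz; lra.
have [G0' | Gn] := ltP 0 G; last first.
  have Gz : G = 0 by apply/eqP; rewrite eq_le G0 Gn.
  have := cov_small bf bg fF gG; rewrite Gz; lra.
pose nf w := (f w + F) / (2 * F); pose ng w := (g w + G) / (2 * G).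
have F2 : 0 < 2 * F by rewrite mulr_gt0.
have G2 : 0 < 2 * G by rewrite mulr_gt0.
have bnf : bmeas nf by apply: bmeasM; [apply: bmeasD => //|]; exact: bmeas_cst.
have bng : bmeas ng by apply: bmeasM; [apply: bmeasD => //|]; exact: bmeas_cst.
have nf01 w : 0 <= nf w <= 1.
  have := fF w; rewrite ler_norml => /andP[h1 h2].
  by rewrite /nf divr_ge0 ?(ltW F2)//=; [rewrite ler_pdivrMr//; lra|lra].
have ng01 w : 0 <= ng w <= 1.
  have := gG w; rewrite ler_norml => /andP[h1 h2].
  by rewrite /ng divr_ge0 ?(ltW G2)//=; [rewrite ler_pdivrMr//; lra|lra].
have lev h (H : R) s : 0 < 2 * H ->
   level (fun w => (h w + H) / (2 * H)) s = level h (s * (2 * H) - H).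
  by move=> H2; apply/funext => w; rewrite /level ler_pdivlMr// lerBlDr.
have key : `|cov nf ng| <= al.
  by apply: cov_unit => // s t; rewrite /nf /ng !lev.
have fE : cov f g = (2 * F) * ((2 * G) * cov nf ng).
  have f1 : f = fun w => 2 * F * nf w + (- F).
    by apply/funext => w; rewrite /nf; field; rewrite gt_eqF.
  have g1 : g = fun w => 2 * G * ng w + (- G).
    by apply/funext => w; rewrite /ng; field; rewrite gt_eqF.
  rewrite {1}f1 covDl//; [|exact: bmeasZ|exact: bmeas_cst].
  rewrite cov_cst// addr0 covZl//; congr (_ * _); rewrite covC.
  rewrite {1}g1 covDl//; [|exact: bmeasZ|exact: bmeas_cst].
  by rewrite cov_cst// addr0 covZl// covC.
rewrite fE normrM (gtr0_norm F2) normrM (gtr0_norm G2).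
have := ler_wpM2l (ltW (mulr_gt0 F2 G2)) key; lra.
Qed.

End CovarianceFromEvents.

(** * Past and future of the sequence space *)

Section SequenceSpace.
Variables (R : realType) (dY : measure_display) (Y : measurableType dY).

Lemma coord_measurable (j : int) : measurable_fun setT (fun w : seqspace Y => w j).
Proof.
move=> _ B mB; rewrite setTI; apply: sub_sigma_algebra.
by exists j, B.
Qed.

Lemma seq_measurable (d : measure_display) (T : measurableType d) (f : T -> seqspace Y) :
  (forall j, measurable_fun setT (fun t => f t j)) -> measurable_fun setT f.
Proof.
move=> mf; apply: (@measurability _ _ T (seqspace Y) setT f (@cylinders _ Y)) => //.
move=> _ [A [j [B [mB ->]]] <-].
exact: mf.
Qed.

Lemma shiftZ_measurable n : measurable_fun setT (shiftZ n : seqspace Y -> seqspace Y).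
Proof. by apply: seq_measurable => j; exact: coord_measurable. Qed.

(** Dependence on coordinates is stated pointwise; [sigma_of_shift] turns it into measurability for
    the generated sigma-algebra. *)
Definition past (c : nat) (f : seqspace Y -> R) : Prop :=
  bmeas f /\ forall w w', (forall j : int, j < c%:Z -> w j = w' j) -> f w = f w'.

Definition future (c : nat) (f : seqspace Y -> R) : Prop :=
  bmeas f /\ forall w w', (forall j : int, c%:Z <= j -> w j = w' j) -> f w = f w'.

Lemma past_le c c' f : (c <= c')%N -> past c f -> past c' f.
Proof.
move=> cc' [bf fE]; split=> // w w' ww'; apply: fE => j jc; apply: ww'.
by apply: lt_le_trans jc _; rewrite lez_nat.
Qed.

Lemma future_le c c' f : (c' <= c)%N -> future c f -> future c' f.
Proof.
move=> cc' [bf fE]; split=> // w w' ww'; apply: fE => j jc; apply: ww'.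
by apply: le_trans jc; rewrite lez_nat.
Qed.

Lemma past_step c f g (a : R) : past c f -> past c g -> past c (fun w => f w * (g w - a)).
Proof.
move=> [bf fE] [bg gE]; split.
  by apply: bmeasM => //; apply: bmeasB => //; exact: bmeas_cst.
by move=> w w' ww'; rewrite (fE w w')// (gE w w').
Qed.

Lemma future_step c f g (a : R) : future c f -> future c g ->
  future c (fun w => f w * (g w - a)).
Proof.
move=> [bf fE] [bg gE]; split.
  by apply: bmeasM => //; apply: bmeasB => //; exact: bmeas_cst.
by move=> w w' ww'; rewrite (fE w w')// (gE w w').
Qed.

Variables (dS : measure_display) (S : measurableType dS) (PP : probability S R).
Variables (xi : int -> S -> Y) (P : probability (seqspace Y) R).
Hypothesis xi_stat : is_stationary PP xi.
Hypothesis xi_law : is_law PP xi P.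

Lemma P_shift n (A : set (seqspace Y)) : measurable A -> P (shiftZ n @^-1` A) = P A.
Proof.
move=> mA; rewrite !xi_law//; last first.
  by rewrite -[X in measurable X]setTI; exact: shiftZ_measurable.
exact: xi_stat.
Qed.

Lemma ae_shift (Q : seqspace Y -> Prop) : (\forall w \ae P, Q w) ->
  \forall w \ae P, forall n : nat, Q (shiftZ n%:Z w).
Proof.
move=> QP; apply: ae_foralln => n.
case: QP => N [mN PN QN]; exists (shiftZ n%:Z @^-1` N); split.
- by rewrite -[X in measurable X]setTI; exact: shiftZ_measurable.
- exact: etrans (P_shift _ mN) PN.
- by move=> w nQ; exact: QN.
Qed.

Lemma int_shift n (f : seqspace Y -> R) : bmeas f ->
  \int[P]_w f (shiftZ n w : seqspace Y) = \int[P]_w f w.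
Proof.
move=> bf; have bfs := bmeas_comp (shiftZ_measurable n) bf.
congr fine.
have mEf : measurable_fun setT (EFin \o f) by apply/measurable_EFinP; case: bf.
have iF : P.-integrable (shiftZ n @^-1` setT) ((EFin \o f) \o (shiftZ n : seqspace Y -> seqspace Y)).
  by rewrite preimage_setT; exact: (ig_bmeas P bfs).
have := integral_pushforward (shiftZ_measurable n) mEf iF measurableT.
rewrite preimage_setT => <-.
apply: eq_measure_integral; first exact: shiftZ_measurable.
by move=> mshift A mA _; exact: P_shift.
Qed.

Lemma sigma_of_shift (A : set (seqspace Y)) (J0 J : set int) n : measurable A ->
  (forall w w', (forall j, J0 j -> w j = w' j) -> A w -> A w') ->
  (forall j, J0 j -> J (j + n)) ->
  sigma_of xi J [set s | A (shiftZ n (fun j => xi j s))].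
Proof.
move=> mA AE JJ; rewrite /sigma_of; set G := [set A0 | _].
pose psi (s : g_sigma_algebraType G) : seqspace Y :=
  fun j => if `[< J0 j >] then xi (j + n) s else point.
have mpsi : measurable_fun setT psi.
  apply: seq_measurable => j; rewrite /psi; case: asboolP => J0j.
    move=> _ B mB; rewrite setTI; apply: sub_sigma_algebra.
    by exists (j + n), B; split => //; exact: JJ.
  exact: measurable_cst.
have := mpsi measurableT A mA; rewrite setTI.
suff -> : psi @^-1` A = [set s | A (shiftZ n (fun j => xi j s))] by [].
apply/seteqP; split=> s /=; apply: AE => j J0j; rewrite /psi /shiftZ; case: asboolP => //.
Qed.

Variable al : nat -> R.
Hypothesis al_le : forall n, (alpha_mix PP xi n <= (al n)%:E)%E.

Lemma cov_past_future c c' f g (F G : R) : (c <= c')%N -> past c f -> future c' g ->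
  (forall w, `|f w| <= F) -> (forall w, `|g w| <= G) ->
  `|\int[P]_w (f w * g w) - \int[P]_w f w * \int[P]_w g w| <= F * G * (4 * al (c' - c)).
Proof.
move=> cc' [bf fE] [bg gE] fF gG; apply: cov_le_events => // s t.
pose A := [set w | s <= f w]; pose B := [set w | t <= g w].
have mA : measurable A.
  rewrite -[A]setTI; apply: measurable_fun_le => //; last by case: bf.
have mB : measurable B.
  rewrite -[B]setTI; apply: measurable_fun_le => //; last by case: bg.
have EA (D : set (seqspace Y)) : measurable D ->
    \int[P]_w \1_D w = fine (P D) :> R.
  by move=> mD; congr fine; rewrite integral_indic// setIT.
have -> : \int[P]_w ((s <= f w)%R%:R * (t <= g w)%R%:R) = fine (P (A `&` B)) :> R.
  rewrite -EA; last exact: measurableI.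
  apply: eq_Rintegral => w _; rewrite -natrM mulnb indicE; congr ((nat_of_bool _)%:R).
  by apply/idP/idP => [/andP[sf tg]|]; rewrite inE => // -[/= -> ->].
have -> : \int[P]_w (s <= f w)%R%:R = fine (P A) :> R.
  rewrite -EA//; apply: eq_Rintegral => w _; rewrite indicE; congr ((nat_of_bool _)%:R).
  by apply/idP/idP; rewrite inE.
have -> : \int[P]_w (t <= g w)%R%:R = fine (P B) :> R.
  rewrite -EA//; apply: eq_Rintegral => w _; rewrite indicE; congr ((nat_of_bool _)%:R).
  by apply/idP/idP; rewrite inE.
(* By stationarity time c is moved to 0: the past then uses indices at most 0 and the future indices
   at least c' - c, as in [alpha_mix]. *)
pose xs (D : set (seqspace Y)) := [set s | D (shiftZ (- c%:Z) (fun j => xi j s))].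
have PE (D : set (seqspace Y)) : measurable D -> P D = PP (xs D).
  by move=> mD; rewrite xi_law// -(xi_stat (- c%:Z)).
have sA : sigma_of xi [set j | j <= 0] (xs A).
  apply: (@sigma_of_shift A [set j | j < c%:Z]) => //.
    by move=> w w' ww'; rewrite /A/= (fE w w').
  by move=> j /= jc; rewrite subr_le0 ltW.
have sB : sigma_of xi [set j | (c' - c)%:Z <= j] (xs B).
  apply: (@sigma_of_shift B [set j | c'%:Z <= j]) => //.
    by move=> w w' ww'; rewrite /B/= (gE w w').
  by move=> j /= jc; rewrite -subzn// lerD2r.
have fin (D : set (seqspace Y)) : measurable D -> P D \is a fin_num by exact: fin_num_measure.
rewrite -lee_fin; apply: le_trans (al_le (c' - c)).
apply: ereal_sup_ubound; exists (xs A), (xs B); split => //.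
have -> : xs A `&` xs B = xs (A `&` B) by [].
rewrite -!PE//; last exact: measurableI.
rewrite -[P (A `&` B)]fineK; last by apply: fin; exact: measurableI.
by rewrite -[P A]fineK ?fin// -[P B]fineK ?fin.
Qed.

End SequenceSpace.

(** * Real transfer operators and quenched weights *)

Lemma cmeasurable_normc (R : realType) (d : measure_display) (X : measurableType d)
  (u : X -> R[i]) : cmeasurable u -> measurable_fun setT (fun x => normc (u x)).
Proof.
move=> [mR mI]; rewrite (_ : (fun x => _) = Num.sqrt \o
   (fun x => complex.Re (u x) ^+ 2 + complex.Im (u x) ^+ 2)).
  apply: measurableT_comp; first by apply: continuous_measurable_fun; exact: sqrt_continuous.
  by apply: measurable_funD; exact: measurable_funX.
by apply/funext => x /=; case: (u x).
Qed.

Section RealTransfer.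
Variables (R : realType) (d : measure_display) (X : measurableType d).
Variables (m : probability X R) (T : X -> X) (L : (X -> R[i]) -> X -> R[i]).
Hypothesis mT : measurable_fun setT T.
Hypothesis HL : is_transfer m T L.
Notation ig f := (m.-integrable setT (EFin \o f)).

Lemma normc_Re (z : R[i]) : `|complex.Re z| <= normc z.
Proof.
case: z => a b /=; rewrite -sqrtr_sqr; apply: ler_wsqrtr.
by rewrite lerDl sqr_ge0.
Qed.

Lemma inL1_Re u : inL1 m u -> ig (fun x => complex.Re (u x)).
Proof.
move=> [[mR mI]]; rewrite /norm1 Lnorm1 => fin; apply/integrableP; split.
  exact/measurable_EFinP.
have mn := cmeasurable_normc (conj mR mI).
apply: le_lt_trans fin; apply: ge0_le_integral => //.
- exact/measurable_EFinP/measurableT_comp.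
- exact/measurableT_comp/measurable_EFinP.
- move=> x _; rewrite /cabs lee_fin; apply: le_trans (normc_Re _) _.
  exact: ler_norm.
Qed.

Lemma inL1_Im u : inL1 m u -> ig (fun x => complex.Im (u x)).
Proof.
move=> [[mR mI] fin]; have -> : (fun x => complex.Im (u x)) =
    (fun x => complex.Re (Complex (complex.Im (u x)) (complex.Re (u x)))) by [].
apply: inL1_Re; split; first by split.
move: fin; rewrite /norm1; congr (_ < _)%E; congr Lnorm.
by apply/funext => x; rewrite /cabs; case: (u x) => a b /=; rewrite addrC.
Qed.

Lemma inLoo_creal (g : X -> R) : bmeas g -> inLoo m (creal g).
Proof.
move=> [mg [M Mg]]; split; first by split => //=; exact: measurable_cst.
rewrite /normoo unlock /= probability_setT lte01 cabs_creal.
apply: le_lt_trans (ltry M); apply/ess_supP; apply: aeW => x /=.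
by rewrite lee_fin normr_id.
Qed.

Lemma transfer_Re u g : inL1 m u -> bmeas g ->
  \int[m]_x (complex.Re (L u x) * g x) = \int[m]_x (complex.Re (u x) * g (T x)).
Proof.
move=> iu bg; have [iLu H] := HL iu.
have := congr1 (@complex.Re R) (H _ (inLoo_creal bg)); rewrite /cint/=.
under eq_Rintegral do rewrite Re_mul /= mulr0 subr0.
by under [in RHS]eq_Rintegral do rewrite Re_mul /= mulr0 subr0.
Qed.

Lemma transfer_Im u g : inL1 m u -> bmeas g ->
  \int[m]_x (complex.Im (L u x) * g x) = \int[m]_x (complex.Im (u x) * g (T x)).
Proof.
move=> iu bg; have [iLu H] := HL iu.
have := congr1 (@complex.Im R) (H _ (inLoo_creal bg)); rewrite /cint/=.
under eq_Rintegral do rewrite Im_mul /= mulr0 add0r.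
by under [in RHS]eq_Rintegral do rewrite Im_mul /= mulr0 add0r.
Qed.

Lemma transfer_ae u w : inL1 m u -> inL1 m w -> (\forall x \ae m, u x = w x) ->
  \forall x \ae m, L u x = L w x.
Proof.
move=> iu iw uw.
have [iLu _] := HL iu; have [iLw _] := HL iw.
have igMr f (g : X -> R) : ig f -> bmeas g -> ig (fun x => f x * g x).
  by move=> iF bg; under [X in EFin \o X]eq_fun do rewrite mulrC; exact: igM.
have hR : \forall x \ae m, complex.Re (L u x) = complex.Re (L w x).
  apply: ae_eq_test; [exact: inL1_Re|exact: inL1_Re|move=> g bg].
  have bgT := bmeas_comp mT bg.
  rewrite !transfer_Re//; apply: Rint_ae.
  - exact: igMr (inL1_Re iu) bgT.
  - exact: igMr (inL1_Re iw) bgT.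
  - by apply: filterS uw => x ->.
have hI : \forall x \ae m, complex.Im (L u x) = complex.Im (L w x).
  apply: ae_eq_test; [exact: inL1_Im|exact: inL1_Im|move=> g bg].
  have bgT := bmeas_comp mT bg.
  rewrite !transfer_Im//; apply: Rint_ae.
  - exact: igMr (inL1_Im iu) bgT.
  - exact: igMr (inL1_Im iw) bgT.
  - by apply: filterS uw => x ->.
by apply: filterS2 hR hI => x hr hi; exact: complex_ext.
Qed.

Definition Ltransfer (u : X -> R) : X -> R := fun x => complex.Re (L (creal u) x).

Lemma Ltransfer_ig u : ig u -> ig (Ltransfer u).
Proof. by move=> /inL1_creal /HL[iLu _]; exact: inL1_Re. Qed.

Lemma Ltransfer_dual u g : ig u -> bmeas g ->
  \int[m]_x (Ltransfer u x * g x) = \int[m]_x (u x * g (T x)).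
Proof. by move=> /inL1_creal iu bg; rewrite transfer_Re. Qed.

(** Tested against real functions, the imaginary part of the image is dual to that of u, which is
    zero; so taking real parts loses nothing. *)
Lemma Ltransfer_creal u : ig u -> \forall x \ae m, L (creal u) x = creal (Ltransfer u) x.
Proof.
move=> /inL1_creal iu; have [iLu _] := HL iu.
have hI : \forall x \ae m, complex.Im (L (creal u) x) = 0.
  apply: ae_eq0_test => [|g bg]; first exact: inL1_Im.
  rewrite transfer_Im//=.
  by under eq_Rintegral do rewrite mul0r; rewrite Rint_cst.
by apply: filterS hI => x hi; exact: complex_ext.
Qed.

End RealTransfer.

Definition clip (R : realType) (M x : R) : R := Num.max (- M) (Num.min M x).

Lemma clip_le (R : realType) (M x : R) : 0 <= M -> `|clip M x| <= M.
Proof.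
move=> M0; rewrite /clip ler_norml le_max lexx/= ge_max ge_min lexx/= andbT.
by move: M0; lra.
Qed.

Lemma clip_id (R : realType) (M x : R) : `|x| <= M -> clip M x = x.
Proof.
by rewrite ler_norml => /andP[h1 h2]; rewrite /clip min_r// max_r.
Qed.

Lemma clip_bmeas (R : realType) (d : measure_display) (X : measurableType d)
  (M : R) (f : X -> R) : 0 <= M -> measurable_fun setT f -> bmeas (fun x => clip M (f x)).
Proof.
move=> M0 mf; split; last by exists M => x; exact: clip_le.
by apply: measurable_maxr => //; apply: measurable_minr.
Qed.

Lemma shiftZD (Y : Type) (a b : int) (w : int -> Y) :
  shiftZ a (shiftZ b w) = shiftZ (b + a) w.
Proof. by apply/funext => j; rewrite /shiftZ -addrA [a + b]addrC. Qed.

(** * Measurability and locality of the quenched weights *)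

Section QuenchedData.
Variables (R : realType) (dX dY : measure_display).
Variables (X : measurableType dX) (Y : measurableType dY).
Variables (m : probability X R) (P : probability (seqspace Y) R).
Variables (T : Y -> X -> X) (phi : Y -> X -> R).
Variable L : seqspace Y -> (X -> R[i]) -> X -> R[i].
Hypothesis T_meas : forall y, measurable_fun setT (T y).
Hypothesis skew_meas : measurable_fun setT (@skew_product _ _ X Y T).
Hypothesis obs_meas : measurable_fun setT (@observable R _ _ X Y phi).
Hypothesis HL : forall w, is_transfer m (T (w 0)) (L w).
Notation ig f := (m.-integrable setT (EFin \o f)).

(* The cut-off at [M] makes everything bounded, and does not change the
   observable almost everywhere if [M] is large; the delay [N0] lets the initial
   measure [m] relax to equilibrium before the sum starts. *)
Variables (M : R) (M0 : 0 <= M) (N0 : nat).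

Definition qtau (w : seqspace Y) (j : nat) : X -> X := T (w j%:Z).
Definition qphi (w : seqspace Y) (j : nat) (x : X) : R :=
  if (N0 <= j)%N then clip M (phi (w j%:Z) x) else 0.
Definition qL (w : seqspace Y) (j : nat) : (X -> R) -> X -> R :=
  Ltransfer (L (shiftZ j%:Z w)).

Let shift_id_meas (j : int) :
  measurable_fun setT (fun p : seqspace Y * X => (shiftZ j p.1 : seqspace Y, p.2)).
Proof.
apply: measurable_fun_pair; last exact: measurable_snd.
apply: seq_measurable => i.
exact: (measurableT_comp (coord_measurable (i + j)) (@measurable_fst _ _ _ _)).
Qed.

Lemma qtau_joint (j : nat) :
  measurable_fun setT (fun p : seqspace Y * X => qtau p.1 j p.2).
Proof.
have := measurableT_comp (measurableT_comp (@measurable_snd _ _ _ _) skew_meas) (shift_id_meas j%:Z).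
by congr measurable_fun; apply/funext => x; rewrite /= /shiftZ add0r.
Qed.

Lemma qphi_joint (j : nat) : bmeas (fun p : seqspace Y * X => qphi p.1 j p.2).
Proof.
rewrite /qphi; case: (N0 <= j)%N; last exact: bmeas_cst.
apply: clip_bmeas => //.
have := measurableT_comp obs_meas (shift_id_meas j%:Z).
by congr measurable_fun; apply/funext => x; rewrite /= /observable /= /shiftZ add0r.
Qed.

Lemma qtau_meas w j : measurable_fun setT (qtau w j).
Proof. exact: T_meas. Qed.

Lemma qphi_b w j : bmeas (qphi w j).
Proof. exact: (bmeas_section w (qphi_joint j)). Qed.

Lemma HL_shift w (j : nat) : is_transfer m (qtau w j) (L (shiftZ j%:Z w)).
Proof.
have -> : qtau w j = T (shiftZ j%:Z w 0) by rewrite /qtau /shiftZ add0r.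
exact: HL.
Qed.

Lemma qL_ig w j u : ig u -> ig (qL w j u).
Proof. by move=> iu; rewrite /qL; exact: (@Ltransfer_ig _ _ _ _ _ _ (HL_shift w j) u iu). Qed.

Lemma qL_dual w j u g : ig u -> bmeas g ->
  \int[m]_x (qL w j u x * g x) = \int[m]_x (u x * g (qtau w j x)).
Proof. by move=> iu bg; apply: (Ltransfer_dual (HL_shift w j)). Qed.

Definition qmom (w : seqspace Y) : nat -> nat -> fps R := qmoment m (qtau w) (qphi w).
Definition qwt (w : seqspace Y) : nat -> nat -> fps R := weight m (qL w) (qphi w).

Let joint_map a n :
  measurable_fun setT (fun p : seqspace Y * X => orbit_map (qtau p.1) a n p.2).
Proof.
elim: n => [|n IH] /=; first exact: measurable_snd.
have := measurableT_comp (qtau_joint (a + n)) (measurable_fun_pair (@measurable_fst _ _ _ _) IH).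
by [].
Qed.

Let joint_sum a n :
  bmeas (fun p : seqspace Y * X => orbit_sum (qtau p.1) (qphi p.1) a n p.2).
Proof.
elim: n => [|n IH] /=; first exact: bmeas_cst.
apply: bmeasD => //.
exact: (bmeas_comp (measurable_fun_pair (@measurable_fst _ _ _ _) (joint_map a n))
  (qphi_joint (a + n))).
Qed.

Lemma joint_pow_b a n p : bmeas (fun z : seqspace Y * X =>
  orbit_sum (qtau z.1) (qphi z.1) a n z.2 ^+ p / p`!%:R).
Proof. by apply: bmeasM; [exact: bmeasX | exact: bmeas_cst]. Qed.

Lemma qmom_b a n p : bmeas (fun w => qmom w a n p).
Proof. by rewrite /qmom /qmoment; exact: (bmeas_inner P m (joint_pow_b a n p)). Qed.

Definition agree (a b : nat) (w w' : seqspace Y) : Prop :=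
  forall i : nat, (a <= i < b)%N -> w i%:Z = w' i%:Z.

Let orbit_map_agree a n w w' : agree a (a + n) w w' ->
  orbit_map (qtau w) a n = orbit_map (qtau w') a n.
Proof.
elim: n => //= n IH ag; apply/funext => x; rewrite IH; last first.
  by move=> i /andP[ai ib]; apply: ag; rewrite ai addnS ltnW.
by rewrite /qtau ag// leq_addr addnS ltnSn.
Qed.

Let orbit_sum_agree a n w w' : agree a (a + n) w w' ->
  orbit_sum (qtau w) (qphi w) a n = orbit_sum (qtau w') (qphi w') a n.
Proof.
elim: n => //= n IH ag.
have ag' : agree a (a + n) w w'.
  by move=> i /andP[ai ib]; apply: ag; rewrite ai addnS ltnW.
apply/funext => x; rewrite IH// (orbit_map_agree ag') /qphi ag//.
by rewrite leq_addr addnS ltnSn.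
Qed.

Lemma qmom_agree a n w w' : agree a (a + n) w w' -> qmom w a n = qmom w' a n.
Proof.
by move=> ag; apply/funext => p; rewrite /qmom /qmoment (orbit_sum_agree ag).
Qed.

Lemma qmomS w a n : qmom w a n.+1 = \sum_(c < n.+1) qmom w a c * qwt w (a + c) (n - c).
Proof.
exact: (qmomentS (qL_ig w) (qtau_meas w) (@qL_dual w) (qphi_b w)).
Qed.

(** The renewal equation is solved for its longest weight. The moments depend on w explicitly
    through the maps, whereas [L w] is only some version of an operator fixed by duality; so
    measurability and locality of the weights are read off from the moments. *)
Lemma qwtE w a n :
  qwt w a n = qmom w a n.+1 - \sum_(c < n) qmom w a c.+1 * qwt w (a + c.+1) (n - c.+1).
Proof.
rewrite qmomS big_ord_recl/= /qmom qmoment_start mul1r addn0 subn0.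
by under [X in _ + X - _]eq_bigr do rewrite /bump/= add1n; rewrite addrK.
Qed.

Lemma qwt_b a n p : bmeas (fun w => qwt w a n p).
Proof.
elim/ltn_ind: n a p => n IH a p.
under [X in bmeas X]eq_fun do rewrite qwtE fpsBE fps_sumE.
apply: bmeasB; first exact: qmom_b.
apply: bmeas_sum => c _; under [X in bmeas X]eq_fun do rewrite fpsME.
apply: bmeas_sum => i _; apply: bmeasM; first exact: qmom_b.
by apply: IH; rewrite ltn_subrL/= (leq_ltn_trans _ (ltn_ord c)).
Qed.

Lemma qwt_agree a n w w' : agree a (a + n.+1) w w' -> qwt w a n = qwt w' a n.
Proof.
elim/ltn_ind: n a => n IH a ag.
apply: etrans (qwtE w a n) _; apply: etrans (esym (qwtE w' a n)).
apply: (f_equal2 (fun x y : fps R => x - y)); first exact: qmom_agree.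
apply: eq_bigr => c _; have cn : (c.+1 <= n)%N by [].
apply: (f_equal2 (fun x y : fps R => x * y)).
  apply: qmom_agree => i /andP[ai ib]; apply: ag; rewrite ai (leq_trans ib)//.
  by rewrite leq_add2l ltnW.
apply: IH; first by rewrite ltn_subrL/= (leq_ltn_trans _ (ltn_ord c)).
move=> i /andP[ai ib]; apply: ag; rewrite (leq_trans (leq_addr _ _) ai)/=.
by apply: leq_trans ib _; rewrite -addnA leq_add2l -subSn// subnKC// ltnW.
Qed.

Lemma qmom0 w a n : qmom w a n 0%N = 1.
Proof. exact: qmoment0. Qed.

Lemma qmom_start w a : qmom w a 0 = 1.
Proof. exact: qmoment_start. Qed.

Lemma qwt0 w a n : qwt w a n 0%N = (n == 0)%:R.
Proof. exact: (weight0 (qL_ig w) (@qL_dual w) (qphi_b w)). Qed.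

Lemma orbit_sum_inactive w n x : (n <= N0)%N -> orbit_sum (qtau w) (qphi w) 0 n x = 0.
Proof.
elim: n => //= n IH nN; rewrite IH ?(ltnW nN)// add0r.
by rewrite /qphi add0n leqNgt nN.
Qed.

Lemma qmom_inactive w n : (n <= N0)%N -> qmom w 0 n = 1.
Proof.
move=> nN; have S0 : orbit_sum (qtau w) (qphi w) 0 n = fun=> 0.
  by apply/funext => x; exact: orbit_sum_inactive.
apply/funext => -[|p]; first by rewrite qmom0 fps1E.
rewrite /qmom /qmoment S0 fps1E/=.
by under eq_Rintegral do rewrite expr0n/= mul0r; rewrite Rint_cst.
Qed.

Opaque qmom qwt.

Variables (A B rho : R) (A0 : 0 <= A) (B0 : 0 <= B) (rho0 : 0 <= rho).

(** Clipping at the expected bound makes the bound valid for every w and keeps locality. The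
    predecessor is there because [qwt w c n] lives on [c, c + n + 1). *)
Definition qV (c c' p : nat) (w : seqspace Y) : R :=
  if (c < c')%N then clip (A * B ^+ p * rho ^+ (c' - c)) (qwt w c (c' - c).-1 p) else 0.

Let bnd_ge0 c c' p : 0 <= A * B ^+ p * rho ^+ (c' - c).
Proof. by rewrite !mulr_ge0// exprn_ge0. Qed.

Lemma qV_le c c' p w : `|qV c c' p w| <= A * B ^+ p * rho ^+ (c' - c).
Proof. by rewrite /qV; case: ifP => _; [exact: clip_le | rewrite normr0]. Qed.

Let qV_b c c' p : bmeas (qV c c' p).
Proof.
rewrite /qV; case: (c < c')%N; last exact: bmeas_cst.
by apply: clip_bmeas => //; case: (qwt_b c (c' - c).-1 p).
Qed.

Let qV_agree c c' p w w' : agree c c' w w' -> qV c c' p w = qV c c' p w'.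
Proof.
move=> ag; rewrite /qV; case: (boolP (c < c')%N) => [cc'|_]; last by [].
apply: (f_equal (fun f : fps R => clip (A * B ^+ p * rho ^+ (c' - c)) (f p))).
by apply: qwt_agree; rewrite prednK ?subn_gt0// subnKC// ltnW.
Qed.

Lemma qV_past c c' p : past c' (qV c c' p).
Proof.
split; first exact: qV_b.
move=> w w' ww'; apply: qV_agree => i /andP[_ ic']; apply: ww'.
by rewrite ltz_nat.
Qed.

Lemma qV_future c c' p : future c (qV c c' p).
Proof.
split; first exact: qV_b.
move=> w w' ww'; apply: qV_agree => i /andP[ci _]; apply: ww'.
by rewrite lez_nat.
Qed.

(** In degree 0 only the weight of length one is nonzero, and it equals 1: it reproduces the
    previous moment, while all other terms have positive order. *)
Lemma qmom_rec w : (forall c n p, `|qwt w c n p| <= A * B ^+ p * rho ^+ n.+1) ->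
  forall n q, qmom w 0 n.+1 q = qmom w 0 n q +
    \sum_(c < n.+1) \sum_(p < q) qV c n.+1 p.+1 w * qmom w 0 c (q - p.+1)%N.
Proof.
move=> H n q; rewrite qmomS fps_sumE.
have E (c : 'I_n.+1) : (qmom w 0 c * qwt w (0 + c) (n - c)) q =
    (n == c)%:R * qmom w 0 c q +
    \sum_(p < q) qV c n.+1 p.+1 w * qmom w 0 c (q - p.+1)%N.
  have cn : (c <= n)%N by rewrite -ltnS.
  rewrite mulrC fpsME big_ord_recl/= subn0 qwt0 subn_eq0 add0n; congr (_ * _ + _).
    by rewrite eqn_leq cn andbT.
  apply: eq_bigr => p _; rewrite /bump/= add1n; congr (_ * _).
  by rewrite /qV ltnS cn subSn//= clip_id// -subSn// subSn.
rewrite (eq_bigr _ (fun c _ => E c)) big_split/=; congr (_ + _).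
rewrite big_ord_recr/= eqxx mul1r big1 ?add0r// => i _.
by rewrite gtn_eqF ?ltn_ord// mul0r.
Qed.

End QuenchedData.

(** * Uniform decay along almost every environment *)

Section FunctionsOfBV.
Variables (R : realType) (d : measure_display) (X : measurableType d).
Variables (m : probability X R) (v : (X -> R[i]) -> \bar R) (Cv : R).
Hypothesis Hv : is_variation m v Cv.
Notation ig f := (m.-integrable setT (EFin \o f)).

Lemma bvle_of_complex U w c : inL1 m U -> ig w -> (\forall x \ae m, U x = creal w x) ->
  (bvnorm m v U <= c%:E)%E -> bvle m v w c.
Proof.
move=> iU iw Uw H; split=> //; apply: le_trans H.
have icw : inL1 m (creal w) by exact/inL1_creal.
rewrite /bvnorm (var_ae Hv icw iU); last by apply: filterS Uw => x ->.
rewrite leeD2r// /norm1 !Lnorm1 le_eqVlt; apply/orP; left; apply/eqP.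
apply: ae_eq_integral => //.
- by apply: measurableT_comp => //; apply/measurable_EFinP; apply: cmeasurable_normc; case: icw.
- by apply: measurableT_comp => //; apply/measurable_EFinP; apply: cmeasurable_normc; case: iU.
- by apply: filterS Uw => x Ux _; rewrite /cabs Ux.
Qed.

Lemma inBV_bvle u : inBV m v (creal u) -> bvle m v u (fine (bvnorm m v (creal u))).
Proof.
move=> [iu vf]; have [_ n1] := iu.
split; first exact/inL1_creal.
rewrite fineK// fin_num_abs /bvnorm gee0_abs; last first.
  by rewrite adde_ge0 ?(var_ge0 Hv)// Lnorm_ge0.
by rewrite lte_add_pinfty.
Qed.

Lemma bvle_pairing f u b c : bmeas f -> (\forall x \ae m, `|f x| <= b) -> 0 <= b ->
  bvle m v u c -> `|\int[m]_x (f x * u x)| <= b * c.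
Proof.
move=> bf fb b0 uc; have [iu _] := uc.
have ifu := igM bf iu.
apply: le_trans (le_normr_Rintegral measurableT ifu) _.
have iau : m.-integrable setT (EFin \o (fun x => `|u x|)).
  by have := integrable_norm iu; apply: eq_integrable => // x _ /=.
apply: (@le_trans _ _ (\int[m]_x (b * `|u x|))).
  apply: Rint_ge0_le; [|exact: igZ|].
    by have := integrable_norm ifu; apply: eq_integrable.
  by apply: filterS fb => x fx; rewrite normrM ler_wpM2r.
rewrite RintZ// ler_wpM2l//.
case: uc => _; rewrite /bvnorm norm1_creal => H.
rewrite -lee_fin /Rintegral fineK; last exact: integrable_fin_num.
by apply: le_trans H; rewrite leeDl// (var_ge0 Hv).
Qed.

End FunctionsOfBV.

(** * Almost every environment satisfies the decay hypotheses *)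

Section GoodCocycle.
Variables (R : realType) (dX dY : measure_display).
Variables (X : measurableType dX) (Y : measurableType dY).
Variables (m : probability X R) (v : (X -> R[i]) -> \bar R) (Cv : R).
Variables (P : probability (seqspace Y) R).
Variables (T : Y -> X -> X) (L : seqspace Y -> (X -> R[i]) -> X -> R[i]).
Variables (h : seqspace Y -> X -> R) (K : seqspace Y -> R) (phi : Y -> X -> R).
Variables (lam eps B0 : R).
Hypothesis Hv : is_variation m v Cv.
Hypothesis T_meas : forall y, measurable_fun setT (T y).
Hypothesis obs_meas : measurable_fun setT (@observable R _ _ X Y phi).
Hypothesis HL : forall w, is_transfer m (T (w 0)) (L w).
Notation ig f := (m.-integrable setT (EFin \o f)).

Lemma shiftZ0 (w : int -> Y) : shiftZ 0 w = w.
Proof. by apply/funext => j; rewrite /shiftZ addr0. Qed.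

Lemma qL_shift w j i : qL L (shiftZ j%:Z w) i = qL L w (j + i).
Proof. by rewrite /qL shiftZD PoszD. Qed.

Lemma lit_shift w j r u : lit (qL L (shiftZ j%:Z w)) 0 r u = lit (qL L w) j r u.
Proof. by elim: r => //= r ->; rewrite qL_shift add0n. Qed.

Lemma Liter_lit w n u : ig u ->
  inL1 m (Liter L n w (creal u)) /\
  \forall x \ae m, Liter L n w (creal u) x = creal (lit (qL L w) 0 n u) x.
Proof.
move=> iu; elim: n => [|n [IH1 IH2]] /=.
  by split; [exact/inL1_creal | exact: aeW].
have HLn := HL_shift HL w n; have il := lit_ig (qL_ig HL w) 0 n iu.
split; first by case: (HLn _ IH1).
have e1 := transfer_ae (T_meas _) HLn IH1 (proj2 (inL1_creal m _) il) IH2.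
have e2 := Ltransfer_creal HLn il.
by apply: filterS2 e1 e2 => x -> ->; rewrite add0n.
Qed.

Definition slow_at w := forall n : nat, K w <= K (shiftZ n%:Z w) * expR (eps * n%:R).

Definition decay_at w := forall n u c, bvle m v u c -> \int[m]_x u x = 0 ->
  bvle m v (lit (qL L w) 0 n u) (K w * expR (- (lam * n%:R)) * c).

Definition decay1_at w := forall n,
  bvle m v (lit (qL L w) 0 n (fun x => 1 - h w x)) (K w * expR (- (lam * n%:R))).

Definition decays_at w := decay_at w /\ decay1_at w.

Definition density_at w := [/\ ig (h w), \int[m]_x h w x = 1 &
  \forall x \ae m, qL L w 0 (h w) x = h (shiftZ 1 w) x].

Definition phi_at (w : seqspace Y) := bvle m v (phi (w 0)) (B0 / K w).

Definition good_at w :=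
  [/\ slow_at w, phi_at w, decay_at w, density_at w & decay1_at w].

Definition good_path (w : seqspace Y) := forall j : nat, good_at (shiftZ j%:Z w).

Hypothesis K1 : forall w, 1 < K w.

Lemma slow_at_ae D Dt Nv : is_adapted m v P h D Dt Nv eps K ->
  \forall w \ae P, slow_at w.
Proof.
move=> [_ _ H]; apply: filterS H => w [_ H] n; have /andP[+ _] := H n%:Z.
by rewrite expRN /= -ler_pdivrMr ?invr_gt0 ?expR_gt0// invrK mulrC.
Qed.

Lemma phi_at_ae normphi : normK m v P K phi = normphi%:E -> `|normphi| <= B0 ->
  \forall w \ae P, phi_at w.
Proof.
move=> nK nB.
have := ess_sup_ge P (fun w => ((K w)%:E * bvnorm m v (creal (phi (w 0%R))))%E).
rewrite -/(normK m v P K phi) nK; apply: filterS => w H.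
have K0 : 0 < K w by exact: lt_trans (K1 w).
have n0 : (0 <= norm1 m (creal (phi (w 0%R))))%E by exact: Lnorm_ge0.
have v0 : (0 <= v (creal (phi (w 0%R))))%E by exact: (var_ge0 Hv).
have H2 : (bvnorm m v (creal (phi (w 0%R))) <= (B0 / K w)%:E)%E.
  rewrite -(@lee_pmul2l _ (K w)%:E)//; last idtac.
  apply: le_trans H _; rewrite -EFinM lee_fin mulrC divfK ?gt_eqF//.
  exact: le_trans (ler_norm _) nB.
split=> //; apply/inL1_creal; split; last first.
  by apply: le_lt_trans (ltry (B0 / K w)); apply: le_trans H2; rewrite leeDl.
split=> /=; last exact: measurable_cst.
exact: (measurable_fun_pair2 w obs_meas).
Qed.

Lemma density_at_ae : is_equivariant_density m v P L h -> \forall w \ae P, density_at w.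
Proof.
move=> [mh]; apply: filterS => w [hBV h0 h1 hE].
have ih : ig (h w) by case: (inBV_bvle Hv hBV).
split=> //; first by rewrite /Rintegral h1.
have := Ltransfer_creal (HL w) ih; apply: filterS2 hE => x.
by rewrite /qL shiftZ0 => -> [<-].
Qed.

(** Pi fixes functions of mean zero and sends 1 to 1 - h, so both decay statements are instances of
    the bound on the iterates of Pi, with D <= K. *)
Lemma decay_at_ae D Dt Nv eps' : cocycle_bounds m v P L h lam eps' D Dt ->
  is_adapted m v P h D Dt Nv eps K -> is_equivariant_density m v P L h ->
  \forall w \ae P, decays_at w.
Proof.
move=> [[_ D0 _] _ HD] [_ _ HK] hD; have hd := density_at_ae hD.
have hDK : \forall w \ae P, D w <= K w.
  apply: filterS HK => w [/andP[_ HK] _].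
  by move: HK; rewrite /Ktilde -lee_fin; apply: le_trans; rewrite !le_max lexx.
suff hfin : forall w, D w <= K w -> density_at w -> (forall n,
    bvop_le m v (fun g => Liter L n w (Pi m h w g)) (D w * expR (- (lam * n%:R)))) ->
    decays_at w.
  have h1 : \forall w \ae P, density_at w -> decays_at w.
    pose Q (w : seqspace Y) := forall n : nat,
      [/\ bvop_le m v (fun g => Liter L n w (Pi m h w g)) (D w * expR (- (lam * n%:R))),
          bvop_le m v (fun g => Liter L n w (coPi m h w g)) (D w * expR (eps' * n%:R)),
          bvop_le m v (fun g => Lnormd L h n w (Pitilde m h w g))
            (Dt w * expR (- (lam * n%:R))) &
          bvop_le m v (fun g => Lnormd L h n w (coPitilde m h w g)) (Dt w)].
    have {}HD : \forall w \ae P, Q w := HD.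
    by apply: filterS2 HD hDK => w HD DK hd'; apply: hfin => // n; case: (HD n).
  by apply: filterS2 h1 hd => w; apply.
move=> w DK [ih h1 _] Hn.
have gen n u g c : ig u -> bvle m v g c -> Pi m h w (creal g) = creal u ->
    bvle m v (lit (qL L w) 0 n u) (K w * expR (- (lam * n%:R)) * c).
  move=> iu gc Eu; have [iL aeL] := Liter_lit w n iu.
  apply: (bvle_of_complex Hv iL _ aeL); first exact: (lit_ig (qL_ig HL w)).
  have := Hn n _ (bvle_inBV gc); rewrite Eu => /le_trans; apply.
  rewrite [X in (_ <= X)%E]EFinM; apply: lee_pmul.
  - rewrite lee_fin; apply: mulr_ge0; last exact: expR_ge0.
    exact: ltW.
  - by rewrite adde_ge0 ?(var_ge0 Hv)// Lnorm_ge0.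
  - by rewrite lee_fin ler_wpM2r// expR_ge0.
  - by case: gc.
split=> [n u c uc u0|n].
  apply: (gen _ _ u) => //; first by case: uc.
  apply/funext => x; rewrite /Pi /coPi /cint /creal /= u0 Rint_cst.
  by apply: complex_ext; rewrite /=; ring.
rewrite -[X in bvle _ _ _ X]mulr1; apply: (gen _ _ (fun=> 1)).
- by apply: igB => //; exact/ig_bmeas/bmeas_cst.
- by have := bvle_cst Hv 1; rewrite normr1.
- apply/funext => x; rewrite /Pi /coPi /cint /creal /= !Rint_cst.
  by apply: complex_ext; rewrite /=; ring.
Qed.

Variables (dS : measure_display) (S : measurableType dS) (PP : probability S R).
Variable xi : int -> S -> Y.
Hypothesis xi_stat : is_stationary PP xi.
Hypothesis xi_law : is_law PP xi P.

Lemma good_path_ae D Dt Nv eps' normphi : is_adapted m v P h D Dt Nv eps K ->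
  cocycle_bounds m v P L h lam eps' D Dt -> is_equivariant_density m v P L h ->
  normK m v P K phi = normphi%:E -> `|normphi| <= B0 ->
  \forall w \ae P, good_path w.
Proof.
move=> HK HD Hh nK nB; suff good_ae : \forall w \ae P, good_at w.
  exact: (ae_shift xi_stat xi_law good_ae).
have h1 : \forall w \ae P, slow_at w /\ phi_at w.
  by apply: filterS2 (slow_at_ae HK) (phi_at_ae nK nB) => w.
have h2 : \forall w \ae P, decays_at w /\ density_at w.
  by apply: filterS2 (decay_at_ae HD HK Hh) (density_at_ae Hh) => w.
by apply: filterS2 h1 h2 => w [s p] [[d1 d2] d3].
Qed.

Hypotheses (eps_lam : eps < lam) (B00 : 0 <= B0).
Variable N0 : nat.
(** By [V3] the observable is almost everywhere at most Cv B0 / K <= Cv B0 in modulus, so clipping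
    at this level changes it only on a null set. *)
Let M := Cv * B0.

Let Cv0 : 0 <= Cv. Proof. by apply: le_trans (V3_ge1 Hv). Qed.
Let M0 : 0 <= M. Proof. exact: mulr_ge0. Qed.
Let K0 w : 0 < K w. Proof. exact: lt_trans (K1 w). Qed.

Lemma clip_phi_ae w j : good_path w -> \forall x \ae m, clip M (phi (w j%:Z) x) = phi (w j%:Z) x.
Proof.
move=> /(_ j) [_ pb _ _ _]; have := bvle_sup Hv pb; apply: filterS => x.
rewrite {1}/shiftZ add0r => H; apply: clip_id; apply: le_trans H _.
by rewrite /M ler_wpM2l// ler_piMr// invf_le1// ltW.
Qed.

Lemma qphi_bvle w j : good_path w -> bvle m v (qphi phi M N0 w j) (B0 / K (shiftZ j%:Z w)).
Proof.
move=> gw; have [_ pb _ _ _] := gw j; have cl := clip_phi_ae j gw.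
have ip := ig_bmeas m (qphi_b obs_meas M0 N0 w j).
have b0 : 0 <= B0 / K (shiftZ j%:Z w) by rewrite divr_ge0// ltW.
case: (boolP (N0 <= j)%N) => Nj.
  apply: (bvle_ae Hv pb ip); apply: filterS cl => x.
  by rewrite /qphi Nj {1}/shiftZ add0r => ->.
have b1 : bvle m v (fun=> 0) (B0 / K (shiftZ j%:Z w)).
  by apply: bvle_le (bvle_cst Hv 0); rewrite normr0.
by apply: (bvle_ae Hv b1 ip); apply: aeW => x; rewrite /qphi (negbTE Nj).
Qed.

Lemma qwt_bound w B rho : good_path w -> 0 < B -> 2 * (2 * Cv * B0) <= B ->
  expR (- (lam - eps)) + 8 * (2 * Cv * B0 / B) <= rho -> rho <= 1 ->
  forall c n p, `|qwt m phi L M N0 w c n p| <= 4 / rho ^+ 2 * B ^+ p * rho ^+ n.+1.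
Proof.
move=> gw Bp B1B rho_ge rho1 c n p.
apply: (weight_bound (qL_ig HL w) (qtau_meas T_meas w) (@qL_dual _ _ _ _ _ _ _ _ HL w)
  (qphi_b obs_meas M0 N0 w) Hv (K := fun j => K (shiftZ j%:Z w))
  (h := fun j => h (shiftZ j%:Z w)) eps_lam B00 Bp B1B rho_ge).
- by move=> j; exact: ltW.
- by move=> j r; have [s _ _ _ _] := gw j; have := s r; rewrite shiftZD -PoszD.
- by move=> j; exact: qphi_bvle.
- by move=> j r u c' uc u0; rewrite -lit_shift; have [_ _ dc _ _] := gw j; exact: dc.
- by move=> j; have [_ _ _ [? _ _] _] := gw j.
- move=> j; have [_ _ _ [_ _ he] _] := gw j.
  by move: he; rewrite shiftZD qL_shift addn0 -[j.+1]addn1 PoszD.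
- by move=> j r; rewrite -lit_shift; have [_ _ _ _ d1] := gw j; exact: d1.
- exact: rho1.
Qed.

End GoodCocycle.

(** * Moments with respect to the skew product measure *)

Lemma ae_nonsingular (R : realType) (d : measure_display) (X : measurableType d)
  (m : probability X R) (f : X -> X) (Q : X -> Prop) : nonsingular m f ->
  (\forall x \ae m, Q x) -> \forall x \ae m, Q (f x).
Proof.
move=> [mf nf] [N [mN N0 QN]]; exists (f @^-1` N); split.
- by rewrite -[X in measurable X]setTI; exact: mf.
- exact: nf.
- by move=> x nQ; exact: QN.
Qed.

Section Orbits.
Variables (R : realType) (d : measure_display) (X : measurableType d).
Variables (m : probability X R).
Variables (l : nat -> (X -> R) -> X -> R) (tau : nat -> X -> X).
Notation ig f := (m.-integrable setT (EFin \o f)).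
Hypothesis tau_ns : forall j, nonsingular m (tau j).
Hypothesis l_ig : forall j u, ig u -> ig (l j u).
Hypothesis l_dual : forall j u g, ig u -> bmeas g ->
  \int[m]_x (l j u x * g x) = \int[m]_x (u x * g (tau j x)).

Lemma orbit_map_ae a n (Q : X -> Prop) :
  (\forall x \ae m, Q x) -> \forall x \ae m, Q (orbit_map tau a n x).
Proof.
elim: n Q => // n IH Q hQ; apply: (IH (fun y => Q (tau (a + n) y))).
exact: ae_nonsingular.
Qed.

Lemma lit_dual a n u g : ig u -> bmeas g ->
  \int[m]_x (lit l a n u x * g x) = \int[m]_x (u x * g (orbit_map tau a n x)).
Proof.
move=> iu; elim: n g => //= n IH g bg.
rewrite l_dual//; last exact: lit_ig.
by rewrite (IH (fun y => g (tau (a + n) y)))//; apply: bmeas_comp bg; case: (tau_ns (a + n)).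
Qed.

End Orbits.

Section SkewProductMoments.
Variables (R : realType) (dX dY : measure_display).
Variables (X : measurableType dX) (Y : measurableType dY).
Variables (m : probability X R) (v : (X -> R[i]) -> \bar R) (Cv : R).
Variables (P : probability (seqspace Y) R).
Variables (T : Y -> X -> X) (L : seqspace Y -> (X -> R[i]) -> X -> R[i]).
Variables (h : seqspace Y -> X -> R) (K : seqspace Y -> R) (phi : Y -> X -> R).
Variable mu : probability (seqspace Y * X)%type R.
Variables (lam eps B0 : R).
Hypothesis Hv : is_variation m v Cv.
Hypothesis T_ns : forall y, nonsingular m (T y).
Hypothesis skew_meas : measurable_fun setT (@skew_product _ _ X Y T).
Hypothesis obs_meas : measurable_fun setT (@observable R _ _ X Y phi).
Hypothesis HL : forall w, is_transfer m (T (w 0)) (L w).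
Hypothesis K1 : forall w, 1 < K w.
Hypothesis h_equiv : is_equivariant_density m v P L h.
Hypothesis mu_skew : is_skew_measure m P h mu.
Variables (dS : measure_display) (S : measurableType dS) (PP : probability S R).
Variable xi : int -> S -> Y.
Hypothesis xi_stat : is_stationary PP xi.
Hypothesis xi_law : is_law PP xi P.
Hypotheses (eps0 : 0 < eps) (eps_lam : eps < lam) (B00 : 0 <= B0).
Hypothesis good_ae : \forall w \ae P, good_path m v L h K phi lam eps B0 w.
Notation ig f := (m.-integrable setT (EFin \o f)).
Notation good := (good_path m v L h K phi lam eps B0).

Let M := Cv * B0.
Let Cv0 : 0 <= Cv. Proof. by apply: le_trans (V3_ge1 Hv). Qed.
Let M0 : 0 <= M. Proof. exact: mulr_ge0. Qed.
Let K0 w : 0 < K w. Proof. exact: lt_trans (K1 w). Qed.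
Let T_meas y : measurable_fun setT (T y). Proof. by case: (T_ns y). Qed.
Let qtau_ns w j : nonsingular m (qtau T w j). Proof. exact: T_ns. Qed.

(** h is nonnegative only over almost every w, while [density_integral] takes a density that is
    nonnegative everywhere. *)
Let absh (z : seqspace Y * X) := `|h z.1 z.2|.

Let absh_meas : measurable_fun setT absh.
Proof. by apply: measurableT_comp => //; case: h_equiv. Qed.

Let absh_ge0 z : 0 <= absh z. Proof. exact: normr_ge0. Qed.

Definition nonneg_at (w : seqspace Y) := forall x, 0 <= h w x.

Lemma nonneg_at_ae : \forall w \ae P, nonneg_at w.
Proof. by case: h_equiv => _; apply: filterS => w []. Qed.

Let mu_absh A : measurable A -> mu A = (\int[(P \x m)%E]_(z in A) (absh z)%:E)%E.
Proof.
move=> mA; rewrite mu_skew// [RHS]integral_mkcond fubini_tonelli1; last 2 first.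
- apply/(measurable_restrictT _ mA)/measurable_EFinP.
  exact: measurable_funTS.
- by move=> z; rewrite patchE; case: (z \in A); rewrite ?lee_fin.
have mh : measurable_fun setT (fun z : seqspace Y * X => (h z.1 z.2)%:E).
  by apply/measurable_EFinP; case: h_equiv.
set g := (fun z : seqspace Y * X => (h z.1 z.2)%:E) \_ A.
have mg : measurable_fun setT g.
  by apply/(measurable_restrictT _ mA); exact: measurable_funTS.
have gE w : (\int[m]_(x in xsection A w) (h w x)%:E = \int[m]_x g (w, x))%E.
  rewrite integral_mkcond; apply: eq_integral => x _.
  by rewrite /g !patchE mem_xsection.
under eq_integral do rewrite gE.
apply: ae_eq_integral => //.
- rewrite (_ : (fun w => _) = fun w =>
      (fubini_F m g^\+ w - fubini_F m g^\- w)%E); last first.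
    apply/funext => w; rewrite [LHS]integralE /fubini_F/=.
    by congr (_ - _)%E; apply: eq_integral => x _; rewrite ?funeposE ?funenegE.
  apply: emeasurable_funB; apply: measurable_fun_fubini_tonelli_F => //.
  + exact: measurable_funepos.
  + exact: measurable_funeneg.
- apply: measurable_fun_fubini_tonelli_F => //; last by move=> z; rewrite patchE; case: (z \in A); rewrite ?lee_fin.
  apply/(measurable_restrictT _ mA)/measurable_EFinP; exact: measurable_funTS.
- apply: filterS nonneg_at_ae => w nw _; apply: eq_integral => x _.
  by rewrite /g !patchE /absh/= ger0_norm.
Qed.

Lemma skew_integral f : bmeas f ->
  \int[mu]_z f z = \int[P]_w \int[m]_x (f (w, x) * `|h w x|).
Proof.
move=> bf; have [iH H] := density_integral absh_meas absh_ge0 mu_absh.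
by rewrite H// Rfubini//; exact: igM.
Qed.

Lemma skew_inner_ig f : bmeas f ->
  P.-integrable setT (EFin \o (fun w => \int[m]_x (f (w, x) * `|h w x|))).
Proof.
move=> bF; have [iH _] := density_integral absh_meas absh_ge0 mu_absh.
have iFH := igM bF iH.
apply: (le_integrable measurableT _ _ (integrable_fubini_F iFH)).
  apply/measurable_EFinP.
  by apply: measurableT_comp => //; exact: (measurable_fubini_F iFH).
have fine_le (y : \bar R) : (`|(fine y)%:E| <= `|y|)%E.
  by case: y => //=; rewrite normr0 leey.
by move=> w _; exact: fine_le.
Qed.

Lemma skew_integral_ae f g : bmeas f -> bmeas g ->
  (\forall w \ae P, \forall x \ae m, f (w, x) = g (w, x)) ->
  \int[mu]_z f z = \int[mu]_z g z.
Proof.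
move=> bf bg fg; rewrite (skew_integral bf) (skew_integral bg); apply: Rint_ae.
- exact: skew_inner_ig.
- exact: skew_inner_ig.
apply: filterS2 fg good_ae => w fg gw.
have iah : ig (fun x => `|h w x|).
  have [_ _ _ [+ _ _] _] := gw 0%N; rewrite shiftZ0 => /integrable_norm.
  exact: eq_integrable.
apply: Rint_ae; [exact: igM (bmeas_section _ bf) _ | exact: igM (bmeas_section _ bg) _ |].
by apply: filterS fg => x ->.
Qed.

(** Split 1 = (1 - h) + h; by equivariance the second part is carried to the density at time j. *)
Lemma density_shift w j : good w -> nonneg_at (shiftZ j%:Z w) ->
  [/\ ig (fun x => `|h (shiftZ j%:Z w) x|), \int[m]_x `|h (shiftZ j%:Z w) x| = 1 &
      \forall x \ae m, lit (qL L w) 0 j (fun=> 1) x =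
        lit (qL L w) 0 j (fun x => 1 - h w x) x + `|h (shiftZ j%:Z w) x|].
Proof.
move=> gw hn.
have -> : (fun x => `|h (shiftZ j%:Z w) x|) = h (shiftZ j%:Z w).
  by apply/funext => x; rewrite ger0_norm.
have ih i : ig (h (shiftZ i%:Z w)) by have [_ _ _ [? _ _] _] := gw i.
have [_ _ _ [_ h1 _] _] := gw j.
split=> //.
have ih0 : ig (h w) by have := ih 0%N; rewrite shiftZ0.
have i1 : ig (fun x => 1 - h w x) by apply: igB => //; exact/ig_bmeas/bmeas_cst.
have E := lit_add (qL_ig HL w) (qtau_meas T_meas w) (@qL_dual _ _ _ _ _ _ _ _ HL w) 0 j i1 ih0.
have Eh : \forall x \ae m, lit (qL L w) 0 j (h w) x = h (shiftZ j%:Z w) x.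
  elim: j {hn h1 E} => [|j IH]; first by apply: aeW => x; rewrite /= shiftZ0.
  have e1 := l_ae (qL_ig HL w) (qtau_meas T_meas w) (@qL_dual _ _ _ _ _ _ _ _ HL w) j
    (lit_ig (qL_ig HL w) 0 j ih0) (ih j) IH.
  have [_ _ _ [_ _ he] _] := gw j.
  apply: filterS2 e1 he => x; rewrite /= add0n shiftZD qL_shift addn0 => ->.
  by rewrite -[j.+1]addn1 PoszD.
apply: filterS2 E Eh => x E Eh; rewrite ger0_norm// -Eh -E.
by congr (lit _ _ _ _ x); apply/funext => y; rewrite subrK.
Qed.

Variable n : nat.

Definition skew_pow (q : nat) (z : seqspace Y * X) : R :=
  orbit_sum (qtau T z.1) (qphi phi M 0 z.1) 0 n z.2 ^+ q / q`!%:R.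

Lemma skew_pow_b q : bmeas (skew_pow q).
Proof. exact: joint_pow_b. Qed.

Lemma orbit_map_shift w N i x : orbit_map (qtau T w) 0 (N + i) x =
  orbit_map (qtau T (shiftZ N%:Z w)) 0 i (orbit_map (qtau T w) 0 N x).
Proof.
elim: i => [|i IH]; first by rewrite addn0.
by rewrite addnS /= IH /qtau /shiftZ !add0n PoszD addrC.
Qed.

Lemma orbit_sum_shift w N i x : orbit_sum (qtau T w) (qphi phi M N w) 0 (N + i) x =
  orbit_sum (qtau T (shiftZ N%:Z w)) (qphi phi M 0 (shiftZ N%:Z w)) 0 i
    (orbit_map (qtau T w) 0 N x).
Proof.
elim: i => [|i IH]; first by rewrite addn0 orbit_sum_inactive.
rewrite addnS /= IH orbit_map_shift; congr (_ + _).
by rewrite /qphi !add0n leq_addr leq0n /shiftZ PoszD addrC.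
Qed.

(** Each summand has its own factor 1 / K, and slow variation of K brings all of them to time N at
    the price exp (eps n). *)
Lemma orbit_sum_small w N : good w ->
  \forall y \ae m, `|orbit_sum (qtau T (shiftZ N%:Z w)) (qphi phi M 0 (shiftZ N%:Z w)) 0 n y|
     <= n%:R * (Cv * B0 * expR (eps * n%:R)) / K (shiftZ N%:Z w).
Proof.
move=> gw; set w' := shiftZ _ w; have gw' : good w'.
  by move=> j; rewrite shiftZD -PoszD; exact: gw.
set c := Cv * B0 * expR (eps * n%:R) / K w'.
have c0 : 0 <= c by rewrite divr_ge0 ?mulr_ge0 ?expR_ge0// ltW.
have one i : (i < n)%N ->
    \forall y \ae m, `|qphi phi M 0 w' i (orbit_map (qtau T w') 0 i y)| <= c.
  move=> iltn; apply: (orbit_map_ae (qtau_ns w') 0 i (Q := fun y => `|qphi phi M 0 w' i y| <= c)).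
  have := bvle_sup Hv (qphi_bvle Hv obs_meas K1 B00 0 i gw'); apply: filterS => y.
  move=> /le_trans; apply; rewrite /c mulrA -!mulrA; do 2!apply: ler_wpM2l => //.
  have [s _ _ _ _] := gw' 0%N; have := s i; rewrite shiftZ0 => Ks.
  rewrite ler_pdivlMr// mulrC ler_pdivrMr//; apply: le_trans Ks _.
  rewrite mulrC ler_wpM2r ?(ltW (K0 _))// ler_expR ler_wpM2l ?(ltW eps0)//.
  by rewrite ler_nat ltnW.
suff H k : (k <= n)%N -> \forall y \ae m,
    `|orbit_sum (qtau T w') (qphi phi M 0 w') 0 k y| <= k%:R * c.
  by apply: filterS (H n (leqnn n)) => y; rewrite /c mulrA.
elim: k => [|k IH] kn; first by apply: aeW => y /=; rewrite normr0 mul0r.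
apply: filterS2 (IH (ltnW kn)) (one k kn) => y H1 H2 /=.
rewrite add0n -natr1 mulrDl mul1r; apply: le_trans (ler_normD _ _) _.
exact: lerD.
Qed.

Let rate := n%:R * (Cv * B0 * expR (eps * n%:R)).

(** By duality the delayed moment integrates [skew_pow] against the N-th image of 1, which differs
    from the equivariant density by the image of 1 - h, of norm at most K(w) exp (- lam N). K(w) is
    at most exp (eps N) K at time N, and that K is cancelled by the 1 / K of the sum. *)
Lemma moment_limit N q :
  `|\int[P]_w qmom m T phi M N w 0 (N + n) q - \int[mu]_z skew_pow q z|
    <= rate ^+ q * expR (- ((lam - eps) * N%:R)).
Proof.
(* In degree 0 there is no factor 1 / K to use, but both integrals are 1. *)
have [->|q0] := eqVneq q 0%N.
  rewrite (_ : (fun w => _) = fun=> 1); last by apply/funext => w; rewrite qmom0.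
  rewrite (_ : skew_pow 0 = fun=> 1); last first.
    by apply/funext => z; rewrite /skew_pow expr0 divr1.
  by rewrite !Rint_cst subrr normr0 mulr_ge0 ?expR_ge0.
have bF := skew_pow_b q; have [_ [C FC]] := bF.
have C0 : 0 <= C by exact: le_trans (normr_ge0 _) (FC point).
pose G w := \int[m]_x (skew_pow q (w, x) * `|h w x|).
have iG : P.-integrable setT (EFin \o G) := skew_inner_ig bF.
have mG := ig_measurable iG.
have bG := clip_bmeas C0 mG.
have bq := qmom_b m P skew_meas obs_meas M0 N 0 (N + n) q.
have nn_ae := ae_shift xi_stat xi_law nonneg_at_ae.
(* G is bounded by C only over good environments; the clipped version is bounded everywhere, so that
   [int_shift] applies to it. *)
have Gclip w : good w -> nonneg_at w -> clip C (G w) = G w.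
  move=> gw nw; apply: clip_id.
  have := @density_shift w 0 gw; rewrite shiftZ0 => /(_ nw)[ih h1 _].
  have bs := bmeas_section w bF.
  have ifh := igM bs ih.
  apply: le_trans (le_normr_Rintegral measurableT ifh) _.
  rewrite -[C]mulr1 -h1 -RintZ//; apply: Rint_ge0_le; [|exact: igZ|].
    by have := integrable_norm ifh; apply: eq_integrable.
  by apply: aeW => x; rewrite normrM normr_id ler_wpM2r.
have -> : \int[mu]_z skew_pow q z = \int[P]_w clip C (G (shiftZ N%:Z w)).
  rewrite skew_integral// (int_shift xi_stat xi_law N%:Z bG).
  apply: Rint_ae => //; first exact: ig_bmeas.
  by apply: filterS2 good_ae nonneg_at_ae => w gw nw; rewrite Gclip.
have bGs := bmeas_comp (shiftZ_measurable N%:Z) bG.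
rewrite -RintB; [|exact: ig_bmeas|exact: ig_bmeas].
apply: Rint_norm_ae; first by apply/ig_bmeas/bmeasB.
apply: filterS2 good_ae nn_ae => w gw nw.
set w' := shiftZ N%:Z w; have gw' : good w'.
  by move=> j; rewrite shiftZD -PoszD; exact: gw.
rewrite Gclip//; last exact: nw.
have [ih h1 lE] := @density_shift w N gw (nw N).
have bs : bmeas (fun y => skew_pow q (w', y)) := bmeas_section (w' : seqspace Y) bF.
have i1 : ig (fun _ : X => 1 : R) by exact/ig_bmeas/bmeas_cst.
have iu : ig (lit (qL L w) 0 N (fun x => 1 - h w x)).
  apply: (lit_ig (qL_ig HL w)); apply: igB => //.
  by have [_ _ _ [+ _ _] _] := gw 0%N; rewrite shiftZ0.
have -> : qmom m T phi M N w 0 (N + n) q =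
    \int[m]_x (skew_pow q (w', x) * lit (qL L w) 0 N (fun=> 1) x).
  under [RHS]eq_Rintegral do rewrite mulrC.
  rewrite (lit_dual (qtau_ns w) (qL_ig HL w) (@qL_dual _ _ _ _ _ _ _ _ HL w))//.
  apply: eq_Rintegral => x _.
  by rewrite orbit_sum_shift mul1r.
rewrite (_ : \int[m]_x _ - G w' =
    \int[m]_x (skew_pow q (w', x) * lit (qL L w) 0 N (fun x => 1 - h w x) x)); last first.
  rewrite (_ : \int[m]_x _ = \int[m]_x (skew_pow q (w', x) *
     lit (qL L w) 0 N (fun x => 1 - h w x) x + skew_pow q (w', x) * `|h w' x|)).
    by rewrite RintD ?addrK//; exact: igM.
  apply: Rint_ae.
  - by apply: igM => //; exact: (lit_ig (qL_ig HL w)).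
  - by apply: igD; exact: igM.
  - by apply: filterS lE => x ->; rewrite mulrDr.
have [s0 _ _ _ d1] := gw 0%N.
have := d1 N; rewrite shiftZ0 => uN.
have rate0 : 0 <= rate by rewrite !mulr_ge0 ?expR_ge0.
have fb : \forall x \ae m, `|skew_pow q (w', x)| <= rate ^+ q / K w'.
  apply: filterS (orbit_sum_small N gw) => x H.
  rewrite /skew_pow normrM normrX (ger0_norm (_ : 0 <= q`!%:R^-1)) ?invr_ge0//.
  apply: (@le_trans _ _ ((rate / K w') ^+ q)).
    apply: le_trans (ler_piMr (exprn_ge0 q (normr_ge0 _)) _) _.
      by rewrite invf_le1 ?ltr0n ?fact_gt0// ler1n fact_gt0.
    by apply: lerXn2r H; rewrite ?nnegrE ?divr_ge0// ltW.
  rewrite expr_div_n ler_wpM2l ?exprn_ge0// lef_pV2 ?posrE ?exprn_gt0//.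
  by case: q q0 {bF FC G mG iG bG bq Gclip bGs bs} => // q _; rewrite exprS ler_peMr ?exprn_ege1// ltW.
apply: le_trans (bvle_pairing Hv bs fb _ uN) _; first by rewrite divr_ge0 ?exprn_ge0// ltW.
have := s0 N; rewrite shiftZ0 -/w' => Ks.
rewrite -!mulrA ler_wpM2l ?exprn_ge0// mulrA mulrC.
have -> : - ((lam - eps) * N%:R) = - (lam * N%:R) + eps * N%:R by ring.
by rewrite expRD ler_wpM2l ?expR_ge0// mulrC ler_pdivrMr// mulrC.
Qed.

Lemma BsumE w x : Bsum T phi n (w, x) =
  \sum_(i < n) phi (w i%:Z) (orbit_map (qtau T w) 0 i x).
Proof.
have iterE j : iter j (@skew_product _ _ X Y T) (w, x) =
    (shiftZ j%:Z w, orbit_map (qtau T w) 0 j x).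
  elim: j => [|j IH]; first by rewrite /= shiftZ0.
  rewrite iterS IH /skew_product /= shiftZD /qtau /shiftZ !add0r add0n.
  by rewrite -[j.+1]addn1 PoszD.
rewrite /Bsum big_mkord; apply: eq_bigr => i _.
by rewrite iterE /observable /= /shiftZ add0r.
Qed.

Lemma Bsum_measurable : measurable_fun setT (Bsum T phi n).
Proof.
apply: measurable_sum => j; apply: measurableT_comp obs_meas _.
by elim: j => [|j IH]; [exact: measurable_id | exact: measurableT_comp skew_meas IH].
Qed.

Definition skew_sum (z : seqspace Y * X) : R :=
  orbit_sum (qtau T z.1) (qphi phi M 0 z.1) 0 n z.2.

Lemma skew_sum_b : bmeas skew_sum.
Proof.
have := skew_pow_b 1; rewrite /skew_pow; congr bmeas; apply/funext => z.
by rewrite expr1 divr1.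
Qed.

Lemma Bsum_ae : \forall w \ae P, \forall x \ae m, Bsum T phi n (w, x) = skew_sum (w, x).
Proof.
apply: filterS good_ae => w gw.
suff H i : \forall x \ae m, \sum_(j < i) phi (w j%:Z) (orbit_map (qtau T w) 0 j x) =
    orbit_sum (qtau T w) (qphi phi M 0 w) 0 i x.
  by apply: filterS (H n) => x; rewrite BsumE.
elim: i => [|i IH]; first by apply: aeW => x; rewrite big_ord0.
have := orbit_map_ae (qtau_ns w) 0 i (clip_phi_ae Hv K1 B00 i gw).
apply: filterS2 IH => x IH E; rewrite big_ord_recr/= IH.
by rewrite /qphi leq0n !add0n E.
Qed.

Lemma cumulant_skew_sum k : cumulant mu (Bsum T phi n) k = cumulant mu skew_sum k.
Proof.
rewrite /cumulant (_ : char_fun mu (Bsum T phi n) = char_fun mu skew_sum)//.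
have [ms _] := skew_sum_b.
have bc (W : seqspace Y * X -> R) t : measurable_fun setT W -> bmeas (fun z => cos (t * W z)).
  move=> mW; split; last by exists 1 => z; rewrite ler_norml cos_geN1 cos_le1.
  apply: measurableT_comp; first by apply: continuous_measurable_fun; exact: continuous_cos.
  exact: measurable_funM.
have bs (W : seqspace Y * X -> R) t : measurable_fun setT W -> bmeas (fun z => sin (t * W z)).
  move=> mW; split; last by exists 1 => z; rewrite ler_norml sin_geN1 sin_le1.
  apply: measurableT_comp; first by apply: continuous_measurable_fun; exact: continuous_sin.
  exact: measurable_funM.
have mB := Bsum_measurable.
apply/funext => t; rewrite /char_fun; congr Complex; apply: skew_integral_ae; auto.
- by apply: filterS Bsum_ae => w; apply: filterS => x ->.
- by apply: filterS Bsum_ae => w; apply: filterS => x ->.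
Qed.

End SkewProductMoments.

(** * Choice of the constants *)

Lemma gas_constants (R : realType) (A B rho C3 : R) :
  0 <= A -> 0 <= B -> 0 < rho -> rho < 1 -> 0 <= C3 ->
  exists (C sig : R), [/\ 0 < C, sig < 1 & forall m : R, 1 <= m -> exists th : R,
    [/\ 0 <= th /\ th <= 2^-1, 2 * th * m <= 1, B / (C * m) <= 2^-1,
        rho * expR (2 * th) <= sig &
        A * expR 1 * (2 * (B / (C * m))) / (1 - sig) * (8 * m) <= 2^-1 /\
        2 * C3 * (A * expR 1 * (2 * (B / (C * m))) / (1 - sig)) <= th]].
Proof.
move=> A0 B0 rho0 rho1 C30.
pose sig := (1 + rho) / 2; have sig1 : sig < 1 by rewrite /sig; lra.
have rs : rho < sig by rewrite /sig; lra.
(* Makes rho exp (2 th0) <= sig; the actual th is th0 / m, so that growth over one unit of gap stays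
   bounded whatever m is. *)
pose th0 := Num.min 2^-1 (ln (sig / rho) / 2).
have th0_gt0 : 0 < th0.
  by rewrite lt_min invr_gt0 ltr0n/= divr_gt0// ln_gt0// ltr_pdivlMr// mul1r.
have th0_half : th0 <= 2^-1 by rewrite ge_min lexx.
have th0_ln : 2 * th0 <= ln (sig / rho).
  have : th0 <= ln (sig / rho) / 2 by rewrite ge_min lexx orbT.
  by move: (ln _) th0 {th0_gt0 th0_half} => x y; lra.
pose k0 := A * expR 1 * (2 * B) / (1 - sig).
have k00 : 0 <= k0.
  by rewrite /k0 divr_ge0 ?subr_ge0 ?(ltW sig1)// !mulr_ge0// expR_ge0.
(* The radius is C m, and [kappa1] becomes k0 / (C m). The summands after 1 serve, in order, B / (C
   m) <= 1/2, kappa = 8 k0 / C <= 1/2 and 2 C3 kappa1 <= th0 / m. *)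
pose C := 1 + 2 * B + 16 * k0 + 2 * C3 * k0 / th0.
have last0 : 0 <= 2 * C3 * k0 / th0.
  by apply: divr_ge0; [exact: mulr_ge0 (mulr_ge0 _ C30) k00 | exact: ltW].
have [C0 CB Ck CC3] : [/\ 0 < C, 2 * B <= C, 16 * k0 <= C & 2 * C3 * k0 / th0 <= C].
  by move: B0 k00 last0; rewrite /C; move: (2 * C3 * k0 / th0) => z *; split; lra.
have sr0 : 0 < sig / rho by rewrite divr_gt0// (lt_trans rho0).
exists C, sig; split=> // m m1; have m0 : 0 < m by lra.
have kE : A * expR 1 * (2 * (B / (C * m))) / (1 - sig) = k0 / C / m.
  by rewrite /k0; field; rewrite !gt_eqF//= subr_gt0.
have minv : m^-1 <= 1 by rewrite invf_le1.
have minv0 : 0 <= m^-1 by rewrite invr_ge0 ltW.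
exists (th0 / m); rewrite kE; split.
- split; first by rewrite divr_ge0// ltW.
  by apply: le_trans th0_half; rewrite ler_piMr// ltW.
- by rewrite mulrA divfK ?gt_eqF//; lra.
- rewrite ler_pdivrMr ?mulr_gt0//.
  have : C <= C * m by rewrite ler_peMr// ltW.
  by move: (C * m) => z; lra.
- apply: (@le_trans _ _ (rho * (sig / rho))); last by rewrite mulrC divfK// gt_eqF.
  rewrite ler_pM2l// -[leRHS]lnK ?posrE//.
  rewrite ler_expR; apply: le_trans th0_ln.
  by rewrite ler_pM2l// ler_piMr// ltW.
- split.
    have -> : k0 / C / m * (8 * m) = 8 * k0 / C by field; rewrite !gt_eqF.
    by rewrite ler_pdivrMr//; lra.
  by rewrite mulrA ler_wpM2r// mulrA ler_pdivrMr// [leRHS]mulrC -ler_pdivrMr.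
Qed.

Lemma ln_le_powR (R : realType) (eta y : R) : 0 < eta -> 0 < y -> eta * ln y <= y `^ eta.
Proof.
move=> eta0 y0; rewrite -ln_powR; have p : 0 < y `^ eta by rewrite powR_gt0.
have := @le_ln1Dx R (y `^ eta - 1); rewrite addrCA subrr addr0 => H.
by have := H _; move: p; move: (y `^ eta) => z p /(_ ltac:(lra)); lra.
Qed.

(* The gap length is measured in units of [k ^ (1 / eta)]: this is where the
   exponent of [k!] comes from. *)
Lemma mixing_rate_bound (R : realType) (c1 c2 eta : R) : 0 < c1 -> 0 < c2 -> 0 < eta ->
  exists C1 : R, 1 <= C1 /\ forall k n : nat, (0 < k)%N ->
    4 * (c1 * expR (- (c2 * n%:R `^ eta))) <=
      Num.max 1 (4 * c1) / Yg (C1 * k%:R `^ eta^-1) n ^+ (3 * k).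
Proof.
move=> c10 c20 eta0.
(* Chosen so that c2 C1^eta >= 3 / eta: a gap of y > 1 units then has exponent c2 n^eta >= (3 / eta)
   k y^eta >= 3 k ln y. *)
pose a := 3 / (eta * c2); have a0 : 0 < a by rewrite divr_gt0// mulr_gt0.
pose C1 := 1 + a `^ eta^-1; have C11 : 1 <= C1 by rewrite lerDl powR_ge0.
have C1a : a <= C1 `^ eta.
  have -> : a = (a `^ eta^-1) `^ eta.
    by rewrite -powRrM mulVf ?gt_eqF// powRr1// ltW.
  apply: ge0_ler_powR; rewrite ?nnegrE ?powR_ge0 ?(ltW eta0)//; first by lra.
  by rewrite lerDr.
exists C1; split=> // k n k0; set m := C1 * _.
have kp : 0 < (k%:R : R) by rewrite ltr0n.
have m0 : 0 < m by rewrite mulr_gt0 ?powR_gt0//; lra.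
set C3 := Num.max _ _; have C34 : 4 * c1 <= C3 by rewrite le_max lexx orbT.
have C30 : 0 < C3 by rewrite lt_max ltr01.
rewrite /Yg; have [ym|my] := leP (n%:R / m) 1.
  rewrite expr1n divr1; apply: le_trans C34.
  rewrite mulrA ler_piMr ?mulr_ge0 ?(ltW c10)// -expR0 ler_expR oppr_le0.
  by rewrite mulr_ge0 ?powR_ge0// ltW.
set y := n%:R / m; have y0 : 0 < y by exact: lt_trans my.
have nE : n%:R = m * y by rewrite /y mulrC divfK// gt_eqF.
rewrite mulrA ler_pM ?mulr_ge0 ?expR_ge0// ?(ltW c10)//.
rewrite -[y]lnK ?posrE// -expRM_natl -expRN ler_expR lerN2.
have -> : n%:R `^ eta = C1 `^ eta * k%:R * y `^ eta.
  rewrite nE powRM ?(ltW m0) ?(ltW y0)// /m powRM ?powR_ge0//; last by lra.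
  by rewrite -[(k%:R `^ eta^-1) `^ eta]powRrM mulVf ?gt_eqF// powRr1.
have ly := ln_le_powR eta0 y0.
have h1 : 3 / eta <= c2 * C1 `^ eta.
  rewrite [leRHS]mulrC -ler_pdivrMr//; apply: le_trans C1a.
  by rewrite /a invfM mulrA.
have p0 : 0 <= y `^ eta by exact: powR_ge0.
apply: (@le_trans _ _ (3 / eta * k%:R * y `^ eta)); last first.
  by rewrite !mulrA; do 2!apply: ler_wpM2r => //.
rewrite natrM mulrAC [3 / eta * _ * _]mulrAC ler_wpM2r//.
by rewrite -mulrA ler_wpM2l// mulrC ler_pdivlMr// mulrC.
Qed.

Lemma cvg_geometric_error (R : realType) (u : nat -> R) (l C x : R) : `|x| < 1 ->
  (forall N, `|u N - l| <= C * x ^+ N) -> u N @[N --> \oo] --> l.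
Proof.
move=> x1 H; apply/subr_cvg0; apply/norm_cvg0P.
apply: (@squeeze_cvgr _ _ _ R (fun=> 0) (fun N => C * x ^+ N)).
- by apply: nearW => N; rewrite normr_ge0 H.
- exact: cvg_cst.
- by rewrite -[X in _ --> X](mulr0 C); apply: cvgM; [exact: cvg_cst | exact: cvg_expr].
Qed.

(** Each coefficient of an inverse is a polynomial in finitely many coefficients of the series, so
    coefficientwise convergence passes to inverses by strong induction. *)
Lemma log_derivative_cvg (R : realType) (Z Zi : nat -> fps R) (M Mi : fps R) (k : nat) :
  (forall N, Z N 0%N = 1) -> M 0%N = 1 ->
  (forall N, Z N * Zi N = 1) -> M * Mi = 1 ->
  (forall q, Z N q @[N --> \oo] --> M q) ->
  (fpsD (Z N) * Zi N) k @[N --> \oo] --> (fpsD M * Mi) k.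
Proof.
move=> Z0 M0 ZZi MMi ZM.
have inv_rec (f g : fps R) : f 0%N = 1 -> f * g = 1 -> forall q,
    g q = (q == 0)%:R - \sum_(i < q) f i.+1 * g (q - i.+1)%N.
  move=> f0 fg q; have := congr1 (fun u : fps R => u q) fg.
  rewrite fpsME fps1E big_ord_recl/= f0 mul1r subn0 => <-.
  by rewrite addrK.
have cvgS n (F : nat -> 'I_n -> R) (G : 'I_n -> R) :
    (forall i, F N i @[N --> \oo] --> G i) ->
    (\sum_(i < n) F N i) @[N --> \oo] --> \sum_(i < n) G i.
  by move=> FG; apply: cvg_big => // -[x y]; exact: add_continuous.
have ZiM q : Zi N q @[N --> \oo] --> Mi q.
  elim/ltn_ind: q => q IH; rewrite (inv_rec _ _ M0 MMi).
  under eq_fun do rewrite (inv_rec _ _ (Z0 _) (ZZi _)).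
  apply: cvgB; first exact: cvg_cst.
  apply: cvgS => i; apply: cvgM; first exact: ZM.
  by apply: IH; have := ltn_ord i; lia.
rewrite fpsME; under eq_fun do rewrite fpsME.
apply: cvgS => i; apply: cvgM; last exact: ZiM.
by rewrite /fpsD; apply: cvgM; [exact: cvg_cst | exact: ZM].
Qed.

Lemma expn_le_fact (R : realType) (k : nat) : (0 < k)%N ->
  k%:R ^+ k <= expR k%:R * k`!%:R :> R.
Proof.
case: k => // k _; rewrite -ler_pdivrMr ?ltr0n ?fact_gt0//.
by apply: le_trans (expR_ge1Dxn k (ler0n R k.+1)); rewrite lerDr.
Qed.

(** (k - 1)! k = k!, and k^k <= e^k k! turns the power k^(gam k) into (k!)^gam. The cube comes from
    k <= 3 (k - 2) for k >= 3. *)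
Lemma factorial_power_bound (R : realType) (C gam x : R) (k n : nat) : (3 <= k)%N ->
  0 <= C -> 0 <= gam -> `|x| <= n%:R * k%:R * (C * k%:R `^ gam) ^+ k ->
  (k.-1)`!%:R * `|x| <=
    n%:R * k`!%:R `^ (1 + gam) * (Num.max 1 (C * expR gam) ^+ 3) ^+ (k - 2).
Proof.
move=> k3 C0 g0 xle; have k0 : (0 < k)%N by exact: leq_trans k3.
have f0 : 0 < (k`!%:R : R) by rewrite ltr0n fact_gt0.
have -> : k`!%:R `^ (1 + gam) = k`!%:R * k`!%:R `^ gam :> R.
  by rewrite powRD ?powRr1 ?(ltW f0)// (gt_eqF f0) implybT.
have fE : k`!%:R = k%:R * (k.-1)`!%:R :> R by rewrite -natrM -{1 2}(prednK k0) factS.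
apply: (@le_trans _ _ (n%:R * k`!%:R * (C * k%:R `^ gam) ^+ k)).
  rewrite fE; apply: le_trans (ler_wpM2l _ xle) _; first exact: ler0n.
  by rewrite le_eqVlt; apply/orP; left; apply/eqP; ring.
rewrite -!mulrA ler_wpM2l// ler_wpM2l ?(ltW f0)//.
have -> : (C * k%:R `^ gam) ^+ k = C ^+ k * (k%:R ^+ k) `^ gam.
  rewrite exprMn; congr (_ * _).
  by rewrite -[LHS]powR_mulrn ?powR_ge0// -(powR_mulrn k (ler0n R k)) -!powRrM mulrC.
apply: (@le_trans _ _ (C ^+ k * (expR k%:R * k`!%:R) `^ gam)).
  apply: ler_wpM2l; first exact: exprn_ge0.
  apply: ge0_ler_powR; rewrite ?nnegrE ?exprn_ge0 ?mulr_ge0 ?expR_ge0 ?(ltW f0)//.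
  exact: expn_le_fact.
rewrite powRM ?expR_ge0 ?(ltW f0)// mulrCA mulrA mulrC ler_wpM2l ?powR_ge0//.
have -> : expR k%:R `^ gam * C ^+ k = (C * expR gam) ^+ k.
  rewrite exprMn mulrC; congr (_ * _).
  by rewrite -expRM_natl /powR gt_eqF ?expR_gt0// expRK mulrC.
have c1 : 1 <= Num.max 1 (C * expR gam) by rewrite le_max lexx.
apply: (@le_trans _ _ (Num.max 1 (C * expR gam) ^+ k)).
  apply: lerXn2r; last by rewrite le_max lexx orbT.
    by rewrite nnegrE mulr_ge0 ?expR_ge0.
  by rewrite nnegrE (le_trans _ c1).
rewrite -exprM; apply: ler_weXn2l => //; move: k3; clear; lia.
Qed.

(** * The annealed bound and the limit of large delay *)

Section AnnealedBound.
Variables (R : realType) (dX dY : measure_display).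
Variables (X : measurableType dX) (Y : measurableType dY).
Variables (m : probability X R) (P : probability (seqspace Y) R).
Variables (T : Y -> X -> X) (L : seqspace Y -> (X -> R[i]) -> X -> R[i]).
Variables (phi : Y -> X -> R) (M : R) (N0 : nat).
Hypothesis T_meas : forall y, measurable_fun setT (T y).
Hypothesis skew_meas : measurable_fun setT (@skew_product _ _ X Y T).
Hypothesis obs_meas : measurable_fun setT (@observable R _ _ X Y phi).
Hypothesis HL : forall w, is_transfer m (T (w 0)) (L w).
Hypothesis M0 : 0 <= M.
Variables (dS : measure_display) (S : measurableType dS) (PP : probability S R).
Variable xi : int -> S -> Y.
Hypothesis xi_stat : is_stationary PP xi.
Hypothesis xi_law : is_law PP xi P.
Variable al : nat -> R.
Hypothesis al_le : forall n, (alpha_mix PP xi n <= (al n)%:E)%E.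
Variables (A B rho : R).
Hypotheses (A0 : 0 <= A) (B0 : 0 <= B) (rho0 : 0 <= rho).
Hypothesis wt_le : \forall w \ae P, forall c n p,
  `|qwt m phi L M N0 w c n p| <= A * B ^+ p * rho ^+ n.+1.
Variables (k : nat) (C3 mm sig Rad th : R).
Hypothesis C31 : 1 <= C3.
Hypothesis al_gap : forall g, 4 * al g <= C3 / Yg mm g ^+ (3 * k).
Hypotheses (mm1 : 1 <= mm) (Rad0 : 0 < Rad) (th0 : 0 <= th) (th_half : th <= 2^-1).
Hypotheses (thm : 2 * th * mm <= 1) (x_half : B / Rad <= 2^-1).
Hypotheses (sigE : rho * expR (2 * th) <= sig) (sig1 : sig < 1).
Hypothesis kap : 2 * A * expR 1 * (2 * (B / Rad)) / (1 - sig) * (8 * mm) <= 2^-1.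
Hypothesis kap1 : 2 * C3 * (2 * A * expR 1 * (2 * (B / Rad)) / (1 - sig)) <= th.

Definition annealed (n : nat) : fps R := Zann P (fun n w => qmom m T phi M N0 w 0 n) n.

Lemma annealed0 n : annealed n 0%N = 1.
Proof.
by rewrite /annealed /Zann; under eq_Rintegral do rewrite qmom0; rewrite Rint_cst.
Qed.

Lemma annealed_start n : (n <= N0)%N -> annealed n = 1.
Proof.
move=> nN; apply/funext => q; rewrite /annealed /Zann.
by under eq_Rintegral do rewrite qmom_inactive//; rewrite Rint_cst.
Qed.

Lemma annealed_log_derivative (Zi : nat -> fps R) n :
  (forall n, annealed n * Zi n = 1) ->
  `|(fpsD (annealed n) * Zi n) k| <= (n - N0)%:R * k%:R * Rad ^+ k.
Proof.
move=> ZiE; pose V := qV m phi L M N0 A B rho.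
have pb c f : past c f -> @bmeas R _ (seqspace Y) f by case.
have fb c f : future c f -> @bmeas R _ (seqspace Y) f by case.
have C30 : 0 <= C3 by exact: le_trans C31.
have A20 : 0 <= 2 * A by exact: mulr_ge0.
have VF := qV_future P T_meas skew_meas obs_meas HL M0 N0 A0 B0 rho0.
have VL := qV_le m phi L M N0 A0 B0 rho0.
have VP := qV_past P T_meas skew_meas obs_meas HL M0 N0 A0 B0 rho0.
apply: (gas_log_derivative A20 B0 rho0 mm1 Rad0 C30 th0 th_half thm x_half sigE sig1
  kap kap1 (Z := annealed) (e := fam_cumulant P V)) => //.
- exact: annealed_start.
- exact: annealed0.
- move=> j q qk; apply: (Zann_rec pb).
  + by move=> i q'; exact: qmom_b.
  + by move=> w; exact: qmom_start.
  + by move=> i w; exact: qmom0.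
  + apply: filterS wt_le => w H i q'.
    exact: (qmom_rec T_meas obs_meas HL M0 H).
  + exact: VP.
  + exact: qk.
- move=> j c p t ok _.
  have cov c1 c' (f g : seqspace Y -> R) (F G : R) : (c1 <= c')%N -> past c1 f -> future c' g ->
      (forall w, `|f w| <= F) -> (forall w, `|g w| <= G) ->
      `|\int[P]_w (f w * g w) - \int[P]_w f w * \int[P]_w g w|
        <= F * G * (fun n => 4 * al n) (c' - c1)%N.
    exact: (cov_past_future xi_stat xi_law al_le).
  exact: (fam_cumulant_bound (k := k) pb fb (@past_le R _ Y) (@future_le R _ Y) (@past_step R _ Y)
    (@future_step R _ Y) cov VP VF VL C31 al_gap ok).
- exact: annealed_start.
Qed.

End AnnealedBound.

(* [c0] is chosen after [normphi], [c1], [c2], [eta] and the numerical constants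
   [Cv], [lambda], [eps'], [eps] of the set-up, before the system, the random
   variables and the observable. *)
Theorem theorem3p1 (R : realType)
  (Cv lambda eps' eps : R) (normphi c1 c2 eta : R) :
  0 < lambda -> 0 < eps' -> 0 < eps -> eps < lambda / 3 ->
  0 < c1 -> 0 < c2 -> 0 < eta ->
  exists c0 : R,
  forall (dX : measure_display) (X : measurableType dX) (m : probability X R)
    (v : (X -> R[i]) -> \bar R)
    (dS : measure_display) (S : measurableType dS) (PP : probability S R)
    (dY : measure_display) (Y : measurableType dY) (xi : int -> S -> Y)
    (P : probability (seqspace Y) R)
    (T : Y -> X -> X) (L : seqspace Y -> (X -> R[i]) -> (X -> R[i]))
    (Nv : seqspace Y -> R)
    (h : seqspace Y -> X -> R) (mu : probability (seqspace Y * X)%type R)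
    (D Dt K : seqspace Y -> R)
    (phi : Y -> X -> R),
  is_variation m v Cv ->
  (forall j, measurable_fun setT (xi j)) ->
  is_stationary PP xi ->
  is_law PP xi P ->
  is_ergodic P ->
  (forall y, nonsingular m (T y)) ->
  measurable_fun setT (@skew_product _ _ X Y T) ->
  (forall w, is_transfer m (T (w 0)) (L w)) ->
  good_cocycle m v P T L Nv ->
  is_equivariant_density m v P L h ->
  is_skew_measure m P h mu ->
  cocycle_bounds m v P L h lambda eps' D Dt ->
  is_adapted m v P h D Dt Nv eps K ->
  measurable_fun setT (@observable R _ _ X Y phi) ->
  ('E_mu[observable phi] = 0)%E ->
  normK m v P K phi = normphi%:E ->
  (forall n : nat, (alpha_mix PP xi n <= (c1 * expR (- (c2 * n%:R `^ eta)))%:E)%E) ->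
  forall k n : nat, (3 <= k)%N ->
    normc (cumulant mu (Bsum T phi n) k)
      <= n%:R * (k`!)%:R `^ (1 + eta^-1) * c0 ^+ (k - 2).
Proof.
move=> lam0 _ eps0 eps3 c10 c20 eta0.
have eps_lam : eps < lambda by lra.
pose x := expR (- (lambda - eps)).
have x0 : 0 < x by exact: expR_gt0.
have x1 : x < 1 by rewrite /x -[X in _ < X]expR0 ltr_expR oppr_lt0 subr_gt0.
pose rho := (1 + x) / 2.
have rho0 : 0 < rho by rewrite /rho; lra.
have rho1 : rho < 1 by rewrite /rho; lra.
pose B0 := `|normphi|; have B00 : 0 <= B0 by exact: normr_ge0.
(* The absolute value is a formality: Cv >= 1 becomes known only with the system, after [c0] is
   chosen. *)
pose b := `|Cv| * B0; have b0 : 0 <= b by rewrite mulr_ge0.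
(* With B1 = 2 b, the term 4 b gives 2 B1 <= B and the last term gives x + 8 B1 / B <= rho, the
   midpoint of x and 1. *)
pose B := 1 + 4 * b + 32 * b / (1 - x).
have Bx : 0 <= 32 * b / (1 - x) by rewrite divr_ge0 ?mulr_ge0// subr_ge0 ltW.
have Bp : 0 < B by rewrite /B; move: Bx; move: (32 * b / _) => z; lra.
have B4 : 4 * b <= B by rewrite /B; move: Bx; move: (32 * b / _) => z; lra.
have Brho : x + 16 * (b / B) <= rho.
  suff : 16 * (b / B) <= (1 - x) / 2 by rewrite /rho; move: (b / B) => z; lra.
  rewrite mulrA ler_pdivrMr// [leRHS]mulrC -ler_pdivrMr; last by rewrite divr_gt0// subr_gt0.
  rewrite invf_div mulrA [16 * b * 2](_ : _ = 32 * b); last by ring.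
  by rewrite /B; move: b0; move: (32 * b / _) => z; lra.
pose A := 4 / rho ^+ 2; have A0 : 0 <= A by rewrite divr_ge0// exprn_ge0// ltW.
pose C3 : R := Num.max 1 (4 * c1).
have C31 : 1 <= C3 by rewrite le_max lexx.
have [C [sig [C0 sig1 gasC]]] := @gas_constants R (2 * A) B rho C3
  (mulr_ge0 (ler0n R 2) A0) (ltW Bp) rho0 rho1 (le_trans ler01 C31).
have [C1 [C11 mixC]] := mixing_rate_bound c10 c20 eta0.
exists (Num.max 1 (C * C1 * expR eta^-1) ^+ 3).
move=> dX X m v dS S PP dY Y xi P T L Nv h mu D Dt K phi Hv mxi xi_stat xi_law _ T_ns
  skew_meas HL _ h_equiv mu_skew HD HK obs_meas _ nK al_le k n k3.
have k0 : (0 < k)%N by exact: leq_trans k3.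
have T_meas y : measurable_fun setT (T y) by case: (T_ns y).
have K1 w : 1 < K w by case: HK.
have Cv0 : 0 <= Cv by apply: le_trans (V3_ge1 Hv).
have bE : b = Cv * B0 by rewrite /b ger0_norm.
have good_ae := good_path_ae Hv T_meas obs_meas HL K1 xi_stat xi_law HK HD h_equiv nK (lexx B0).
pose mm := C1 * k%:R `^ eta^-1.
have mm1 : 1 <= mm.
  rewrite /mm -[leLHS]mulr1 ler_pM//.
  rewrite -[leLHS](powRr0 (k%:R : R)); apply: ler_powR; first by rewrite ler1n.
  by rewrite invr_ge0 ltW.
have [th [[th0 th_half] thm x_half sigE [kap kap1]]] := gasC mm mm1.
have Rad0 : 0 < C * mm by rewrite mulr_gt0// (lt_le_trans _ mm1).
pose Z N := annealed m P T phi (Cv * B0) N.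
have /choice[Zi ZiE] : forall N, exists f : nat -> fps R, forall j, Z N j * f j = 1.
  by move=> N; apply: gas_inverse => j; exact: annealed0.
(* Uniform in the delay N: the series equal 1 up to time N, so only n steps contribute. *)
have lim N : `|(fpsD (Z N (N + n)%N) * Zi N (N + n)%N) k| <=
    n%:R * k%:R * (C * mm) ^+ k.
  have wt_le : \forall w \ae P, forall c j p,
      `|qwt m phi L (Cv * B0) N w c j p| <= A * B ^+ p * rho ^+ j.+1.
    apply: filterS good_ae => w gw.
    apply: (qwt_bound Hv T_meas obs_meas HL K1 eps_lam B00 N gw Bp _ _ (ltW rho1)).
      by move: B4; rewrite bE; lra.
    by rewrite (_ : 8 * _ = 16 * (b / B))// bE; ring.
  have := annealed_log_derivative T_meas skew_meas obs_meas HL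
    (mulr_ge0 Cv0 B00) xi_stat xi_law al_le A0 (ltW Bp) (ltW rho0) wt_le C31
    (fun g => mixC k g k0) mm1 Rad0 th0 th_half thm x_half sigE sig1 kap kap1 (N + n) (ZiE N).
  by rewrite addKn.
pose W := skew_sum Cv T phi B0 n.
have bW : bmeas W by exact: (skew_sum_b Hv skew_meas obs_meas B00 n).
have M0 : moment_series mu W 0%N = 1.
  by rewrite /moment_series divr1; under eq_Rintegral do rewrite expr0; rewrite Rint_cst.
have [Mi MMi] := fps_inv M0.
have ZM q : Z N (N + n)%N q @[N --> \oo] --> moment_series mu W q.
  have -> : moment_series mu W q = \int[mu]_z skew_pow Cv T phi B0 n q z.
    rewrite /moment_series mulrC -RintZ; last exact/ig_bmeas/bmeasX.
    by apply: eq_Rintegral => z _; rewrite mulrC.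
  apply: (@cvg_geometric_error R (fun N => Z N (N + n)%N q) _
    ((n%:R * (Cv * B0 * expR (eps * n%:R))) ^+ q) x); first by rewrite gtr0_norm.
  move=> N; rewrite /x -expRM_natr mulNr.
  exact: (moment_limit Hv T_ns skew_meas obs_meas HL K1 h_equiv mu_skew xi_stat xi_law eps0
    B00 good_ae n N q).
have lam_cvg := @log_derivative_cvg R (fun N => Z N (N + n)%N) (fun N => Zi N (N + n)%N)
  _ _ k (fun N => annealed0 _ _ _ _ _ _ _) M0 (fun N => ZiE N (N + n)%N) MMi ZM.
have lam_le : `|(fpsD (moment_series mu W) * Mi) k| <= n%:R * k%:R * (C * mm) ^+ k.
  apply: (ler_cvg_to (cvg_norm lam_cvg) (cvg_cst _)).
  by apply: nearW => N; exact: lim.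
rewrite (cumulant_skew_sum Hv T_ns skew_meas obs_meas K1 h_equiv mu_skew B00 good_ae).
rewrite -{1}(prednK k0) (cumulantE bW k.-1 MMi) prednK//.
rewrite /= expr0n/= addr0 sqrtr_sqr normrM ger0_norm//.
apply: (factorial_power_bound (C := C * C1)) => //.
- by rewrite mulr_ge0 ?(ltW C0)// (le_trans _ C11).
- by rewrite invr_ge0 ltW.
- by move: lam_le; rewrite /mm mulrA.
Qed.
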